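(* Let $\Phi$ be an arbitrary positive number and let $S=\mathbb{R}\times(-1,1)$. Then the problem $$\left\{\begin{aligned}&-\Delta\mathbf{u}+(\mathbf{u}\cdot\nabla)\mathbf{u}+\nabla p=\mathbf{0}\quad\text{in }S,\\ &\nabla\cdot\mathbf{u}=0\quad\text{in }S,\\ &\mathbf{u}(x,\pm1)=\mathbf{0}\quad\forall x\in\mathbb{R},\\ &\int_{-1}^1\mathbf{u}(0,y)\cdot\mathbf{e}_1\,dy=\Phi\end{aligned}\right.$$ has one and only one solution $(\mathbf{u},p)$ with $\mathbf{u}\in\mathbb{X}^2$, $p\in H^1_{\mathrm{loc}}(S)$ (modulo additive constants), $\nabla p\in\mathbb{X}^0$, and $\mathbf{u}$ satisfying $(X1)$; it is given by the Poiseuille flow $$\mathbf{u}_\Phi(x,y)=\tfrac34\Phi\,(1-y^2)\,\mathbf{e}_1,\qquad p_\Phi(x,y)=-\tfrac32\Phi\,x.$$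
   Context: $\mathbf{e}_1=(1,0)$; vector fields are real and two-dimensional, and the same notation is used for spaces of scalar functions and of vector fields. For $m=0,1,2,\dots$, $\mathbb{X}^m\subset H^m_{\mathrm{loc}}(S)$ is the Banach space of functions on $S$ with finite norm $$\|f\|_{\mathbb{X}^m}=\sup_{a\in\mathbb{R}}\|f\|_{H^m((a,a+1)\times(-1,1))}.$$ A vector field $\mathbf{u}=(u_1,u_2)$ on $S$ satisfies $(X1)$ if $u_1$ is even in $x$ and $u_2$ is odd in $x$. *)

(* Defs.v *)
From HB Require Import structures.
From mathcomp Require Import all_boot all_order all_algebra.
From mathcomp Require Import all_classical all_reals all_analysis.

Set Implicit Arguments.
Unset Strict Implicit.
Unset Printing Implicit Defensive.

Import Order.TTheory GRing.Theory Num.Theory.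
Import numFieldNormedType.Exports.

Local Open Scope classical_set_scope.
Local Open Scope ring_scope.

Notation mu2 R := (@lebesgue_measure R \x @lebesgue_measure R)%E.

Definition strip (R : realType) : set (R * R) := [set z | -1 < z.2 < 1].

Definition closed_strip (R : realType) : set (R * R) := [set z | -1 <= z.2 <= 1].

Definition strip_rect (R : realType) (a : R) : set (R * R) :=
  [set z | a < z.1 < a + 1 /\ -1 < z.2 < 1].

Definition e1 (R : realType) : R * R := (1, 0).
Definition e2 (R : realType) : R * R := (0, 1).

Fixpoint Ck (R : realType) (k : nat) (f : R * R -> R) : Prop :=
  if k is k'.+1 then
    [/\ forall z, derivable f z (e1 R),
        forall z, derivable f z (e2 R),
        continuous f,
        Ck k' (fun z => 'D_(e1 R) f z) &
        Ck k' (fun z => 'D_(e2 R) f z)]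
  else continuous f.

Definition pderive (R : realType) (al : nat * nat) (f : R * R -> R)
    : R * R -> R :=
  iter al.1 (fun g z => 'D_(e1 R) g z) (iter al.2 (fun g z => 'D_(e2 R) g z) f).

(* phi \in C_c^oo(Om), extended by 0 to the whole plane. *)
Definition test_function (R : realType) (Om : set (R * R)) (phi : R * R -> R) :=
  [/\ forall k, Ck k phi,
      compact (closure [set z | phi z != 0]) &
      closure [set z | phi z != 0] `<=` Om].

(* f \in L^p_loc(Om) for an integer exponent p. *)
Definition Lploc (R : realType) (p : nat) (Om : set (R * R)) (f : R * R -> R) :=
  measurable_fun (Om : set (measurableTypeR R * measurableTypeR R)) f /\
  forall K : set (R * R), compact K -> K `<=` Om ->
    (\int[mu2 R]_(z in K) (`|f z| ^+ p)%:E < +oo)%E.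

Definition weak_derivative (R : realType) (Om : set (R * R)) (al : nat * nat)
    (f g : R * R -> R) :=
  [/\ Lploc 1 Om f, Lploc 1 Om g &
      forall phi, test_function Om phi ->
        \int[mu2 R]_(z in Om) (f z * pderive al phi z) =
        (-1) ^+ (al.1 + al.2) * \int[mu2 R]_(z in Om) (g z * phi z)].

(* A chosen version of the weak derivative of f in Om, which is unique up to
   equality almost everywhere in Om; the null function if there is none. *)
Definition wD (R : realType) (Om : set (R * R)) (al : nat * nat)
    (f : R * R -> R) : R * R -> R :=
  xget (fun _ => 0) [set g | weak_derivative Om al f g].

Definition Hloc (R : realType) (m : nat) (Om : set (R * R)) (f : R * R -> R) :=
  Lploc 2 Om f /\
  forall al : nat * nat, (al.1 + al.2 <= m)%N ->
    exists2 g, weak_derivative Om al f g & Lploc 2 Om g.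

(* The H^m(Om) norm, meaningful when f has weak derivatives in Om up to
   order m. *)
Definition Hnorm (R : realType) (m : nat) (Om : set (R * R)) (f : R * R -> R)
    : \bar R :=
  ((\sum_(i < m.+1) \sum_(j < m.+1 | (i + j <= m)%N)
     \int[mu2 R]_(z in Om) ((wD Om (i : nat, j : nat) f z) ^+ 2)%:E) `^ (2^-1))%E.

Definition Xnorm (R : realType) (m : nat) (f : R * R -> R) : \bar R :=
  ereal_sup [set Hnorm m (strip_rect a) f | a in [set: R]].

Definition Xspace (R : realType) (m : nat) (f : R * R -> R) :=
  Hloc m (@strip R) f /\ (Xnorm m f < +oo)%E.

Definition Xspace_vec (R : realType) (m : nat) (u : R * R -> R * R) :=
  Xspace m (fst \o u) /\ Xspace m (snd \o u).

Definition wdx (R : realType) (f : R * R -> R) := wD (@strip R) (1%N, 0%N) f.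
Definition wdy (R : realType) (f : R * R -> R) := wD (@strip R) (0%N, 1%N) f.
Definition wgrad (R : realType) (f : R * R -> R) (z : R * R) : R * R :=
  (wdx f z, wdy f z).
Definition wlaplacian (R : realType) (f : R * R -> R) (z : R * R) : R :=
  wD (@strip R) (2%N, 0%N) f z + wD (@strip R) (0%N, 2%N) f z.
Definition vlaplacian (R : realType) (u : R * R -> R * R) (z : R * R) : R * R :=
  (wlaplacian (fst \o u) z, wlaplacian (snd \o u) z).
Definition advection (R : realType) (u : R * R -> R * R) (z : R * R) : R * R :=
  ((u z).1 * wdx (fst \o u) z + (u z).2 * wdy (fst \o u) z,
   (u z).1 * wdx (snd \o u) z + (u z).2 * wdy (snd \o u) z).
Definition wdiv (R : realType) (u : R * R -> R * R) (z : R * R) : R :=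
  wdx (fst \o u) z + wdy (snd \o u) z.

(* Elements of H^2 are classes of functions; their pointwise values up to the
   boundary are those of the representative v continuous on the closed strip,
   which exists by Sobolev embedding when u \in X^2 and is then unique. *)
Definition continuous_representative (R : realType) (u v : R * R -> R * R) :=
  {within @closed_strip R, continuous v} /\ v = u %[ae mu2 R in @strip R].

Definition satisfies_X1 (R : realType) (u : R * R -> R * R) :=
  (fun z => (u (- z.1, z.2)).1) = (fun z => (u z).1) %[ae mu2 R in @strip R] /\
  (fun z => (u (- z.1, z.2)).2) = (fun z => - (u z).2) %[ae mu2 R in @strip R].

Definition ns_problem (R : realType) (Phi : R) (u : R * R -> R * R)
    (p : R * R -> R) :=
  [/\ (fun z => - vlaplacian u z + advection u z + wgrad p z) = (fun _ => 0)
        %[ae mu2 R in @strip R],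
      wdiv u = (fun _ => 0) %[ae mu2 R in @strip R] &
      exists v, [/\ continuous_representative u v,
        forall x, v (x, 1) = 0 /\ v (x, -1) = 0 &
        \int[@lebesgue_measure R]_(y in `[-1, 1]) (v (0, y)).1 = Phi]].

Definition ns_solution (R : realType) (Phi : R) (u : R * R -> R * R)
    (p : R * R -> R) :=
  [/\ Xspace_vec 2 u, Hloc 1 (@strip R) p, Xspace_vec 0 (wgrad p),
      satisfies_X1 u & ns_problem Phi u p].

Definition poiseuille_u (R : realType) (Phi : R) (z : R * R) : R * R :=
  (3 / 4 * Phi * (1 - z.2 ^+ 2)) *: e1 R.
Definition poiseuille_p (R : realType) (Phi : R) (z : R * R) : R :=
  - (3 / 2 * Phi * z.1).

(* Main.v *)
From HB Require Import structures.
From mathcomp Require Import all_boot all_order all_algebra.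
From mathcomp Require Import all_classical all_reals all_analysis.
From mathcomp Require Import measurable_realfun ring lra.
Require Import Defs.
Set Implicit Arguments.
Unset Strict Implicit.
Unset Printing Implicit Defensive.
Import Order.TTheory GRing.Theory Num.Theory.
Import numFieldNormedType.Exports.
Local Open Scope classical_set_scope.
Local Open Scope ring_scope.
(** Existence is a verification: both components of the Poiseuille velocity and
    its pressure are products of a smooth function of x by a smooth function of
    y, and the classical derivatives of such products are their weak
    derivatives (tensor_weak_derivative, poiseuille_solution).

    Uniqueness holds for every flux, large or small, because the symmetry (X1)
    removes the nonlinearity. Take the curl of the momentum equation, which
    eliminates the pressure. If u1 is even and u2 odd in x, the curl of the
    viscous term is even in x while the curl of the advection term is odd. Two
    equal quantities of opposite parity vanish, so the velocity solves the
    linear Stokes system (curl_cancel_nonlinear, ns_stokes).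

    It remains to show that a Stokes flow (f, g) in the strip that is bounded in
    the uniform local L2 sense, vanishes on the walls and has zero flux is zero
    (stokes_pair_zero). Everything is tested against products p(x) q(y) of
    bumps. Pairing with p and its derivatives in x alone leaves functions of y,
    V_k(y) = int f(x,y) p^(k)(x) dx, and their antiderivatives Psi_k from the
    lower wall. The divergence equation expresses the pairings of g as
    antiderivatives Psi_k, and the curl equation becomes
    Psi_0'''' + 2 Psi_2'' + Psi_4 = 0 on ]-1, 1[ in the weak sense. The
    Du Bois-Reymond lemma turns it into an identity between iterated integrals,
    hence into regularity up to the walls. Zero velocity on the walls and zero
    flux make Psi_k and its derivative vanish at both ends.

    Translating p by t makes these functions depend on t, and a derivative in t
    raises k by one. The energy flux
    H(t) = int (2 V_1 V_0 - Psi_3 Psi_0 + Psi_2 Psi_1) dy then satisfies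
    H' = int (Psi_0''^2 + 2 V_1^2 + Psi_2^2) dy
    (clamped_biharmonic_energy). It is bounded on the whole line, and in each of
    its products one factor is controlled by H', so
    |H| <= e B + C H' / e for all e > 0. These properties force
    H' = 0 (bounded_riccati_zero). Hence every pairing of f vanishes, and
    (f, g) = 0 (clamped_family_zero).

    Applied to the difference between the continuous representative of u and
    the Poiseuille profile this determines the velocity (velocity_unique). The
    momentum equation then gives the gradient of the pressure, and a locally
    integrable function with zero weak gradient is constant
    (weak_gradient0_cst).

    Only product test functions are ever inserted into the weak equations. They
    suffice because they approximate indicator functions of rectangles, which
    generate the measurable sets of the plane (fundamental_lemma). *)

Local Notation "f ^D" := (derive1 f) (at level 2, format "f ^D").
Local Notation "f ^[ n ]" := (derive1n n f) (at level 2, format "f ^[ n ]").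

(** * Smooth functions of one variable *)

Section smooth_functions.
Context {R : realType}.
Implicit Types (f g : R -> R) (p : {poly R}) (x : R).

Fixpoint times_derivable k f : Prop :=
  if k is k'.+1 then (forall x, derivable f x 1) /\ times_derivable k' f^D
  else True.

Definition smooth f := forall k, times_derivable k f.

Lemma smooth_derivable f x : smooth f -> derivable f x 1.
Proof. by move=> /(_ 1%N)[]. Qed.

Lemma smooth_derive1 f : smooth f -> smooth f^D.
Proof. by move=> sf k; have [] := sf k.+1. Qed.

Lemma smooth_derive1n f n : smooth f -> smooth f^[n].
Proof.
by move=> sf; elim: n => [//|n IH]; rewrite derive1nS; exact: smooth_derive1.
Qed.

Lemma smooth_is_derive f x : smooth f -> is_derive x 1 f (f^D x).
Proof.
by move=> sf; apply: DeriveDef; [exact: smooth_derivable|rewrite derive1E].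
Qed.

Lemma smooth_continuous f : smooth f -> continuous f.
Proof.
move=> sf x; apply/differentiable_continuous/derivable1_diffP.
exact: smooth_derivable.
Qed.

Lemma is_derive_derive1 f g : (forall x, is_derive x 1 f (g x)) -> f^D = g.
Proof.
by move=> df; apply/funext => x; rewrite derive1E (@derive_val _ _ _ _ _ _ _ (df x)).
Qed.

(** Smoothness by closure: a set of functions stable under differentiation
    contains only smooth functions, so no formula for higher derivatives is
    needed. *)
Lemma smooth_class (S : set (R -> R)) :
  (forall f, S f -> exists2 g, S g & forall x, is_derive x 1 f (g x)) ->
  forall f, S f -> smooth f.
Proof.
move=> SS f Sf k; elim: k f Sf => [//|k IH] f /SS[g Sg fg]; split.
  by move=> x; apply: ex_derive.
by rewrite (is_derive_derive1 fg); exact: IH.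
Qed.

Lemma times_derivable_le k f : times_derivable k.+1 f -> times_derivable k f.
Proof.
elim: k f => [//|k IH] f [df kf]; split=> //; exact: IH.
Qed.

Lemma derive1D_fun f g : (forall x, derivable f x 1) ->
  (forall x, derivable g x 1) -> (f \+ g)^D = f^D \+ g^D.
Proof. by move=> df dg; apply/funext => x; rewrite /= !derive1E; exact: deriveD. Qed.

Lemma derive1M_fun f g : (forall x, derivable f x 1) ->
  (forall x, derivable g x 1) ->
  (f \* g)^D = (f^D \* g) \+ (f \* g^D).
Proof.
move=> df dg; apply/funext => x; rewrite /= !derive1E addrC.
by rewrite [X in _ + X]mulrC; exact: deriveM.
Qed.

Lemma times_derivableD k f g :
  times_derivable k f -> times_derivable k g -> times_derivable k (f \+ g).
Proof.
elim: k f g => [//|k IH] f g [df kf] [dg kg]; split.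
  by move=> x; apply: derivableD.
by rewrite derive1D_fun//; exact: IH.
Qed.

Lemma times_derivableM k f g :
  times_derivable k f -> times_derivable k g -> times_derivable k (f \* g).
Proof.
elim: k f g => [//|k IH] f g kf kg; split.
  by move=> x; apply: derivableM; [exact: kf.1|exact: kg.1].
rewrite (derive1M_fun kf.1 kg.1); apply: times_derivableD; apply: IH.
- exact: kf.2.
- exact: times_derivable_le.
- exact: times_derivable_le.
- exact: kg.2.
Qed.

Lemma smoothD f g : smooth f -> smooth g -> smooth (f \+ g).
Proof. by move=> sf sg k; exact: times_derivableD. Qed.

Lemma smoothM f g : smooth f -> smooth g -> smooth (f \* g).
Proof. by move=> sf sg k; exact: times_derivableM. Qed.

Lemma smooth_horner p : smooth (horner p).
Proof.
apply: (@smooth_class [set horner q | q in setT]); last by exists p.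
move=> _ [q _ <-]; exists (horner q^`()%R); first by exists q^`()%R.
move=> x; apply: DeriveDef; first exact: derivable_horner.
by rewrite derivE derive1E.
Qed.

Lemma smooth_cst (r : R) : smooth (cst r).
Proof. by rewrite -hornerC_ext; exact: smooth_horner. Qed.

Lemma is_derive1_affine f (a b x df : R) :
  is_derive (a * x + b) 1 f df ->
  is_derive x 1 (fun x => f (a * x + b)) (a * df).
Proof.
move=> fx; have ax : is_derive x 1 (fun x : R => a * x + b) a.
  by apply: is_derive_eq; rewrite /GRing.scale/= mulr1 addr0.
by rewrite mulrC; exact: (@is_derive1_comp _ f (fun x : R => a * x + b) x df a fx ax).
Qed.

Lemma smooth_affine f (a b : R) : smooth f -> smooth (fun x => f (a * x + b)).
Proof.
move=> sf; apply: (@smooth_class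
  [set h | exists c g, smooth g /\ h = (fun x => c * g (a * x + b))]); last first.
  by exists 1, f; split=> //; apply/funext => x; rewrite mul1r.
move=> _ [c [g [sg ->]]]; exists (fun x => (c * a) * g^D (a * x + b)).
  by exists (c * a), g^D; split => //; exact: smooth_derive1.
move=> x; rewrite -mulrA.
have := is_derive1_affine (smooth_is_derive (a * x + b) sg).
by move=> ?; apply: is_deriveZ.
Qed.

Lemma derive1nZ_affine f (a b : R) n : smooth f ->
  (fun x => f (a * x + b))^[n] = (fun x => a ^+ n * f^[n] (a * x + b)).
Proof.
move=> sf; elim: n => [|n IH].
  by apply/funext => x; rewrite !derive1n0 mul1r.
rewrite derive1nS IH; apply: is_derive_derive1 => x.
rewrite exprSr -mulrA.
have := is_derive1_affine (smooth_is_derive (a * x + b) (smooth_derive1n n sf)).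
by move=> ?; rewrite derive1nS; apply: is_deriveZ.
Qed.

Lemma smooth_scale f (c : R) : smooth f -> smooth (fun x => c * f x).
Proof. by move=> sf; apply: (smoothM (smooth_cst c) sf). Qed.

Lemma derive1n_lin f g (c : R) n : smooth f -> smooth g ->
  (fun x => f x + c * g x)^[n] = (fun x => f^[n] x + c * g^[n] x).
Proof.
move=> sf sg; elim: n => [//|n IH]; rewrite 3!derive1nS IH.
apply: is_derive_derive1 => x.
have := smooth_is_derive x (smooth_derive1n n sf).
have := smooth_is_derive x (smooth_derive1n n sg).
by move=> ? ?; apply: is_deriveD.
Qed.

Lemma smooth_lin f g (c : R) : smooth f -> smooth g ->
  smooth (fun x => f x + c * g x).
Proof. by move=> sf sg; apply: smoothD => //; exact: smooth_scale. Qed.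

End smooth_functions.

(** * Functions flat at the origin *)

Section flat_functions.
Context {R : realType}.
Implicit Types (p : {poly R}) (x : R).

(** Carrying the polynomial p makes the family stable under differentiation,
    as smooth_class requires; exp(-1/x) alone is the case p = 1. *)
Definition flat p x : R := if 0 < x then p.[x^-1] * expR (- x^-1) else 0.

Lemma horner_le_expR p : exists2 C : R, 0 <= C &
  forall x, 0 <= x -> `|p.[x]| <= C * expR x.
Proof.
exists (\sum_(i < size p) `|p`_i| * i`!%:R).
  by apply: sumr_ge0 => i _; rewrite mulr_ge0.
move=> x x0; rewrite horner_coef (le_trans (ler_norm_sum _ _ _))// mulr_suml.
apply: ler_sum => i _; rewrite normrM -mulrA ler_wpM2l//.
rewrite ger0_norm ?exprn_ge0// mulrC -ler_pdivrMr ?ltr0n ?fact_gt0//.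
case: (nat_of_ord i) => [|n].
  by rewrite expr0 fact0 divr1; apply: le_trans (expR_ge1Dx x); rewrite lerDl.
by apply: le_trans (expR_ge1Dxn n x0); rewrite lerDr.
Qed.

(** The exponential dominates p X^2 at 1/x; this gives derivative zero at the
    origin. *)
Lemma flat_le_sqr p : exists2 C : R, 0 <= C &
  forall x, `|flat p x| <= C * x ^+ 2.
Proof.
have [C C0 HC] := horner_le_expR (p * 'X^2).
exists C => // x; rewrite /flat; case: ltP => x0; last first.
  by rewrite normr0 mulr_ge0// sqr_ge0.
have := HC x^-1 (ltW _); rewrite invr_gt0 => /(_ x0).
rewrite hornerM hornerXn normrM (ger0_norm (exprn_ge0 _ _)) ?invr_ge0 ?(ltW x0)//.
rewrite normrM (ger0_norm (expR_ge0 _)) expRN exprVn => H.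
rewrite ler_pdivrMr ?expR_gt0// mulrAC.
by rewrite -ler_pdivrMr ?exprn_gt0.
Qed.

(** The chain rule gives (1/x^2) (p - p')(1/x) exp(-1/x) for x > 0, whence the
    polynomial X^2 (p - p'). At 0 the difference quotient is O(h). *)
Lemma is_derive_flat p x :
  is_derive x 1 (flat p) (flat ('X^2 * (p - p^`()%R)) x).
Proof.
have [x0|x0|->] := ltgtP x 0.
- apply: (@near_eq_is_derive _ _ _ (cst 0)); last first.
  + by rewrite /flat ltNge (ltW x0)/=; exact: is_derive_cst.
  + near=> y; rewrite /flat ltNge ifF//.
    apply/negbF/ltW; near: y; exact: lt_nbhsl.
- apply: (@near_eq_is_derive R R R (fun y : R => p.[y^-1] * expR (- y^-1))); last first.
  + have dV : is_derive x 1 (fun y : R => y^-1) (- x ^- 2).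
      apply: is_derive_eq; first by apply: is_deriveV; rewrite gt_eqF.
      by rewrite /GRing.scale/= mulr1.
    have dp : is_derive x^-1 1 (horner p) (p^`()%R).[x^-1].
      apply: DeriveDef; first exact: derivable_horner.
      by rewrite derivE derive1E.
    have d1 := @is_derive1_comp _ (horner p) (fun y : R => y^-1) _ _ _ dp dV.
    have dN : is_derive x 1 (fun y : R => - y^-1) (x ^- 2).
      by apply: is_derive_eq; rewrite opprK.
    have d2 := @is_derive1_comp _ expR (fun y : R => - y^-1) _ _ _
      (is_derive_expR _) dN.
    have d := @is_deriveM _ _ _ _ _ _ _ _ d1 d2.
    apply: (@is_derive_eq _ _ _ _ _ _ _ _ d).
    rewrite /flat x0 /GRing.scale/= hornerM hornerXn hornerD hornerN exprVn.
    ring.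
  + near=> y; rewrite /flat ifT//.
    near: y; exact: lt_nbhsr.
- have [C C0 HC] := flat_le_sqr p.
  have fl0 q : flat q 0 = 0 by rewrite /flat ltxx.
  rewrite fl0.
  have H : h^-1 *: (flat p (h *: 1 + 0) - flat p 0) @[h --> 0^'] --> (0 : R).
    apply/cvgrPdist_le => e e0; near=> h; rewrite sub0r normrN fl0 subr0 addr0.
    have h0 : h != 0 by near: h; exact: nbhs_dnbhs_neq.
    rewrite /GRing.scale/= mulr1 normrM normfV ler_pdivrMl ?normr_gt0//.
    rewrite (le_trans (HC _))// -(real_normK (num_real h)) expr2 mulrCA ler_wpM2l//.
    have hC : `|h| <= e / (C + 1).
      by near: h; apply: dnbhs0_le; rewrite divr_gt0// ltr_wpDl.
    apply: le_trans (ler_wpM2l C0 hC) _.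
    by rewrite mulrCA ler_piMr ?(ltW e0)// ler_pdivrMr ?ltr_wpDl// mul1r lerDl.
  apply: DeriveDef; first by apply/cvg_ex; exists 0.
  by apply/cvg_lim.
Unshelve. all: by end_near. Qed.

Lemma smooth_flat p : smooth (flat p).
Proof.
apply: (@smooth_class _ [set flat q | q in setT]); last by exists p.
move=> _ [q _ <-]; exists (flat ('X^2 * (q - q^`()%R))).
  by exists ('X^2 * (q - q^`()%R)).
exact: is_derive_flat.
Qed.

End flat_functions.

(** * Calculus on a segment *)

Section segment_calculus.
Context {R : realType}.
Notation mu := (@lebesgue_measure R).
Implicit Types (f g h F G : R -> R) (a b c x y : R).

Lemma Rintegral_support d (T : measurableType d) (m : {measure set T -> \bar R})
    (A B : set T) (f : T -> R) :
  (forall z, A z -> ~ B z -> f z = 0) -> (forall z, B z -> ~ A z -> f z = 0) ->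
  \int[m]_(z in A) f z = \int[m]_(z in B) f z.
Proof.
move=> AB BA; rewrite Rintegral_mkcond [RHS]Rintegral_mkcond.
congr (Rintegral _ _ _); apply/funext => z; rewrite !patchE.
case: (boolP (z \in A)) => [/set_mem zA|/negP zA].
  case: ifPn => // zB; apply: AB => // Bz; by rewrite mem_set in zB.
by case: ifPn => // /set_mem zB; rewrite BA// => Az; apply: zA; exact: mem_set.
Qed.

Lemma continuous_integrable a b f : continuous f ->
  mu.-integrable `[a, b] (EFin \o f).
Proof.
move=> cf; apply: continuous_compact_integrable; first exact: segment_compact.
exact: continuous_subspaceT.
Qed.

Lemma is_derive_continuous f g : (forall x, is_derive x 1 f (g x)) -> continuous f.
Proof.
move=> df x; apply/differentiable_continuous/derivable1_diffP.
by apply: ex_derive.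
Qed.

Lemma is_derive_LR f g a b : a < b -> (forall x, is_derive x 1 f (g x)) ->
  derivable_oo_LRcontinuous f a b.
Proof.
move=> ab df; have cf := is_derive_continuous df; split.
- by move=> x _; apply: ex_derive.
- exact: cvg_at_right_filter (cf a).
- exact: cvg_at_left_filter (cf b).
Qed.

(** Derivatives are assumed on the whole line, which leaves no one-sided
    conditions at the ends of the segment. *)
Lemma FTC2 f g a b : a <= b -> (forall x, is_derive x 1 f (g x)) ->
  continuous g -> \int[mu]_(x in `[a, b]) g x = f b - f a.
Proof.
rewrite le_eqVlt => /predU1P[<- _ _|ab df cg].
  by rewrite set_itv1 Rintegral_set1 subrr.
rewrite /Rintegral (@continuous_FTC2 _ _ f)//.
- exact: continuous_subspaceT.
- exact: is_derive_LR df.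
- by move=> x _; rewrite (is_derive_derive1 df).
Qed.

Lemma segment_by_parts F f G g a b : a <= b ->
  (forall x, is_derive x 1 F (f x)) -> continuous f ->
  (forall x, is_derive x 1 G (g x)) -> continuous g ->
  \int[mu]_(x in `[a, b]) (F x * g x) =
    F b * G b - F a * G a - \int[mu]_(x in `[a, b]) (f x * G x).
Proof.
rewrite le_eqVlt => /predU1P[<- _ _ _ _|ab dF cf dG cg].
  by rewrite set_itv1 !Rintegral_set1 !subrr.
apply: Rintegration_by_parts => //.
- exact: continuous_subspaceT.
- exact: is_derive_LR dF.
- by move=> x _; rewrite (is_derive_derive1 dF).
- exact: continuous_subspaceT.
- exact: is_derive_LR dG.
- by move=> x _; rewrite (is_derive_derive1 dG).
Qed.

Lemma is_derive_primitive f a x : continuous f -> a < x ->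
  is_derive x 1 (fun y => \int[mu]_(t in `[a, y]) f t) (f x).
Proof.
move=> cf ax.
have [//||df dE] := @continuous_FTC1_closed _ f a x (x + 1) _ _ ax (cf x).
- by rewrite ltrDl.
- exact: continuous_integrable.
- by apply: DeriveDef => //; rewrite -dE derive1E.
Qed.

Lemma segment_split f a b c : continuous f -> a <= b -> b <= c ->
  \int[mu]_(x in `[a, c]) f x =
  \int[mu]_(x in `[a, b]) f x + \int[mu]_(x in `[b, c]) f x.
Proof.
move=> cf ab bc; apply/eqP; rewrite addrC -subr_eq; apply/eqP.
rewrite (@Rintegral_itvB _ f (BLeft a) (BRight c) b) ?bnd_simp//; last first.
  exact: continuous_integrable.
rewrite Rintegral_itv_obnd_cbnd//.
apply: integrableS (continuous_integrable b c cf) => //.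
exact: subset_itv_oc_cc.
Qed.

(** The integral of h from a to y is squeezed between 0 and the total
    integral, so it is constant in y, and h is its derivative. *)
Lemma segment_integral_eq0 h a b : continuous h ->
  (forall x, a <= x <= b -> 0 <= h x) -> \int[mu]_(x in `[a, b]) h x = 0 ->
  forall x, a < x < b -> h x = 0.
Proof.
move=> ch h0 ih x /andP[ax xb].
have G0 y : a < y < b -> \int[mu]_(t in `[a, y]) h t = 0.
  move=> /andP[ay yb]; apply/eqP; rewrite eq_le; apply/andP; split.
    rewrite -ih (@segment_split h a y b) ?(ltW ay) ?(ltW yb)// lerDl.
    apply: Rintegral_ge0 => t /=; rewrite in_itv/= => /andP[yt tb].
    by apply: h0; rewrite tb (le_trans (ltW ay)).
  apply: Rintegral_ge0 => t /=; rewrite in_itv/= => /andP[at_ ty].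
  by apply: h0; rewrite at_ (le_trans ty)// ltW.
have dG := is_derive_primitive ch ax.
have d0 : is_derive x 1 (fun y => \int[mu]_(t in `[a, y]) h t) 0.
  apply: (@near_eq_is_derive R R R (cst 0)).
  by near=> y; rewrite G0//; apply/andP; split; near: y;
    [exact: lt_nbhsr|exact: lt_nbhsl].
by rewrite -(@derive_val _ _ _ _ _ _ _ dG) (@derive_val _ _ _ _ _ _ _ d0).
Unshelve. all: by end_near. Qed.

End segment_calculus.

(** * Bumps *)

Section test_functions.
Context {R : realType}.
Notation mu := (@lebesgue_measure R).
Implicit Types (f g F : R -> R) (a b c d x y : R).

(** The interval [c, d] makes the support compact in ]a, b[; d < c is allowed
    and means f = 0. *)
Definition bump_on a b f := smooth f /\ exists c d,
  [/\ a < c, d < b, forall x, x < c -> f x = 0 & forall x, d < x -> f x = 0].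

Lemma bump_on_out a b f x : bump_on a b f -> ~~ (a < x < b) -> f x = 0.
Proof.
move=> [_ [c [d [ac db fc fd]]]]; rewrite negb_and -!leNgt => /orP[|] h.
  by apply: fc; exact: le_lt_trans h ac.
by apply: fd; exact: lt_le_trans db h.
Qed.

Lemma bump_on_sub a b a' b' f : a' <= a -> b <= b' ->
  bump_on a b f -> bump_on a' b' f.
Proof.
move=> aa bb [sf [c [d [ac db fc fd]]]]; split=> //; exists c, d; split=> //.
  exact: le_lt_trans ac.
exact: lt_le_trans bb.
Qed.

Lemma bump_on_derive a b f : bump_on a b f -> bump_on a b f^D.
Proof.
move=> [sf [c [d [ac db fc fd]]]]; split; first exact: smooth_derive1.
have H x : (\forall y \near x, f y = 0) -> f^D x = 0.
  move=> xf; rewrite derive1E.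
  have d0 : is_derive x 1 f 0.
    apply: (@near_eq_is_derive R R R (cst 0)).
    by apply: filterS xf => y ->.
  exact: derive_val.
exists c, d; split=> // x xc; apply: H; near=> y.
  by apply: fc; near: y; exact: lt_nbhsl.
by apply: fd; near: y; exact: lt_nbhsr.
Unshelve. all: by end_near. Qed.

Lemma bump_on_derive1n a b f n : bump_on a b f -> bump_on a b f^[n].
Proof.
by move=> ?; elim: n => [//|n IH]; rewrite derive1nS; exact: bump_on_derive.
Qed.

Lemma bump_on_lin a b f g k : bump_on a b f -> bump_on a b g ->
  bump_on a b (fun x => f x + k * g x).
Proof.
move=> [sf [c [d [ac db fc fd]]]] [sg [c' [d' [ac' db' gc gd]]]].
split; first exact: smooth_lin.
exists (Num.min c c'), (Num.max d d'); rewrite lt_min ac ac' gt_max db db'.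
split=> // x.
  by rewrite lt_min => /andP[xc xc']; rewrite fc// gc// mulr0 addr0.
by rewrite gt_max => /andP[xc xc']; rewrite fd// gd// mulr0 addr0.
Qed.

Lemma bump_on_shift a b f t : bump_on a b f ->
  bump_on (a - t) (b - t) (fun x => f (1 * x + t)).
Proof.
move=> [sf [c [d [ac db fc fd]]]]; split; first exact: smooth_affine.
exists (c - t), (d - t); rewrite !ltrD2r; split=> // x.
  by rewrite ltrBrDr mul1r; exact: fc.
by rewrite ltrBlDr mul1r; exact: fd.
Qed.

Lemma bump_on_flip a b f : bump_on a b f ->
  bump_on (- b) (- a) (fun x => f (-1 * x + 0)).
Proof.
move=> [sf [c [d [ac db fc fd]]]]; split; first exact: smooth_affine.
exists (- d), (- c); rewrite !ltrN2; split=> // x; rewrite mulN1r addr0 => xx.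
  by apply: fd; rewrite ltrNr.
by apply: fc; rewrite ltrNl.
Qed.

Lemma bump_on_ends a b f : bump_on a b f -> f a = 0 /\ f b = 0.
Proof.
by move=> bf; split; apply: (bump_on_out bf); rewrite ltxx ?andbF.
Qed.

(** For k > 0, positive exactly on ]c, d[. The slope k sharpens the sides, and
    k -> +oo gives the indicator function of ]c, d[. *)
Definition bump (k c d x : R) : R := flat 1 (k * (x - c)) * flat 1 (k * (d - x)).

Lemma bump_on_bump a b k c d : 0 < k -> a < c -> d < b ->
  bump_on a b (bump k c d).
Proof.
move=> k0 ac db; split.
  rewrite (_ : bump k c d = (fun x => flat 1 (k * x + - (k * c))) \*
                            (fun x => flat 1 (- k * x + k * d))).
    by apply: smoothM; apply: smooth_affine; exact: smooth_flat.
  by apply/funext => x; rewrite /bump; congr (flat _ _ * flat _ _); ring.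
exists c, d; split=> // x xx; rewrite /bump /flat.
  by rewrite pmulr_rgt0// subr_gt0 ltNge (ltW xx) mul0r.
by rewrite (pmulr_rgt0 (d - x))// subr_gt0 (ltNge x) (ltW xx) mulr0.
Qed.

Lemma bumpE k c d x : 0 < k -> c < x < d ->
  bump k c d x = expR (- (k * (x - c))^-1) * expR (- (k * (d - x))^-1).
Proof.
move=> k0 /andP[cx xd].
by rewrite /bump /flat !pmulr_rgt0// !subr_gt0 cx xd !hornerC !mul1r.
Qed.

Lemma bump0 k c d x : 0 < k -> ~~ (c < x < d) -> bump k c d x = 0.
Proof.
move=> k0; rewrite /bump /flat !pmulr_rgt0// !subr_gt0.
by case: (c < x); case: (x < d); rewrite ?mul0r ?mulr0.
Qed.

Lemma bump_ge0 k c d x : 0 < k -> 0 <= bump k c d x.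
Proof.
move=> k0; have [cxd|cxd] := boolP (c < x < d); last by rewrite bump0.
by rewrite bumpE// mulr_ge0// expR_ge0.
Qed.

Lemma bump_le1 k c d x : 0 < k -> bump k c d x <= 1.
Proof.
move=> k0; have [cxd|cxd] := boolP (c < x < d); last by rewrite bump0.
have /andP[cx xd] := cxd.
by rewrite bumpE// mulr_ile1 ?expR_ge0// expR_le1 oppr_le0 invr_ge0
  mulr_ge0// ?ltW// subr_gt0.
Qed.

Lemma bump_gt0 k c d x : 0 < k -> c < x < d -> 0 < bump k c d x.
Proof. by move=> k0 cxd; rewrite bumpE// mulr_gt0// expR_gt0. Qed.

Lemma bump_on_continuous a b f : bump_on a b f -> continuous f.
Proof. by case=> sf _; exact: smooth_continuous. Qed.

Lemma continuousMf f g : continuous f -> continuous g ->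
  continuous (fun x => f x * g x).
Proof. by move=> cf cg x; apply: continuousM; [exact: cf|exact: cg]. Qed.

Lemma continuousDf f g : continuous f -> continuous g ->
  continuous (fun x => f x + g x).
Proof. by move=> cf cg x; apply: continuousD; [exact: cf|exact: cg]. Qed.

Lemma continuousZf k f : continuous f -> continuous (fun x => k * f x).
Proof. by move=> cf; apply: continuousMf => // x; exact: cvg_cst. Qed.

(** If F were positive at a point it would be positive near it, and a bump
    supported there would have a positive integral against F. *)
Lemma bump_orthogonal_eq0 F a b : continuous F ->
  (forall f, bump_on a b f -> \int[mu]_(x in `[a, b]) (F x * f x) = 0) ->
  forall x, a < x < b -> F x = 0.
Proof.
have pos (G : R -> R) : continuous G ->
  (forall f, bump_on a b f -> \int[mu]_(x in `[a, b]) (G x * f x) = 0) ->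
  forall x, a < x < b -> ~ 0 < G x.
  move=> cG iG x /andP[ax xb] Gx.
  have : \forall y \near x, [/\ a < y, y < b & 0 < G y].
    near=> y; split; near: y; [exact: lt_nbhsr|exact: lt_nbhsl|].
    exact: (cvgr_gt _ (cG x)).
  move=> /nbhs_ballP[e /= e0 He].
  have He' y : `|x - y| < e -> [/\ a < y, y < b & 0 < G y] by exact: He.
  pose f := bump 1 (x - e / 2) (x + e / 2).
  have e20 : 0 < e / 2 by rewrite divr_gt0.
  have e2e : e / 2 < e by rewrite ltr_pdivrMr// ltr_pMr// ltr1n.
  have bf : bump_on a b f.
    apply: bump_on_bump => //.
      by have [] := He' (x - e / 2); rewrite // subKr gtr0_norm.
    by have [] := He' (x + e / 2); rewrite // opprD addNKr normrN gtr0_norm.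
  have f0 y : 0 <= G y * f y.
    have [yx|yx] := boolP (x - e / 2 < y < x + e / 2).
      rewrite mulr_ge0 ?bump_ge0// ltW//.
      have [//|//] := He' y; rewrite distrC ltr_distl.
      move/andP: yx => [y1 y2]; apply/andP; split.
        by apply: lt_trans y1; rewrite ltrD2l ltrN2.
      by apply: lt_trans y2 _; rewrite ltrD2l.
    by rewrite /f bump0// mulr0.
  have := @segment_integral_eq0 _ (fun y => G y * f y) a b
    (continuousMf cG (bump_on_continuous bf)) (fun y _ => f0 y) (iG f bf) x.
  rewrite ax xb => /(_ isT)/eqP; rewrite mulf_eq0 gt_eqF//= gt_eqF//.
  by apply: bump_gt0 => //; rewrite ltrBlDr ltrDl e20.
move=> cF iF x axb; apply/eqP; rewrite eq_le !leNgt; apply/andP; split.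
  by apply/negP; exact: pos.
apply/negP; rewrite -oppr_gt0; apply: (@pos (fun y => - F y)) => //.
  by move=> y; apply: continuousN; exact: cF.
move=> f bf; under eq_Rintegral do rewrite mulNr -mulN1r.
rewrite RintegralZl ?iF ?mulr0//.
exact: continuous_integrable (continuousMf cF (bump_on_continuous bf)).
Unshelve. all: by end_near. Qed.

End test_functions.

(** * The Du Bois-Reymond lemma *)

Section du_bois_reymond.
Context {R : realType}.
Notation mu := (@lebesgue_measure R).
Implicit Types (f g F G : R -> R) (a b c x y : R).

Lemma smooth_antiderivative F f : (forall x, is_derive x 1 F (f x)) ->
  smooth f -> smooth F.
Proof.
move=> dF sf [//|k]; split; first by move=> x; apply: ex_derive.
by rewrite (is_derive_derive1 dF).
Qed.

(** The vanishing integral is what makes the antiderivative from a return to 0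
    on the right of the support. *)
Lemma bump_on_antiderivative a b f : bump_on a b f ->
  \int[mu]_(x in `[a, b]) f x = 0 -> exists2 g, bump_on a b g & g^D = f.
Proof.
move=> bf if0; have [sf [c [d [ac db fc fd]]]] := bf.
have cf := smooth_continuous sf.
pose g y := \int[mu]_(x in `[a, y]) f x.
have gc y : y < c -> g y = 0.
  move=> yc; rewrite /g (@Rintegral_support _ _ _ _ _ set0) ?Rintegral_set0//.
  by move=> z /=; rewrite in_itv/= => /andP[_ zy] _; apply: fc; exact: le_lt_trans yc.
have gd y : d < y -> g y = 0.
  move=> dy; rewrite -if0 /g; apply: Rintegral_support => z /=; rewrite !in_itv/=.
    move=> /andP[az zy]; rewrite az/= => /negP; rewrite -ltNge => bz.
    by apply: fd; exact: lt_trans bz.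
  move=> /andP[az zb]; rewrite az/= => /negP; rewrite -ltNge => bz.
  by apply: fd; exact: lt_trans bz.
have dg x : is_derive x 1 g (f x).
  have [ax|xa] := ltP a x; first exact: is_derive_primitive.
  have xc : x < c by exact: le_lt_trans ac.
  rewrite fc//; apply: (@near_eq_is_derive R R R (cst 0)).
  by near=> y; rewrite gc//; near: y; exact: lt_nbhsl.
exists g; last exact: is_derive_derive1.
by split; [exact: smooth_antiderivative dg sf|exists c, d].
Unshelve. all: by end_near. Qed.

Lemma bump_by_parts a b F f g : a <= b ->
  (forall x, is_derive x 1 F (f x)) -> continuous f -> bump_on a b g ->
  \int[mu]_(x in `[a, b]) (F x * g^D x) = - \int[mu]_(x in `[a, b]) (f x * g x).
Proof.
move=> ab dF cf bg; have [sg _] := bg; have [ga gb] := bump_on_ends bg.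
rewrite (segment_by_parts ab dF cf (fun x => smooth_is_derive x sg)).
  by rewrite ga gb !mulr0 subrr sub0r.
exact/smooth_continuous/smooth_derive1.
Qed.

Lemma bump_moment a b n g : a <= b -> bump_on a b g ->
  \int[mu]_(x in `[a, b]) (x ^+ n * g^[n] x) =
  (-1) ^+ n * n`!%:R * \int[mu]_(x in `[a, b]) g x.
Proof.
move=> ab bg; elim: n => [|n IH].
  rewrite expr0 fact0 !mul1r; apply: eq_Rintegral => x _.
  by rewrite expr0 mul1r.
have dX (x : R) : is_derive x 1 (fun x : R => x ^+ n.+1) (n.+1%:R * x ^+ n).
  by apply: DeriveDef; [exact: exprn_derivable|rewrite -derive1E exp_derive1].
have cX : continuous (fun x : R => x ^+ n) by move=> x; exact: exprn_continuous.
rewrite derive1nS (bump_by_parts ab dX (continuousZf cX) (bump_on_derive1n n bg)).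
under eq_Rintegral do rewrite -mulrA.
rewrite RintegralZl//; last first.
  apply: continuous_integrable; apply: continuousMf => //.
  exact: (bump_on_continuous (bump_on_derive1n n bg)).
by rewrite IH factS natrM exprS; ring.
Qed.

Lemma unit_bump a b : a < b ->
  exists2 f, bump_on a b f & \int[mu]_(x in `[a, b]) f x = 1.
Proof.
move=> ab.
pose c := a + (b - a) / 3; pose d := b - (b - a) / 3.
have ba3 : 0 < (b - a) / 3 by rewrite divr_gt0// subr_gt0.
have ac : a < c by rewrite /c; lra.
have db : d < b by rewrite /d; lra.
have cd : c < d by rewrite /c /d; lra.
have bf := @bump_on_bump _ a b 1 c d ltr01 ac db.
have cf := bump_on_continuous bf.
have i0 : \int[mu]_(x in `[a, b]) bump 1 c d x != 0.
  apply/eqP => i0.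
  have := @segment_integral_eq0 _ _ a b cf (fun x _ => bump_ge0 c d x ltr01) i0
    ((c + d) / 2).
  have -> : a < (c + d) / 2 < b by apply/andP; split; lra.
  move=> /(_ isT)/eqP; rewrite gt_eqF// bump_gt0//.
  by apply/andP; split; lra.
set m := (X in X != 0) in i0.
(* The normalised bump, written as a linear combination so that bump_on_lin
   applies. *)
exists (fun x => 0 * bump 1 c d x + m^-1 * bump 1 c d x).
  have -> : (fun x => 0 * bump 1 c d x + m^-1 * bump 1 c d x) =
    (fun x => bump 1 c d x + (m^-1 - 1) * bump 1 c d x).
    by apply/funext => x; ring.
  exact: bump_on_lin.
under eq_Rintegral do rewrite mul0r add0r.
rewrite RintegralZl// ?mulVf//.
exact: continuous_integrable.
Qed.

(** Induction on n. For a bump f of integral m and a bump r of integral 1, f -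
    m r is the derivative of a bump g. The hypothesis of order n+1 at g says
    that the pairing of F with f^(n) is m times a constant; by bump_moment a
    multiple of x^n has the same pairings, and the difference satisfies the
    hypothesis of order n. *)
Lemma du_bois_reymond n F a b : a < b -> continuous F ->
  (forall f, bump_on a b f -> \int[mu]_(x in `[a, b]) (F x * f^[n] x) = 0) ->
  exists2 p : {poly R}, (size p <= n)%N & forall x, a < x < b -> F x = p.[x].
Proof.
move=> ab; have [r br ir] := unit_bump ab.
have iI := fun f (cf : continuous f) => continuous_integrable a b cf.
elim: n F => [|n IH] F cF iF.
  exists 0; first by rewrite size_poly0.
  by move=> x axb; rewrite horner0; apply: bump_orthogonal_eq0 axb.
pose c := \int[mu]_(x in `[a, b]) (F x * r^[n] x).
(* By bump_moment, k x^n and F have the same pairing c m with the n-th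
   derivative of a bump of integral m. *)
pose k := c * (-1) ^+ n / n`!%:R.
have cX : continuous (fun x : R => x ^+ n) by move=> x; exact: exprn_continuous.
have cb f m : bump_on a b f -> continuous f^[m].
  by move=> bf; apply: bump_on_continuous; exact: bump_on_derive1n bf.
have [|f bf|p sp pE] := IH (fun x => F x + (- k) * x ^+ n).
- by apply: continuousDf => //; exact: continuousZf.
- pose m := \int[mu]_(x in `[a, b]) f x.
  have bh : bump_on a b (fun x => f x + (- m) * r x) by exact: bump_on_lin.
  have [|g bg gE] := bump_on_antiderivative bh.
    rewrite RintegralD//; [|exact/iI/(cb _ 0%N)|
      exact/iI/continuousZf/(cb _ 0%N)].
    rewrite RintegralZl//; last exact/iI/(cb _ 0%N).
    by rewrite ir mulr1 subrr.
  have := iF g bg; rewrite derive1Sn gE.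
  rewrite derive1n_lin; [|exact: bf.1|exact: br.1].
  under eq_Rintegral do rewrite mulrDr mulrCA.
  rewrite RintegralD//; [|exact/iI/continuousMf/cb|
    exact/iI/continuousZf/continuousMf/cb].
  rewrite RintegralZl//; last exact/iI/continuousMf/cb.
  rewrite -/c => Fm.
  under eq_Rintegral do rewrite mulrDl -mulrA.
  rewrite RintegralD//; [|exact/iI/continuousMf/cb|
    exact/iI/continuousZf/continuousMf/cb].
  rewrite RintegralZl//; last exact/iI/continuousMf/cb.
  rewrite bump_moment ?ltW// -/m (_ : - k * _ = - m * c)// /k.
  have nf : n`!%:R != 0 :> R by rewrite pnatr_eq0 -lt0n fact_gt0.
  have -> : - (c * (-1) ^+ n / n`!%:R) * ((-1) ^+ n * n`!%:R * m) =
    - (c * m) * ((-1) ^+ n * (-1) ^+ n) * (n`!%:R / n`!%:R) :> R by ring.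
  by rewrite divff// -expr2 sqrr_sign; ring.
- exists (p + k *: 'X^n).
    rewrite (leq_trans (size_polyD _ _))// geq_max leqW//=.
    by rewrite (leq_trans (size_scale_leq _ _))// size_polyXn.
  move=> x axb; rewrite hornerD hornerZ hornerXn -pE//; ring.
Qed.

End du_bois_reymond.

(** * The clamped biharmonic equation on a segment *)

Section clamped_biharmonic.
Context {R : realType}.
Notation mu := (@lebesgue_measure R).
Implicit Types (f g h F G : R -> R) (a b c x y : R).

Lemma segment_integralD a b f g : continuous f -> continuous g ->
  \int[mu]_(x in `[a, b]) (f x + g x) =
  \int[mu]_(x in `[a, b]) f x + \int[mu]_(x in `[a, b]) g x.
Proof. by move=> cf cg; rewrite RintegralD//; exact: continuous_integrable. Qed.

Lemma segment_integralZ a b k f : continuous f ->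
  \int[mu]_(x in `[a, b]) (k * f x) = k * \int[mu]_(x in `[a, b]) f x.
Proof. by move=> cf; rewrite RintegralZl//; exact: continuous_integrable. Qed.

Lemma bump_by_parts2 a b F f1 f2 g : a <= b ->
  (forall x, is_derive x 1 F (f1 x)) -> (forall x, is_derive x 1 f1 (f2 x)) ->
  continuous f2 -> bump_on a b g ->
  \int[mu]_(x in `[a, b]) (F x * g^[2] x) = \int[mu]_(x in `[a, b]) (f2 x * g x).
Proof.
move=> ab d1 d2 c2 bg.
rewrite derive1nS (bump_by_parts ab d1 (is_derive_continuous d2))//; last first.
  exact: bump_on_derive1n.
by rewrite derive1n1 (bump_by_parts ab d2 c2 bg) opprK.
Qed.

Lemma derive1nD2 g n : g^[n.+2] = g^[n]^[2].
Proof. by rewrite !derive1nS. Qed.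

Lemma eq_on_closure a b f g : a < b -> continuous f -> continuous g ->
  (forall x, a < x < b -> f x = g x) -> forall x, a <= x <= b -> f x = g x.
Proof.
move=> ab cf cg fg.
have ch : continuous (fun x => f x + -1 * g x).
  by apply: continuousDf => //; exact: continuousZf.
have end_a : f a = g a.
  apply/eqP; rewrite -subr_eq0 -mulN1r; apply/negPn/negP => h0.
  have ha := cvg_at_right_filter (ch a).
  near a^'+ => y.
  have : f y + -1 * g y != 0 by near: y; exact: (cvgr_neq0 _ ha).
  by rewrite fg ?mulN1r ?subrr ?eqxx//; apply/andP; split; near: y;
    [exact: nbhs_right_gt|exact: nbhs_right_lt].
have end_b : f b = g b.
  apply/eqP; rewrite -subr_eq0 -mulN1r; apply/negPn/negP => h0.
  have hb := cvg_at_left_filter (ch b).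
  near b^'- => y.
  have : f y + -1 * g y != 0 by near: y; exact: (cvgr_neq0 _ hb).
  by rewrite fg ?mulN1r ?subrr ?eqxx//; apply/andP; split; near: y;
    [exact: nbhs_left_gt|exact: nbhs_left_lt].
move=> x /andP[]; rewrite le_eqVlt => /predU1P[<- //|ax].
by rewrite le_eqVlt => /predU1P[-> //|xb]; apply: fg; rewrite ax.
Unshelve. all: by end_near. Qed.

(** The base point is the lower wall y = -1. *)
Definition primitive f y := \int[mu]_(x in `[-1, y]) f x.

Lemma primitive_le f y : y <= -1 -> primitive f y = 0.
Proof.
rewrite le_eqVlt => /predU1P[->|y1]; rewrite /primitive.
  by rewrite set_itv1 Rintegral_set1.
by rewrite set_itv_ge ?Rintegral_set0// bnd_simp -ltNge.
Qed.

Lemma is_derive_primitive_left0 f y : continuous f ->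
  (forall x, x <= -1 -> f x = 0) -> is_derive y 1 (primitive f) (f y).
Proof.
move=> cf f0; have [y1|y1] := ltP (-1) y; first exact: is_derive_primitive.
have E z : primitive f z = \int[mu]_(x in `[y - 1, z]) f x.
  apply: Rintegral_support => x /=; rewrite !in_itv/=.
    move=> /andP[x1 ->]; rewrite andbT => /negP; rewrite -ltNge => xy.
    by move: (le_lt_trans x1 xy); lra.
  move=> /andP[_ ->]; rewrite andbT => /negP; rewrite -ltNge => xy.
  by apply: f0; exact: ltW.
rewrite (_ : primitive f = fun z => \int[mu]_(x in `[y - 1, z]) f x).
  by apply: is_derive_primitive => //; lra.
exact/funext.
Qed.

(** The Cauchy-Schwarz inequality against the constant 1: expand the square of
    h minus its mean. *)
Lemma segment_sqr_integral_le a b h : a <= b -> continuous h ->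
  (\int[mu]_(x in `[a, b]) h x) ^+ 2 <=
  (b - a) * \int[mu]_(x in `[a, b]) (h x ^+ 2).
Proof.
rewrite le_eqVlt => /predU1P[<- _|ab ch].
  by rewrite set_itv1 Rintegral_set1 expr0n/= subrr mul0r.
set m := Rintegral _ _ _; pose L := b - a; rewrite -/L.
have L0 : 0 < L by rewrite subr_gt0.
have ch2 : continuous (fun x => h x ^+ 2).
  by under eq_fun do rewrite expr2; exact: continuousMf.
have : 0 <= \int[mu]_(x in `[a, b]) ((h x ^+ 2 + (- 2 * m / L) * h x) + (m / L) ^+ 2).
  apply: Rintegral_ge0 => x _.
  rewrite (_ : _ + _ = (h x - m / L) ^+ 2) ?sqr_ge0//; ring.
have cc (k : R) : continuous (fun _ : R => k) by move=> x; exact: cvg_cst.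
rewrite RintegralD//; [|exact/continuous_integrable/continuousDf/continuousZf
                      |exact: continuous_integrable].
rewrite RintegralD//; [|exact: continuous_integrable
                      |exact/continuous_integrable/continuousZf].
rewrite RintegralZl//; last exact: continuous_integrable.
rewrite Rintegral_cst//= lebesgue_measure_itv/= lte_fin ab -EFinD/= -/L -/m.
move=> H; rewrite mulrC -ler_pdivrMr// -subr_ge0.
rewrite (_ : _ - _ = Rintegral mu `[a, b] (fun x => h x ^+ 2) + - 2 * m / L * m +
  (m / L) ^+ 2 * L)//.
by field; rewrite gt_eqF.
Qed.

Lemma is_derive_unique_itv a b F f G g : a < b ->
  (forall x, is_derive x 1 F (f x)) -> continuous f ->
  (forall x, is_derive x 1 G (g x)) -> continuous g ->
  (forall x, a < x < b -> F x = G x) -> forall x, a <= x <= b -> f x = g x.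
Proof.
move=> ab dF cf dG cg FG; apply: eq_on_closure => // x /andP[ax xb].
have dF' : is_derive x 1 F (g x).
  apply: (@near_eq_is_derive R R R G); near=> y; rewrite FG//.
  by apply/andP; split; near: y; [exact: lt_nbhsr|exact: lt_nbhsl].
by rewrite -(@derive_val _ _ _ _ _ _ _ (dF x)) (@derive_val _ _ _ _ _ _ _ dF').
Unshelve. all: by end_near. Qed.

Lemma is_derive_horner (p : {poly R}) x : is_derive x 1 (horner p) p^`()%R.[x].
Proof.
by apply: DeriveDef; [exact: derivable_horner|rewrite derivE derive1E].
Qed.

(** On functions that vanish below the lower wall, primitive is an
    antiderivative on the whole line and can be iterated. *)
Definition left0 f := continuous f /\ forall x, x <= -1 -> f x = 0.

Lemma left0_iter_primitive n f : left0 f -> left0 (iter n primitive f).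
Proof.
move=> lf; elim: n => [//|n [cf f0]]; split; last exact: primitive_le.
by apply: is_derive_continuous => x; exact: is_derive_primitive_left0.
Qed.

Lemma is_derive_iter_primitive n f x : left0 f ->
  is_derive x 1 (iter n.+1 primitive f) (iter n primitive f x).
Proof.
by move=> /(left0_iter_primitive n)[cf f0]; exact: is_derive_primitive_left0.
Qed.

Local Opaque primitive.

(** N and M are antiderivatives of B and C of orders two and four. Moving
    derivatives onto the test function collects the weak equation into a
    single function orthogonal to every g''''. *)
Lemma integrate_weak_biharmonic (A B C N M : R -> R) g :
  continuous A -> continuous B -> continuous C -> continuous N ->
  continuous M -> bump_on (-1) 1 g ->
  \int[mu]_(x in `[-1, 1]) (N x * g^[4] x) =
    \int[mu]_(x in `[-1, 1]) (B x * g^[2] x) ->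
  \int[mu]_(x in `[-1, 1]) (M x * g^[4] x) =
    \int[mu]_(x in `[-1, 1]) (C x * g x) ->
  \int[mu]_(x in `[-1, 1]) ((A x + 2 * N x + M x) * g^[4] x) =
  \int[mu]_(x in `[-1, 1])
    (A x * g^[4] x + 2 * (B x * g^[2] x) + C x * g x).
Proof.
move=> cA cB cC cN cM bg EN EM.
have cg n : continuous g^[n].
  exact: bump_on_continuous (bump_on_derive1n _ bg).
have cg0 : continuous g := cg 0%N; have cg2 := cg 2%N; have cg4 := cg 4%N.
under eq_Rintegral do rewrite mulrDl mulrDl -mulrA.
move: g^[4] g^[2] cg2 cg4 EN EM => g4 g2 cg2 cg4 EN EM.
have cAg := continuousMf cA cg4; have cBg := continuousMf cB cg2.
have cCg := continuousMf cC cg0; have cNg := continuousMf cN cg4.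
have cMg := continuousMf cM cg4.
have c2B := continuousZf (k := 2) cBg; have c2N := continuousZf (k := 2) cNg.
rewrite (segment_integralD _ _ (continuousDf cAg c2N) cMg).
rewrite (segment_integralD _ _ cAg c2N) (segment_integralZ _ _ _ cNg).
rewrite (segment_integralD _ _ (continuousDf cAg c2B) cCg).
rewrite (segment_integralD _ _ cAg c2B) (segment_integralZ _ _ _ cBg).
by rewrite EN EM.
Qed.

(** With I for integration from the lower wall, Psi0 + 2 I^2 Psi2 + I^4 Psi4
    is orthogonal to every g'''', hence a cubic polynomial. Since Psi_k is
    itself I f_k, this writes Psi0 through iterated integrals of order at
    least three, which are regular up to the walls. *)
Lemma weak_biharmonic_regularity f0 f2 f4 :
  left0 f0 -> left0 f2 -> left0 f4 ->
  (forall g, bump_on (-1) 1 g -> \int[mu]_(x in `[-1, 1])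
    (primitive f0 x * g^[4] x + 2 * (primitive f2 x * g^[2] x) +
     primitive f4 x * g x) = 0) ->
  exists2 p : {poly R}, (size p <= 4)%N &
    forall x, -1 < x < 1 -> primitive f0 x = p.[x] -
      2 * iter 3 primitive f2 x - iter 5 primitive f4 x.
Proof.
move=> L0 L2 L4 weak.
have cI n f : left0 f -> continuous (iter n primitive f).
  by move=> /(left0_iter_primitive n)[].
have dI := is_derive_iter_primitive.
have ab : -1 <= 1 :> R by lra.
have lt11 : -1 < 1 :> R by lra.
have c0 := cI 1%N f0 L0; have c2 := cI 1%N f2 L2; have c4 := cI 1%N f4 L4.
have [N [cN NE EN]] : exists N : R -> R, [/\ continuous N,
    forall x, iter 3 primitive f2 x = N x &
    forall g, bump_on (-1) 1 g -> \int[mu]_(x in `[-1, 1]) (N x * g^[4] x) =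
      \int[mu]_(x in `[-1, 1]) (primitive f2 x * g^[2] x)].
  exists (iter 3 primitive f2); split; [exact: cI|by []|move=> g bg].
  rewrite (derive1nD2 _ 2).
  exact: (bump_by_parts2 ab (fun x => dI 2%N f2 x L2) (fun x => dI 1%N f2 x L2)
    c2 (bump_on_derive1n 2 bg)).
have [M [cM ME EM]] : exists M : R -> R, [/\ continuous M,
    forall x, iter 5 primitive f4 x = M x &
    forall g, bump_on (-1) 1 g -> \int[mu]_(x in `[-1, 1]) (M x * g^[4] x) =
      \int[mu]_(x in `[-1, 1]) (primitive f4 x * g x)].
  exists (iter 5 primitive f4); split; [exact: cI|by []|move=> g bg].
  rewrite (derive1nD2 _ 2).
  rewrite (bump_by_parts2 ab (fun x => dI 4%N f4 x L4) (fun x => dI 3%N f4 x L4)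
    (cI 3%N f4 L4) (bump_on_derive1n 2 bg)).
  exact: (bump_by_parts2 ab (fun x => dI 2%N f4 x L4) (fun x => dI 1%N f4 x L4)
    c4 bg).
have [|g bg|p sp pE] := @du_bois_reymond _ 4 (fun x =>
  (primitive f0 x + 2 * N x) + M x) (-1) 1 lt11.
- by apply: continuousDf; [apply: continuousDf; [|exact: continuousZf]|].
- exact: etrans (integrate_weak_biharmonic c0 c2 c4 cN cM bg (EN g bg) (EM g bg))
    (weak g bg).
- by exists p => // x x1; rewrite -pE// NE ME; ring.
Qed.

Lemma is_derive_comb F1 F2 F3 f1 f2 f3 x :
  is_derive x 1 F1 (f1 x) -> is_derive x 1 F2 (f2 x) -> is_derive x 1 F3 (f3 x) ->
  is_derive x 1 (fun x => F1 x - 2 * F2 x - F3 x) (f1 x - 2 * f2 x - f3 x).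
Proof.
move=> d1 d2 d3; have d2' : is_derive x 1 (fun x => 2 * F2 x) (2 * f2 x).
  exact: is_deriveZ.
have d12 : is_derive x 1 (fun x => F1 x - 2 * F2 x) (f1 x - 2 * f2 x).
  exact: is_deriveB.
exact: is_deriveB.
Qed.

Lemma continuous_comb f1 f2 f3 : continuous f1 -> continuous f2 ->
  continuous f3 -> continuous (fun x => f1 x - 2 * f2 x - f3 x).
Proof.
move=> c1 c2 c3 x; apply: cvgB; last exact: c3.
by apply: cvgB; [exact: c1|exact: (continuousZf c2)].
Qed.

Lemma eq_segment_integral a b f g : (forall x, a <= x <= b -> f x = g x) ->
  \int[mu]_(x in `[a, b]) f x = \int[mu]_(x in `[a, b]) g x.
Proof.
by move=> fg; apply: eq_Rintegral => x /set_mem /=; rewrite in_itv/= => /fg.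
Qed.

(** The boundary terms disappear because a0 and a1 vanish at both walls. T is
    the third derivative a3 as given by the equation; unlike a3 it has a known
    derivative, which allows the second integration by parts. *)
Lemma clamped_by_parts (a0 a1 a2 a3 b1 b2 P T : R -> R) :
  (forall x, is_derive x 1 a0 (a1 x)) -> (forall x, is_derive x 1 a1 (a2 x)) ->
  (forall x, is_derive x 1 a2 (a3 x)) -> continuous a3 ->
  (forall x, is_derive x 1 b1 (b2 x)) -> continuous b2 -> continuous P ->
  (forall x, is_derive x 1 T (0 - 2 * b2 x - P x)) ->
  (forall x, -1 <= x <= 1 -> a3 x = T x) ->
  a0 (-1) = 0 -> a0 1 = 0 -> a1 (-1) = 0 -> a1 1 = 0 ->
  \int[mu]_(x in `[-1, 1]) (a2 x ^+ 2) =
    2 * \int[mu]_(x in `[-1, 1]) (b1 x * a1 x) -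
    \int[mu]_(x in `[-1, 1]) (P x * a0 x).
Proof.
move=> d0 d1 d2 c3 db cb cP dT a3T a0N a01 a1N a11.
have le11 : -1 <= 1 :> R by lra.
have c0 := is_derive_continuous d0; have c1 := is_derive_continuous d1.
have c2 := is_derive_continuous d2.
under eq_Rintegral do rewrite expr2.
rewrite (segment_by_parts le11 d2 c3 d1 c2) a1N a11 !mulr0 subrr sub0r.
rewrite (@eq_segment_integral _ _ _ (fun x => T x * a1 x)); last first.
  by move=> x x1; rewrite a3T.
have cT' : continuous (fun x => 0 - 2 * b2 x - P x).
  have c00 : continuous (fun _ : R => 0 : R) by move=> x; exact: cvg_cst.
  exact: (continuous_comb c00 cb cP).
rewrite (segment_by_parts le11 dT cT' d0 c1) a0N a01 !mulr0 subrr sub0r opprK.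
have -> : \int[mu]_(x in `[-1, 1]) ((0 - 2 * b2 x - P x) * a0 x) =
    \int[mu]_(x in `[-1, 1]) (-2 * (a0 x * b2 x) + (-1) * (P x * a0 x)).
  by apply: eq_segment_integral => x _; ring.
have ca0b := continuousMf c0 cb; have cPa := continuousMf cP c0.
rewrite (segment_integralD _ _ (continuousZf ca0b) (continuousZf cPa)).
rewrite (segment_integralZ _ _ _ ca0b) (segment_integralZ _ _ _ cPa).
rewrite (segment_by_parts le11 d0 c1 db cb) a0N a01 !mul0r subrr sub0r.
rewrite mulrN mulNr opprK mulN1r; congr (2 * _ - _).
by apply: eq_segment_integral => x _; rewrite mulrC.
Qed.

(** Multiply Psi0'''' + 2 Psi2'' + Psi4 = 0 by Psi0 and integrate, where Psi_k
    = primitive f_k; w is Psi0''. The weak equation for (f2, f4, f6) is what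
    makes f2 = Psi2' differentiable, so that the product Psi2'' Psi0 can be
    integrated by parts. *)
Lemma clamped_biharmonic_energy f0 f2 f4 f6 :
  left0 f0 -> left0 f2 -> left0 f4 -> left0 f6 ->
  f0 1 = 0 -> primitive f0 1 = 0 ->
  (forall g, bump_on (-1) 1 g -> \int[mu]_(x in `[-1, 1])
    (primitive f0 x * g^[4] x + 2 * (primitive f2 x * g^[2] x) +
     primitive f4 x * g x) = 0) ->
  (forall g, bump_on (-1) 1 g -> \int[mu]_(x in `[-1, 1])
    (primitive f2 x * g^[4] x + 2 * (primitive f4 x * g^[2] x) +
     primitive f6 x * g x) = 0) ->
  exists w : R -> R, [/\ continuous w,
    forall y, -1 <= y <= 1 -> f0 y = \int[mu]_(x in `[-1, y]) w x &
    \int[mu]_(x in `[-1, 1]) (w x ^+ 2) =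
      2 * \int[mu]_(x in `[-1, 1]) (f2 x * f0 x) -
      \int[mu]_(x in `[-1, 1]) (primitive f4 x * primitive f0 x)].
Proof.
move=> L0 L2 L4 L6 f01 P01 weak0 weak2.
have [[c0 l0] [c2 l2] [c4 l4] [c6 l6]] := And4 L0 L2 L4 L6.
have [p sp pE] := weak_biharmonic_regularity L0 L2 L4 weak0.
have [q sq qE] := weak_biharmonic_regularity L2 L4 L6 weak2.
have lt11 : -1 < 1 :> R by lra.
have le11 : -1 <= 1 :> R by lra.
have inN1 : -1 <= (-1 : R) <= 1 by rewrite lexx.
have in1 : -1 <= (1 : R) <= 1 by rewrite lexx andbT.
have iI f : continuous f -> mu.-integrable `[-1, 1] (EFin \o f).
  exact: continuous_integrable.
have cI n f : left0 f -> continuous (iter n primitive f).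
  by move=> /(left0_iter_primitive n)[].
have dI := is_derive_iter_primitive.
pose W (p : {poly R}) k f g x := p.[x] - 2 * iter k primitive f x -
  iter k.+2 primitive g x.
have dW (r : {poly R}) k f g x : left0 f -> left0 g ->
    is_derive x 1 (W r k.+1 f g) (W r^`()%R k f g x).
  move=> lf lg; exact: (@is_derive_comb (horner r) (iter k.+1 primitive f)
    (iter k.+3 primitive g) (horner r^`()%R) (iter k primitive f)
    (iter k.+2 primitive g) x (is_derive_horner r x) (dI _ _ _ lf) (dI _ _ _ lg)).
have cW (r : {poly R}) k f g : left0 f -> left0 g -> continuous (W r k f g).
  move=> lf lg.
  exact: (continuous_comb (@continuous_horner _ r) (cI _ _ lf) (cI _ _ lg)).
(* Psi0, Psi0' and Psi2' as iterated integrals on the closed segment, so that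
   the conditions at the walls pass to the right-hand sides. *)
have W0E : forall x, -1 <= x <= 1 -> primitive f0 x = W p 3 f2 f4 x :=
  eq_on_closure lt11 (cI 1%N _ L0) (cW p 3%N _ _ L2 L4) pE.
have W1E : forall x, -1 <= x <= 1 -> f0 x = W p^`()%R 2 f2 f4 x :=
  is_derive_unique_itv lt11 (fun x => dI 0%N _ x L0) c0
  (fun x => dW p 2%N _ _ x L2 L4) (cW p^`()%R 2%N _ _ L2 L4) pE.
have V1E : forall x, -1 <= x <= 1 -> f2 x = W q^`()%R 2 f4 f6 x :=
  is_derive_unique_itv lt11 (fun x => dI 0%N _ x L2) c2
  (fun x => dW q 2%N _ _ x L4 L6) (cW q^`()%R 2%N _ _ L4 L6) qE.
have p4 : p^`()^`()^`()^`()%R = 0.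
  apply/eqP; rewrite -size_poly_leq0.
  have sd : forall (r : {poly R}) n, (size r <= n.+1)%N -> (size r^`()%R <= n)%N.
    by move=> r n sr; rewrite (leq_trans (size_poly _ _))// -subn1 leq_subLR add1n.
  exact: (sd _ _ (sd _ _ (sd _ _ (sd _ _ sp)))).
set P1 := p^`()%R in W1E p4 *; set P2 := P1^`()%R in p4 *.
set P3 := P2^`()%R in p4 *.
set Q1 := q^`()%R in V1E *; set Q2 := Q1^`()%R.
(* The third derivative of Psi0 with f2 replaced by its expression as an
   iterated integral; the cubic polynomial p contributes the constant P3 only.
   *)
pose T x := P3.[x] - 2 * W Q1 2 f4 f6 x - iter 2 primitive f4 x.
have dT x : is_derive x 1 T (0 - 2 * W Q2 1 f4 f6 x - primitive f4 x).
  rewrite -(horner0 x) -p4.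
  exact: (is_derive_comb (is_derive_horner P3 x) (dW Q1 1%N _ _ x L4 L6)
    (dI 1%N _ x L4)).
have cT : continuous T.
  exact: (continuous_comb (@continuous_horner _ P3) (cW Q1 2%N _ _ L4 L6)
    (cI 2%N _ L4)).
have W3T x : -1 <= x <= 1 -> W P3 0 f2 f4 x = T x.
  by move=> x1; rewrite /T -(V1E x x1).
have f0N : f0 (-1) = 0 by exact: l0 (lexx _).
have P0N : primitive f0 (-1) = 0 by exact: primitive_le (lexx _).
have W1N := etrans (esym (W1E _ inN1)) f0N.
have W11 := etrans (esym (W1E _ in1)) f01.
have W0N := etrans (esym (W0E _ inN1)) P0N.
have W01 := etrans (esym (W0E _ in1)) P01.
have := clamped_by_parts (fun x => dW p 2%N f2 f4 x L2 L4)
  (fun x => dW P1 1%N f2 f4 x L2 L4) (fun x => dW P2 0%N f2 f4 x L2 L4)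
  (cW P3 0%N f2 f4 L2 L4) (fun x => dW Q1 1%N f4 f6 x L4 L6)
  (cW Q2 1%N f4 f6 L4 L6) (cI 1%N f4 L4) dT W3T W0N W01 W1N W11.
move=> E; exists (W P2 1 f2 f4); split.
- exact: cW.
- move=> y /andP[y1 y2].
  rewrite (FTC2 y1 (fun x => dW P1 1%N f2 f4 x L2 L4) (cW P2 1%N f2 f4 L2 L4)).
  by rewrite W1N subr0; apply: W1E; rewrite y1.
- rewrite E; congr (2 * _ - _).
    by apply: eq_segment_integral => x x1; rewrite (W1E x x1) (V1E x x1).
  by apply: eq_segment_integral => x x1; rewrite (W0E x x1).
Qed.

End clamped_biharmonic.

(** * The energy flux along the channel *)

Section energy_method.
Context {R : realType}.
Notation mu := (@lebesgue_measure R).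
Implicit Types (f g h F G H E : R -> R) (a b c s t x y : R).
Local Notation primitive := (@primitive R).

Lemma growth_lower_bound H E c t0 s : (forall t, is_derive t 1 H (E t)) ->
  (forall t, t0 <= t -> c <= E t) -> 0 <= s -> H t0 + c * s <= H (t0 + s).
Proof.
move=> dH Ec s0.
have [||z zI] := @MVT_segment R H E t0 (t0 + s).
- by rewrite lerDl.
- exact/continuous_subspaceT/(is_derive_continuous dH).
rewrite addrAC subrr add0r => e.
rewrite addrC -lerBrDr e ler_wpM2r// Ec//.
by move: zI; rewrite in_itv/= => /andP[].
Qed.

(** If H t0 = h > 0 then H >= h from t0 on, H being nondecreasing. For e so
    small that e B <= h / 2 the last hypothesis bounds E below by a positive
    constant, which contradicts the boundedness of H. *)
Lemma bounded_riccati_nonpositive (H E : R -> R) (M B C : R) : 0 < C -> 0 <= B ->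
  (forall t, is_derive t 1 H (E t)) -> (forall t, 0 <= E t) ->
  (forall t, `|H t| <= M) ->
  (forall e t, 0 < e -> `|H t| <= e * B + C * E t / e) ->
  forall t, H t <= 0.
Proof.
move=> C0 B0 dH E0 HM He t0; rewrite leNgt; apply/negP => h0.
set h := H t0 in h0.
have mono t : t0 <= t -> h <= H t.
  move=> tt; have := @growth_lower_bound H E 0 t0 (t - t0) dH (fun t _ => E0 t).
  by rewrite mul0r addr0 subr_ge0 => /(_ tt); rewrite addrC subrK.
(* B + 1 in place of B because B may be 0. *)
pose e := h / (2 * (B + 1)).
have B1 : 0 < B + 1 by rewrite ltr_wpDl.
have e0 : 0 < e by rewrite divr_gt0// mulr_gt0.
have eB : e * B <= h / 2.
  have -> : e * B = (h / 2) * (B / (B + 1)) by rewrite /e; field; rewrite gt_eqF.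
  by rewrite ler_piMr ?divr_ge0 ?(ltW h0)// ler_pdivrMr// mul1r lerDl.
pose c := e * (h / 2) / C.
have c0 : 0 < c by rewrite /c divr_gt0// mulr_gt0// divr_gt0.
have Ec t : t0 <= t -> c <= E t.
  move=> tt; have := le_trans (mono t tt) (le_trans (ler_norm _) (He e t e0)).
  move=> H1; have H2 : h / 2 <= C * E t / e by move: H1 eB; lra.
  by move: H2; rewrite ler_pdivlMr// /c ler_pdivrMr// mulrC [E t * C]mulrC.
have M0 : 0 <= M by exact: le_trans (HM t0).
have s0 : 0 <= M / c by rewrite divr_ge0// ltW.
have := @growth_lower_bound H E c t0 (M / c) dH Ec s0.
rewrite mulrCA divff ?gt_eqF// mulr1 -/h => H1.
have := le_trans H1 (le_trans (ler_norm _) (HM _)).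
by rewrite gerDr leNgt h0.
Qed.

(** The function -H(-t) satisfies the same hypotheses as H, so
    bounded_riccati_nonpositive gives both signs. *)
Lemma bounded_riccati_zero (H E : R -> R) (M B C : R) : 0 < C -> 0 <= B ->
  (forall t, is_derive t 1 H (E t)) -> (forall t, 0 <= E t) ->
  (forall t, `|H t| <= M) ->
  (forall e t, 0 < e -> `|H t| <= e * B + C * E t / e) ->
  forall t, E t = 0.
Proof.
move=> C0 B0 dH E0 HM He.
have Hle := bounded_riccati_nonpositive C0 B0 dH E0 HM He.
have dG t : is_derive t 1 (fun t => - H (-1 * t + 0)) (E (-1 * t + 0)).
  have -> : E (-1 * t + 0) = - (-1 * E (-1 * t + 0)) by rewrite !mulN1r opprK.
  by have ? := is_derive1_affine (dH (-1 * t + 0)); apply: is_deriveN.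
have Hge := bounded_riccati_nonpositive C0 B0 dG (fun t => E0 _).
have H0 t : H t = 0.
  apply/eqP; rewrite eq_le Hle/=.
  have := Hge M _ _ (- t); rewrite mulN1r opprK addr0 oppr_le0; apply.
    by move=> s; rewrite normrN.
  by move=> e s e0; rewrite normrN; exact: He.
move=> t; have d0 : is_derive t 1 H 0.
  by apply: (@near_eq_is_derive R R R (cst 0)); near=> s; rewrite H0.
by rewrite -(@derive_val _ _ _ _ _ _ _ (dH t)) (@derive_val _ _ _ _ _ _ _ d0).
Unshelve. all: by end_near. Qed.

Lemma derive_segment_integral (K dK : R -> R -> R) c d t0 M :
  (forall t, continuous (K t)) ->
  (forall t y, c <= y <= d -> is_derive t 1 (K ^~ y) (dK t y)) ->
  (forall t y, `|t - t0| < 1 -> c <= y <= d -> `|dK t y| <= M) ->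
  is_derive t0 1 (fun t => \int[mu]_(y in `[c, d]) K t y)
    (\int[mu]_(y in `[c, d]) dK t0 y).
Proof.
move=> cK dKK KM.
have I0 : `](t0 - 1), (t0 + 1)[%classic t0.
  by rewrite /= in_itv/=; apply/andP; split; lra.
have Iabs t : `](t0 - 1), (t0 + 1)[%classic t -> `|t - t0| < 1.
  by rewrite /= in_itv/= distrC ltr_distl => /andP[t1 t2]; apply/andP; split; lra.
have dE t y : c <= y <= d -> partial1of2 K t y = dK t y.
  by move=> cyd; rewrite partial1of2E (@derive_val _ _ _ _ _ _ _ (dKK t y cyd)).
have iK t (_ : `](t0 - 1), (t0 + 1)[%classic t) :
    mu.-integrable `[c, d] (EFin \o K t) by exact: continuous_integrable.
have dK1 t y : `](t0 - 1), (t0 + 1)[%classic t -> `[c, d]%classic y ->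
    derivable (K ^~ y) t 1.
  by move=> _; rewrite /= in_itv/= => cyd; apply: ex_derive; exact: dKK.
have G0 (y : R) : 0 <= Num.max M 0 by rewrite le_max lexx orbT.
have iG : mu.-integrable `[c, d] (EFin \o (fun _ : R => Num.max M 0)).
  by apply: continuous_integrable => y; exact: cvg_cst.
have GM t y : `](t0 - 1), (t0 + 1)[%classic t -> `[c, d]%classic y ->
    `|partial1of2 K t y| <= Num.max M 0.
  move=> /Iabs tt; rewrite /= in_itv/= => cyd.
  by rewrite dE// le_max KM.
apply: DeriveDef.
  exact: (@derivable_under_integral _ _ _ mu K _ (measurable_itv _) t0 _ _ I0 iK
    dK1 _ G0 iG GM).
rewrite -derive1E.
rewrite (@differentiation_under_integral _ _ _ mu K _ (measurable_itv _) t0 _ _ I0 iK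
    dK1 _ G0 iG GM).
by apply: eq_segment_integral => y cyd; rewrite dE.
Qed.

(** V k t stands for the pairing in x of the first velocity component with the
    k-th derivative of a bump translated by t. Translation trades derivatives
    in x, which the velocity need not have pointwise, for derivatives in t. *)
Record clamped_family (V : nat -> R -> R -> R) : Prop := ClampedFamily {
  family_left0 : forall k t, left0 (V k t) ;
  family_right : forall k t, V k t 1 = 0 ;
  family_flux : forall k t, primitive (V k t) 1 = 0 ;
  family_derive : forall k t y, is_derive t 1 (V k ^~ y) (V k.+1 t y) ;
  family_locally_bounded : forall k t0, exists M, forall t y,
    `|t - t0| < 1 -> -1 <= y <= 1 -> `|V k t y| <= M ;
  family_bounded : forall k, exists B, forall t,
    \int[mu]_(y in `[-1, 1]) (V k t y ^+ 2) <= B ;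
  family_biharmonic : forall k t g, bump_on (-1) 1 g ->
    \int[mu]_(y in `[-1, 1]) (primitive (V k t) y * g^[4] y +
      2 * (primitive (V k.+2 t) y * g^[2] y) +
      primitive (V k.+4 t) y * g y) = 0 }.

Lemma segment_integral_le a b f g : continuous f -> continuous g ->
  (forall x, a <= x <= b -> f x <= g x) ->
  \int[mu]_(x in `[a, b]) f x <= \int[mu]_(x in `[a, b]) g x.
Proof.
move=> cf cg fg; apply: le_Rintegral => //; exact: continuous_integrable.
Qed.

Lemma segment_integral_ge0 a b f : (forall x, a <= x <= b -> 0 <= f x) ->
  0 <= \int[mu]_(x in `[a, b]) f x.
Proof.
by move=> f0; apply: Rintegral_ge0 => x /=; rewrite in_itv/= => /f0.
Qed.

Lemma segment_integral_cst k : \int[mu]_(x in `[-1, 1]) (fun _ : R => k) x = 2 * k.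
Proof.
rewrite Rintegral_cst//= lebesgue_measure_itv/= lte_fin ifT; last by lra.
by rewrite -EFinD/= opprK mulrC.
Qed.

Lemma continuousXf2 f : continuous f -> continuous (fun x => f x ^+ 2).
Proof. by move=> cf; under eq_fun do rewrite expr2; exact: continuousMf. Qed.

(** Cauchy-Schwarz on [-1, y]; the constant is the square of the width 2. *)
Lemma primitive_poincare f w : continuous f -> continuous w ->
  (forall y, -1 <= y <= 1 -> f y = \int[mu]_(x in `[-1, y]) w x) ->
  \int[mu]_(y in `[-1, 1]) (f y ^+ 2) <=
  4 * \int[mu]_(y in `[-1, 1]) (w y ^+ 2).
Proof.
move=> cf cw fw; set I := (X in _ <= 4 * X).
have cw2 := continuousXf2 cw.
have w0 a b : 0 <= \int[mu]_(y in `[a, b]) (w y ^+ 2).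
  by apply: segment_integral_ge0 => x _; exact: sqr_ge0.
have H y : -1 <= y <= 1 -> f y ^+ 2 <= 2 * I.
  move=> y1; have /andP[y0 y2] := y1; rewrite (fw y y1).
  apply: le_trans (segment_sqr_integral_le y0 cw) _.
  apply: ler_pM => //; first by lra.
    by lra.
  by rewrite /I (segment_split cw2 y0 y2) lerDl.
apply: le_trans (segment_integral_le (continuousXf2 cf) _ H) _.
  by move=> x; exact: cvg_cst.
by rewrite segment_integral_cst mulrA -natrM.
Qed.

Lemma family_primitive_derive V k t y : clamped_family V -> -1 <= y <= 1 ->
  is_derive t 1 (fun t => primitive (V k t) y) (primitive (V k.+1 t) y).
Proof.
move=> fV /andP[y1 y2]; have [M HM] := family_locally_bounded fV k.+1 t.
apply: (@derive_segment_integral (V k) (V k.+1) (-1) y t M).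
- by move=> s; have [] := family_left0 fV k s.
- by move=> s z _; exact: family_derive.
- by move=> s z st /andP[z1 z2]; apply: HM => //; rewrite z1 (le_trans z2).
Qed.

Lemma primitive_bound f y M : continuous f ->
  (forall x, -1 <= x <= 1 -> `|f x| <= M) -> -1 <= y <= 1 ->
  `|primitive f y| <= 2 * M.
Proof.
move=> cf fM /andP[y1 y2]; rewrite /primitive.
apply: le_trans (le_normr_Rintegral _ _) _ => //.
  exact: continuous_integrable.
have M0 : 0 <= M by apply: le_trans (fM 1 _) => //; rewrite lexx andbT; lra.
have cn : continuous (fun x => `|f x|).
  by move=> x; apply: cvg_norm; exact: cf.
have cM : continuous (fun _ : R => M) by move=> x; exact: cvg_cst.
rewrite -segment_integral_cst (segment_split cM y1 y2).
apply: ler_wpDr; first exact: segment_integral_ge0.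
apply: segment_integral_le => // x /andP[x1 x2].
by apply: fM; rewrite x1 (le_trans x2).
Qed.

Lemma young_ineq (a b e : R) : 0 < e -> `|a * b| <= e / 2 * b ^+ 2 + e^-1 / 2 * a ^+ 2.
Proof.
move=> e0; rewrite normrM -(real_normK (num_real a)) -(real_normK (num_real b)).
move: `|a| `|b| => {}a {}b.
rewrite -subr_ge0 (_ : _ - _ = e / 2 * (b - a / e) ^+ 2).
  by rewrite mulr_ge0 ?sqr_ge0// divr_ge0// ltW.
by field; rewrite gt_eqF.
Qed.

(** H is the energy flux and E its derivative, which clamped_biharmonic_energy
    identifies with a sum of squares. The Young inequality is applied to the
    products of H so that V1, Psi0 and Psi2, which E controls (Psi0 through
    the Poincare inequality), carry the weight 1/e, and V0, Psi1 and Psi3,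
    which are merely bounded, carry the weight e. *)
Theorem clamped_family_zero V : clamped_family V ->
  forall t y, -1 <= y <= 1 -> V 0%N t y = 0.
Proof.
move=> fV; pose P k t := primitive (V k t).
have cV k t : continuous (V k t) by have [] := family_left0 fV k t.
have cP k t : continuous (P k t).
  by have [] := left0_iter_primitive 1 (family_left0 fV k t).
pose K t y := 2 * (V 1%N t y * V 0%N t y) +
  (-1 * (P 3%N t y * P 0%N t y) + P 2%N t y * P 1%N t y).
pose dK t y := (2 * (V 2%N t y * V 0%N t y) + 2 * (V 1%N t y ^+ 2)) +
  (-1 * (P 4%N t y * P 0%N t y) + P 2%N t y ^+ 2).
pose H t := \int[mu]_(y in `[-1, 1]) K t y.
pose E t := \int[mu]_(y in `[-1, 1]) dK t y.
have cK t : continuous (K t).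
  apply: continuousDf; first by apply/continuousZf/continuousMf; exact: cV.
  by apply: continuousDf; [apply/continuousZf/continuousMf|apply: continuousMf];
    exact: cP.
have dH t : is_derive t 1 H (E t).
  have [M0 HM0] := family_locally_bounded fV 0 t.
  have [M1 HM1] := family_locally_bounded fV 1 t.
  have [M2 HM2] := family_locally_bounded fV 2 t.
  have [M4 HM4] := family_locally_bounded fV 4 t.
  apply: (@derive_segment_integral K dK (-1) 1 t
    ((2 * (M2 * M0) + 2 * (M1 * M1)) + ((2 * M4) * (2 * M0) + (2 * M2) * (2 * M2)))).
  - exact: cK.
  - move=> s y y1.
    have dV0 := family_derive fV 0 s y; have dV1 := family_derive fV 1 s y.
    have dP0 := family_primitive_derive 0 s fV y1.
    have dP1 := family_primitive_derive 1 s fV y1.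
    have dP2 := family_primitive_derive 2 s fV y1.
    have dP3 := family_primitive_derive 3 s fV y1.
    have d1 := @is_deriveM _ _ _ _ _ _ _ _ dV1 dV0.
    have d2 := @is_deriveM _ _ _ _ _ _ _ _ dP3 dP0.
    have d3 := @is_deriveM _ _ _ _ _ _ _ _ dP2 dP1.
    have d4 := @is_deriveZ _ _ _ _ 2 _ _ _ d1.
    have d5 := @is_deriveZ _ _ _ _ (-1) _ _ _ d2.
    have d6 := @is_deriveD _ _ _ _ _ _ _ _ _ d4
      (@is_deriveD _ _ _ _ _ _ _ _ _ d5 d3).
    apply: (@is_derive_eq _ _ _ _ _ _ _ _ d6).
    rewrite /dK /P /GRing.scale/=; ring.
  - move=> s y st y1.
    have bP k M : (forall t0 y0, `|t0 - t| < 1 -> -1 <= y0 <= 1 ->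
        `|V k t0 y0| <= M) -> `|P k s y| <= 2 * M.
      move=> HM; apply: primitive_bound => // x x1; exact: HM.
    have nM (a b c d : R) : `|a| <= b -> `|c| <= d -> `|a * c| <= b * d.
      by move=> *; rewrite normrM ler_pM.
    rewrite /dK; apply: le_trans (ler_normD _ _) _; apply: lerD.
      apply: le_trans (ler_normD _ _) _; apply: lerD; rewrite normrM ger0_norm//.
        by rewrite ler_wpM2l// nM// ?HM2 ?HM0.
      by rewrite ler_wpM2l// expr2 nM// HM1.
    apply: le_trans (ler_normD _ _) _; apply: lerD.
      by rewrite mulN1r normrN nM// bP.
    by rewrite expr2 nM// bP.
have w_ex t : exists w : R -> R, [/\ continuous w,
    forall y, -1 <= y <= 1 -> V 0%N t y = \int[mu]_(x in `[-1, y]) w x &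
    E t = \int[mu]_(y in `[-1, 1]) (w y ^+ 2) +
      2 * \int[mu]_(y in `[-1, 1]) (V 1%N t y ^+ 2) +
      \int[mu]_(y in `[-1, 1]) (P 2%N t y ^+ 2)].
  have [w [cw wE wI]] := clamped_biharmonic_energy (family_left0 fV 0 t)
    (family_left0 fV 2 t) (family_left0 fV 4 t) (family_left0 fV 6 t)
    (family_right fV 0 t) (family_flux fV 0 t)
    (fun g => @family_biharmonic _ fV 0 t g)
    (fun g => @family_biharmonic _ fV 2 t g).
  exists w; split => //; rewrite wI /E.
  have c1 := continuousMf (cV 2%N t) (cV 0%N t).
  have c2 := continuousXf2 (cV 1%N t).
  have c3 := continuousMf (cP 4%N t) (cP 0%N t).
  have c4 := continuousXf2 (cP 2%N t).
  rewrite (segment_integralD _ _ (continuousDf (continuousZf c1) (continuousZf c2))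
    (continuousDf (continuousZf c3) c4)).
  rewrite (segment_integralD _ _ (continuousZf c1) (continuousZf c2)).
  rewrite (segment_integralD _ _ (continuousZf c3) c4).
  rewrite (segment_integralZ _ _ _ c1) (segment_integralZ _ _ _ c2).
  rewrite (segment_integralZ _ _ _ c3) /P mulN1r addrA.
  by congr (_ + _); rewrite addrAC.
pose q k t := \int[mu]_(y in `[-1, 1]) (V k t y ^+ 2).
pose r k t := \int[mu]_(y in `[-1, 1]) (P k t y ^+ 2).
have q0 k t : 0 <= q k t by apply: segment_integral_ge0 => x _; exact: sqr_ge0.
have r0 k t : 0 <= r k t by apply: segment_integral_ge0 => x _; exact: sqr_ge0.
have rq k t : r k t <= 4 * q k t by apply: primitive_poincare.
(* 4 is the Poincare constant for V0, whose derivative is w. *)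
have wE t : q 0%N t + 2 * q 1%N t + r 2%N t <= 4 * E t.
  have [w [cw Vw ->]] := w_ex t; rewrite -/(q 1%N t) -/(r 2%N t).
  have := primitive_poincare (cV 0%N t) cw Vw; rewrite -/(q 0%N t).
  have := q0 1%N t; have := r0 2%N t.
  set D := \int[mu]_(y in _) (w y ^+ 2).
  by move: (r 2%N t) (q 1%N t) (q 0%N t) D => *; lra.
have He e t : 0 < e ->
    `|H t| <= e / 2 * (2 * q 0%N t + (r 3%N t + r 1%N t)) +
              e^-1 / 2 * (2 * q 1%N t + (r 0%N t + r 2%N t)).
  move=> e0.
  have c1 k := continuousXf2 (cV k t); have c2 k := continuousXf2 (cP k t).
  pose G y := e / 2 * (2 * V 0%N t y ^+ 2 + (P 3%N t y ^+ 2 + P 1%N t y ^+ 2)) +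
              e^-1 / 2 * (2 * V 1%N t y ^+ 2 + (P 0%N t y ^+ 2 + P 2%N t y ^+ 2)).
  have cG1 := continuousDf (continuousZf (k := 2) (c1 0%N))
    (continuousDf (c2 3%N) (c2 1%N)).
  have cG2 := continuousDf (continuousZf (k := 2) (c1 1%N))
    (continuousDf (c2 0%N) (c2 2%N)).
  have cG := continuousDf (continuousZf (k := e / 2) cG1)
    (continuousZf (k := e^-1 / 2) cG2).
  have -> : e / 2 * (2 * q 0%N t + (r 3%N t + r 1%N t)) +
      e^-1 / 2 * (2 * q 1%N t + (r 0%N t + r 2%N t)) =
      \int[mu]_(y in `[-1, 1]) G y.
    rewrite /G (segment_integralD _ _ (continuousZf cG1) (continuousZf cG2)).
    rewrite (segment_integralZ _ _ _ cG1) (segment_integralZ _ _ _ cG2).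
    rewrite (segment_integralD _ _ (continuousZf (c1 0%N))
      (continuousDf (c2 3%N) (c2 1%N))).
    rewrite (segment_integralD _ _ (continuousZf (c1 1%N))
      (continuousDf (c2 0%N) (c2 2%N))).
    rewrite (segment_integralD _ _ (c2 3%N) (c2 1%N)).
    rewrite (segment_integralD _ _ (c2 0%N) (c2 2%N)).
    by rewrite (segment_integralZ _ _ _ (c1 0%N)) (segment_integralZ _ _ _ (c1 1%N)).
  apply: le_trans (le_normr_Rintegral _ (continuous_integrable (-1) 1 (cK t))) _.
    exact: measurable_itv.
  apply: segment_integral_le => [||y _].
  - by move=> x; apply: cvg_norm; exact: cK.
  - exact: cG.
  - have y1 := young_ineq (V 1%N t y) (V 0%N t y) e0.
    have y2 := young_ineq (P 0%N t y) (P 3%N t y) e0.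
    have y3 := young_ineq (P 2%N t y) (P 1%N t y) e0.
    rewrite /K /G (mulrC (P 3%N t y)).
    apply: (@le_trans _ _ (2 * `|V 1%N t y * V 0%N t y| +
      (`|P 0%N t y * P 3%N t y| + `|P 2%N t y * P 1%N t y|))).
      apply: le_trans (ler_normD _ _) _; apply: lerD.
        by rewrite normrM ger0_norm.
      by apply: le_trans (ler_normD _ _) _; rewrite mulN1r normrN.
    by move: y1 y2 y3; move: (V _ _ _ ^+ 2) (V _ _ _ ^+ 2) (P _ _ _ ^+ 2)
      (P _ _ _ ^+ 2) (P _ _ _ ^+ 2) (P _ _ _ ^+ 2) `|_| `|_| `|_| => *; lra.
have [B0 HB0] := family_bounded fV 0; have [B1 HB1] := family_bounded fV 1.
have [B2 HB2] := family_bounded fV 2; have [B3 HB3] := family_bounded fV 3.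
have B0_ge0 : 0 <= B0 := le_trans (q0 0%N 0) (HB0 0).
have B1_ge0 : 0 <= B1 := le_trans (q0 1%N 0) (HB1 0).
have B2_ge0 : 0 <= B2 := le_trans (q0 2%N 0) (HB2 0).
have B3_ge0 : 0 <= B3 := le_trans (q0 3%N 0) (HB3 0).
have hb t : [/\ q 0%N t <= B0, q 1%N t <= B1, q 2%N t <= B2 & q 3%N t <= B3].
  by split; [exact: HB0|exact: HB1|exact: HB2|exact: HB3].
have E_ge0 t : 0 <= E t.
  by have := wE t; have := q0 0%N t; have := q0 1%N t; have := r0 2%N t; lra.
have low t : 2 * q 0%N t + (r 3%N t + r 1%N t) <= 2 * B0 + 4 * B3 + 4 * B1.
  have [] := hb t; have := rq 3%N t; have := rq 1%N t.
  by move: (q _ _) (q _ _) (q _ _) (q _ _) (r _ _) (r _ _); clear; move=> *; lra.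
have EZ := @bounded_riccati_zero H E
  ((2 * B0 + 4 * B3 + 4 * B1) / 2 + (2 * B1 + 4 * B0 + 4 * B2) / 2)
  ((2 * B0 + 4 * B3 + 4 * B1) / 2) 8 _ _ dH E_ge0.
have {}EZ t : E t = 0.
  apply: EZ; [by []|by lra| |].
  - move=> s; apply: le_trans (He 1 s ltr01) _; rewrite invr1.
    have [] := hb s; have := rq 0%N s; have := rq 2%N s; have := low s.
    by move: (q _ _) (q _ _) (q _ _) (q _ _) (r _ _) (r _ _) (r _ _) (r _ _);
      clear; move=> *; lra.
  - move=> e s e0; apply: le_trans (He e s e0) _; apply: lerD.
      by rewrite mulrAC -mulrA ler_wpM2l ?(ltW e0)// ler_pM2r// low.
    have H1 : 2 * q 1%N s + (r 0%N s + r 2%N s) <= 16 * E s.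
      have := wE s; have := rq 0%N s; have := r0 2%N s; have := q0 1%N s.
      by move: (q _ _) (q _ _) (r _ _) (r _ _) (E s); clear; move=> *; lra.
    have -> : 8 * E s / e = e^-1 / 2 * (16 * E s) by field; rewrite gt_eqF.
    by rewrite ler_wpM2l// divr_ge0// invr_ge0 ltW.
move=> t.
have qz : q 0%N t = 0.
  apply/eqP; rewrite eq_le q0 andbT.
  by have := wE t; have := q0 1%N t; have := r0 2%N t; rewrite EZ; lra.
have Vz := @segment_integral_eq0 _ _ (-1) 1 (continuousXf2 (cV 0%N t))
  (fun x _ => sqr_ge0 _) qz.
move=> y /andP[]; rewrite le_eqVlt => /predU1P[<- _|y1].
  by have [_] := family_left0 fV 0 t; apply.
rewrite le_eqVlt => /predU1P[->|y2]; first exact: family_right.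
by have := Vz y; rewrite y1 y2 => /(_ isT)/eqP; rewrite sqrf_eq0 => /eqP.
Qed.

End energy_method.

(** * Integration over rectangles *)

Section plane_integration.
Context {R : realType}.
Notation mu := (@lebesgue_measure R).
Notation plane := (measurableTypeR R * measurableTypeR R)%type.
Implicit Types (F G : R * R -> R) (a b c d x y : R).

Lemma continuous_pairing (T U W : topologicalType) (f : T -> U) (g : T -> W) :
  continuous f -> continuous g -> continuous (fun z => (f z, g z)).
Proof.
move=> cf cg z.
exact: (@cvg_pair _ _ _ (nbhs z) (nbhs (f z)) (nbhs (g z)) _ _ _ f g (cf z) (cg z)).
Qed.

Lemma continuous_pairL F x : continuous F -> continuous (fun y => F (x, y)).
Proof.
move=> cF y; apply: (@continuous_comp _ _ _ (fun y : R => (x, y)) F); last exact: cF.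
apply: continuous_pairing => z; [exact: cvg_cst|exact: cvg_id].
Qed.

Lemma continuous_pairR F y : continuous F -> continuous (fun x => F (x, y)).
Proof.
move=> cF x; apply: (@continuous_comp _ _ _ (fun x : R => (x, y)) F); last exact: cF.
apply: continuous_pairing => z; [exact: cvg_id|exact: cvg_cst].
Qed.

(** The topology and the sigma-algebra of the plane are two separate product
    constructions; a cover by countably many rational rectangles relates them.
    *)
Lemma open_plane_measurable (U : set (R * R)) : open U ->
  measurable (U : set plane).
Proof.
move=> oU.
pose B (q : rat * rat * rat * rat) : set (R * R) :=
  `](ratr q.1.1.1), (ratr q.1.1.2)[ `*` `](ratr q.1.2), (ratr q.2)[.
pose A n : set (R * R) :=
  if unpickle n is Some q then if `[< B q `<=` U >] then B q else set0 else set0.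
have -> : U = \bigcup_n A n.
  apply/seteqP; split=> [z Uz|z [n _]]; last first.
    by rewrite /A; case: unpickle => // q; case: asboolP => // BU; exact: BU.
  have [e /= e0 He] : nbhs_ball z U by apply/nbhs_ballP; exact: open_nbhs_nbhs.
  have [q1 q1z] : exists q : rat, ratr q \in `](z.1 - e), z.1[.
    by apply: rat_in_itvoo; rewrite ltrBlDr ltrDl.
  have [q2 q2z] : exists q : rat, ratr q \in `]z.1, (z.1 + e)[.
    by apply: rat_in_itvoo; rewrite ltrDl.
  have [q3 q3z] : exists q : rat, ratr q \in `](z.2 - e), z.2[.
    by apply: rat_in_itvoo; rewrite ltrBlDr ltrDl.
  have [q4 q4z] : exists q : rat, ratr q \in `]z.2, (z.2 + e)[.
    by apply: rat_in_itvoo; rewrite ltrDl.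
  move: q1z q2z q3z q4z; rewrite !in_itv/= => /andP[a1 b1] /andP[a2 b2]
    /andP[a3 b3] /andP[a4 b4].
  exists (pickle (q1, q2, q3, q4)); first exact: I.
  rewrite /A pickleK ifT.
    by split; rewrite /= in_itv/= ?b1 ?a2 ?b3 ?a4.
  apply/asboolP => -[x y] [/=]; rewrite !in_itv/= => /andP[x1 x2] /andP[y1 y2].
  apply: He; split; rewrite /ball/= ltr_distl; apply/andP; split; lra.
apply: bigcupT_measurable => n; rewrite /A; case: unpickle => [q|]; last first.
  exact: measurable0.
by case: ifP => _; [apply: measurableX; exact: measurable_itv|exact: measurable0].
Qed.

Lemma continuous_plane_measurable F : continuous F ->
  measurable_fun [set: plane] F.
Proof.
move=> /continuousP cF; apply: (measurability _ (measurable_realfun.RGenOpens.measurableE R)).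
move=> _ [_ [a [b ->] <-]]; rewrite setTI; apply: open_plane_measurable.
exact/cF/interval_open.
Qed.

Definition box a b c d : set (R * R) := `[a, b] `*` `[c, d].

Lemma boxP a b c d z : box a b c d z <-> a <= z.1 <= b /\ c <= z.2 <= d.
Proof. by rewrite /box /setX/= !in_itv/=. Qed.

Lemma box_measurable a b c d : measurable (box a b c d : set plane).
Proof. by apply: measurableX; exact: measurable_itv. Qed.

Lemma box_compact a b c d : compact (box a b c d).
Proof. by apply: compact_setX; exact: segment_compact. Qed.

Lemma box_bounded F a b c d : continuous F ->
  exists M, forall z, box a b c d z -> `|F z| <= M.
Proof.
move=> cF.
have := compact_bounded (continuous_compact (continuous_subspaceT cF)
  (@box_compact a b c d)).
move=> [M [_ HM]]; exists (M + 1) => z Bz.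
by apply: (HM (M + 1)); [rewrite ltrDl|exists z].
Qed.

Lemma box_mu2_fin a b c d : (mu2 R (box a b c d) < +oo)%E.
Proof.
rewrite /box product_measure1E; [|exact: measurable_itv|exact: measurable_itv].
have fin (p q : R) : (mu `[p, q]%classic < +oo)%E.
  by rewrite lebesgue_measure_itv/=; case: ifP => _; rewrite ?ltry// -EFinB ltry.
by apply: lte_mul_pinfty; [exact: measure_ge0|rewrite ge0_fin_numE//; exact: fin
  |exact: fin].
Qed.

Lemma box_integrable F a b c d : continuous F ->
  (mu2 R).-integrable (box a b c d) (EFin \o F).
Proof.
move=> cF; apply: measurable_bounded_integrable.
- exact: box_measurable.
- exact: box_mu2_fin.
- exact: measurable_funS (continuous_plane_measurable cF).
- have [M HM] := box_bounded a b c d cF.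
  by exists M; split; [exact: num_real|move=> N MN z /HM /le_trans; apply; exact: ltW].
Qed.

Lemma patch_box F a b c d x y : (F \_ (box a b c d)) (x, y) =
  (((fun y => F (x, y)) \_ `[c, d]) y : R) * \1_`[a, b] x.
Proof.
rewrite !patchE indicE; case: ifPn => [/set_mem/boxP/= [xab ycd]|].
  by rewrite !mem_set ?mulr1//= in_itv/=.
move=> /negP xy; case: ifPn => [/set_mem/= ycd|_]; last by rewrite mul0r.
case: (boolP (x \in _)) => [/set_mem/= xab|]; last by rewrite mulr0.
by exfalso; apply: xy; apply/mem_set; split.
Qed.

Lemma box_fubini F a b c d : continuous F ->
  \int[mu2 R]_(z in box a b c d) F z =
    \int[mu]_(x in `[a, b]) \int[mu]_(y in `[c, d]) F (x, y).
Proof.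
move=> cF; have iF := box_integrable a b c d cF.
have iF' : (mu2 R).-integrable setT (EFin \o (F \_ (box a b c d))).
  by rewrite -restrict_EFin; apply/integrable_restrict => //;
    [exact: box_measurable|rewrite setTI].
rewrite Rintegral_mkcond /Rintegral -(integral12_prod_meas1 iF') /=.
rewrite -/(Rintegral mu `[a, b] _) Rintegral_mkcond /Rintegral; congr fine.
apply: eq_integral => x _; rewrite /fubini_F/= patchE.
case: ifPn => [xab|xab].
  rewrite fineK; last first.
    apply: integrable_fin_num => //; apply: continuous_integrable.
    exact: continuous_pairL.
  rewrite [RHS]integral_mkcond; apply: eq_integral => y _.
  by rewrite patch_box indicE xab mulr1 restrict_EFin.
apply: integral0_eq => y _.
by rewrite patch_box indicE (negbTE xab) mulr0.
Qed.

Lemma box_fubini_sym F a b c d : continuous F ->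
  \int[mu2 R]_(z in box a b c d) F z =
    \int[mu]_(y in `[c, d]) \int[mu]_(x in `[a, b]) F (x, y).
Proof.
move=> cF; have iF := box_integrable a b c d cF.
have iF' : (mu2 R).-integrable setT (EFin \o (F \_ (box a b c d))).
  by rewrite -restrict_EFin; apply/integrable_restrict => //;
    [exact: box_measurable|rewrite setTI].
rewrite Rintegral_mkcond /Rintegral -(integral21_prod_meas1 iF') /=.
rewrite -/(Rintegral mu `[c, d] _) Rintegral_mkcond /Rintegral; congr fine.
apply: eq_integral => y _; rewrite /fubini_G/= patchE.
have E x : (F \_ (box a b c d)) (x, y) =
    (((fun x => F (x, y)) \_ `[a, b]) x : R) * \1_`[c, d] y.
  rewrite patch_box !patchE !indicE.
  by case: (y \in _); case: (x \in _); rewrite ?mulr1 ?mulr0 ?mul0r.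
case: ifPn => [ycd|ycd].
  rewrite fineK; last first.
    apply: integrable_fin_num => //; apply: continuous_integrable.
    exact: continuous_pairR.
  rewrite [RHS]integral_mkcond; apply: eq_integral => x _.
  by rewrite E indicE ycd mulr1 restrict_EFin.
apply: integral0_eq => x _.
by rewrite E indicE (negbTE ycd) mulr0.
Qed.

Lemma continuous_integral_section F c d : continuous F ->
  continuous (fun x => \int[mu]_(y in `[c, d]) F (x, y)).
Proof.
move=> cF x0.
have [M HM] := box_bounded (x0 - 1) (x0 + 1) c d cF.
apply: (@continuity_under_integral _ _ _ mu (fun x y => F (x, y)) `[c, d] _
  (x0 - 1) (x0 + 1) _ _ (fun _ => M)) => //.
- by move=> x _; apply: continuous_integrable; exact: continuous_pairL.
- by apply: aeW => y _ x _; exact: continuous_pairR.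
- by apply: continuous_integrable => x; exact: cvg_cst.
- move=> x; rewrite /= in_itv/= => /andP[x1 x2].
  apply: aeW => y /=; rewrite in_itv/= => y1.
  by apply: HM; apply/boxP; split=> //=; apply/andP; split; exact: ltW.
- by apply/mem_set; rewrite /= in_itv/=; apply/andP; split; lra.
Qed.

End plane_integration.

(** * Uniqueness for the linear Stokes problem *)

Section stokes_uniqueness.
Context {R : realType}.
Notation mu := (@lebesgue_measure R).
Implicit Types (f g : R * R -> R) (p q : R -> R) (a b c d s t x y : R).

Definition xpairing f a b p y := \int[mu]_(x in `[a, b]) (f (x, y) * p x).

Lemma continuous_xpairing f a b p : continuous f -> continuous p ->
  continuous (xpairing f a b p).
Proof.
move=> cf cp.
have cF : continuous (fun z : R * R => f (z.2, z.1) * p z.2).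
  move=> z; apply: continuousM.
    apply: (@continuous_comp _ _ _ (fun z : R * R => (z.2, z.1)) f); last exact: cf.
    by apply: continuous_pairing => u; [exact: cvg_snd|exact: cvg_fst].
  by apply: (@continuous_comp _ _ _ snd p); [exact: cvg_snd|exact: cp].
by move=> y; exact: (@continuous_integral_section _ _ a b cF y).
Qed.

Lemma xpairing_out f a b p y : (forall x, f (x, y) = 0) -> xpairing f a b p y = 0.
Proof.
move=> f0; rewrite /xpairing.
under eq_Rintegral do rewrite f0 mul0r.
by rewrite Rintegral_cst//= mul0r.
Qed.

Lemma xpairing_extend f a b a' b' p y : a' <= a -> b <= b' -> bump_on a b p ->
  xpairing f a b p y = xpairing f a' b' p y.
Proof.
move=> aa bb bp; apply: Rintegral_support => x /=; rewrite !in_itv/=.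
  move=> /andP[ax xb] /negP; rewrite negb_and -!ltNge => /orP[|] h.
    by have := le_lt_trans aa (le_lt_trans ax h); rewrite ltxx.
  by have := le_lt_trans bb (lt_le_trans h xb); rewrite ltxx.
move=> _ /negP h; rewrite (bump_on_out bp) ?mulr0//.
by apply: contraNN h => /andP[h1 h2]; rewrite !ltW.
Qed.

(** The velocity (f, g) is extended by 0 outside the strip, and all
    derivatives in x are carried by the bump p. The field pair_curl is the
    curl of the Stokes equation: it contains no pressure. *)
Record stokes_pair f g : Prop := StokesPair {
  pair_continuous1 : continuous f ;
  pair_continuous2 : continuous g ;
  pair_noslip1 : forall x y, ~~ (-1 < y < 1) -> f (x, y) = 0 ;
  pair_noslip2 : forall x y, ~~ (-1 < y < 1) -> g (x, y) = 0 ;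
  pair_flux : \int[mu]_(y in `[-1, 1]) f (0, y) = 0 ;
  pair_div : forall a b p q, a < b -> bump_on a b p -> bump_on (-1) 1 q ->
    \int[mu]_(y in `[-1, 1])
      (xpairing f a b p^[1] y * q y + xpairing g a b p y * q^[1] y) = 0 ;
  pair_curl : forall a b p q, a < b -> bump_on a b p -> bump_on (-1) 1 q ->
    \int[mu]_(y in `[-1, 1])
      ((xpairing f a b p^[2] y * q^[1] y + xpairing f a b p y * q^[3] y) -
       (xpairing g a b p^[3] y * q y + xpairing g a b p^[1] y * q^[2] y)) = 0 ;
  pair_bounded : exists C, forall a,
    \int[mu2 R]_(z in box a (a + 1) (-1) 1) (f z ^+ 2) <= C }.

Lemma left0_xpairing f a b p : continuous f -> continuous p ->
  (forall x y, ~~ (-1 < y < 1) -> f (x, y) = 0) -> left0 (xpairing f a b p).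
Proof.
move=> cf cp f0; split; first exact: continuous_xpairing.
move=> y y1; apply: xpairing_out => x; apply: f0.
by rewrite negb_and -leNgt y1.
Qed.

Lemma ltN11 : (-1 : R) < 1. Proof. lra. Qed.
Lemma notin_oo1 : ~~ (-1 < (1 : R) < 1). Proof. by rewrite ltxx andbF. Qed.

(** By the divergence equation the two sides have the same derivative in y in
    the weak sense, so they differ by a constant (Du Bois-Reymond of order
    one), which is 0 at the lower wall. *)
Lemma stokes_pair_cross_component f g a b p y : stokes_pair f g -> a < b ->
  bump_on a b p -> -1 <= y <= 1 ->
  xpairing g a b p y = primitive (xpairing f a b p^[1]) y.
Proof.
move=> fg ab bp.
have cf := pair_continuous1 fg; have cg := pair_continuous2 fg.
have cp n : continuous p^[n] := bump_on_continuous (bump_on_derive1n n bp).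
have l1 := left0_xpairing a b cf (cp 1%N) (pair_noslip1 fg).
set F := xpairing f a b p^[1] in l1 *; set G := xpairing g a b p.
have cG : continuous G by apply: continuous_xpairing => //; exact: (cp 0%N).
have cF : continuous F by case: l1.
have cQ : continuous (primitive F) by have [] := left0_iter_primitive 1 l1.
have [|q bq|c sc cE] := @du_bois_reymond _ 1 (fun y => G y + -1 * primitive F y)
    (-1) 1 ltN11.
- by apply: continuousDf => //; exact: continuousZf.
- have cq n : continuous q^[n] := bump_on_continuous (bump_on_derive1n n bq).
  have cq0 : continuous q := cq 0%N.
  under eq_Rintegral do rewrite mulrDl -mulrA.
  have c1 := continuousMf cG (cq 1%N); have c2 := continuousMf cQ (cq 1%N).
  have c3 := continuousMf cF cq0.
  rewrite (segment_integralD _ _ c1 (continuousZf c2)) (segment_integralZ _ _ _ c2).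
  rewrite derive1n1 (bump_by_parts (ltW ltN11)
    (fun x => is_derive_iter_primitive 0 x l1) cF bq) mulN1r opprK -derive1n1.
  have := pair_div fg ab bp bq; rewrite -/F -/G (segment_integralD _ _ c3 c1).
  by rewrite addrC.
- have cst1 (z : R) : c.[z] = c.[-1].
    by rewrite (size1_polyC sc) !hornerC.
  have E := eq_on_closure ltN11 (continuousDf cG (continuousZf (k := -1) cQ))
    (@continuous_horner _ c) cE.
  have cN1 : c.[-1] = 0.
    rewrite -E ?lexx ?(ltW ltN11)// primitive_le// mulr0 addr0.
    by apply: xpairing_out => x; apply: (pair_noslip2 fg); rewrite ltxx.
  move=> y1; have := E y y1; rewrite cst1 cN1 mulN1r => /eqP.
  by rewrite subr_eq0 => /eqP.
Qed.

(** The flux X through a vertical section is constant in x: its pairing with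
    p' is the value at the upper wall of the pairing of g with p, which is 0.
    At x = 0 the flux vanishes. *)
Lemma stokes_pair_flux f g a b p : stokes_pair f g -> a < b ->
  bump_on a b p -> primitive (xpairing f a b p) 1 = 0.
Proof.
move=> fg ab bp; have cf := pair_continuous1 fg.
pose X x := \int[mu]_(y in `[-1, 1]) f (x, y).
have cX : continuous X by exact: continuous_integral_section.
have fub a' b' q : bump_on a' b' q ->
    \int[mu]_(x in `[a', b']) (X x * q x) = primitive (xpairing f a' b' q) 1.
  move=> bq; have cq := bump_on_continuous bq.
  have cF : continuous (fun z : R * R => f z * q z.1).
    move=> z; apply: continuousM; first exact: cf.
    by apply: (@continuous_comp _ _ _ fst q); [exact: cvg_fst|exact: cq].
  rewrite /primitive /xpairing -(box_fubini_sym a' b' (-1) 1 cF) box_fubini//.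
  apply: eq_segment_integral => x _ /=; rewrite /X.
  rewrite mulrC -segment_integralZ; last exact: continuous_pairL.
  by apply: eq_segment_integral => y _; rewrite mulrC.
have X0 : forall x, X x = 0.
  move=> x; pose N := `|x| + 1.
  have N0 : - N < N by rewrite /N; have := normr_ge0 x; lra.
  have [q bq|c sc cE] := @du_bois_reymond _ 1 X (- N) N N0 cX.
    rewrite fub; last exact: bump_on_derive1n.
    rewrite -(stokes_pair_cross_component fg N0 bq) ?lexx ?(ltW ltN11)//.
    by apply: xpairing_out => z; apply: (pair_noslip2 fg); exact: notin_oo1.
  have inN z : `|z| <= `|x| -> X z = c.[0].
    move=> zx; have -> : c.[0] = c.[z] by rewrite (size1_polyC sc) !hornerC.
    by apply: cE; rewrite -ltr_norml /N; lra.
  have H0 : X 0 = c.[0] by apply: inN; rewrite normr0 normr_ge0.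
  by rewrite (inN x (lexx _)) -H0; exact: (pair_flux fg).
rewrite -fub//; under eq_Rintegral do rewrite X0 mul0r.
by rewrite Rintegral_cst//= mul0r.
Qed.

(** P0 and P2 stand for antiderivatives of A0 and A2; the last two hypotheses
    are the corresponding integrations by parts. *)
Lemma curl_to_biharmonic (A0 A2 P0 P2 P4 q0 q1 q2 q3 q4 : R -> R) :
  continuous A0 -> continuous A2 -> continuous P0 -> continuous P2 ->
  continuous P4 -> continuous q0 -> continuous q1 -> continuous q2 ->
  continuous q3 -> continuous q4 ->
  \int[mu]_(y in `[-1, 1]) (P2 y * q2 y) = - (\int[mu]_(y in `[-1, 1]) (A2 y * q1 y)) ->
  \int[mu]_(y in `[-1, 1]) (P0 y * q4 y) = - (\int[mu]_(y in `[-1, 1]) (A0 y * q3 y)) ->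
  \int[mu]_(y in `[-1, 1])
    ((A2 y * q1 y + A0 y * q3 y) + -1 * (P4 y * q0 y + P2 y * q2 y)) =
  - (\int[mu]_(y in `[-1, 1]) (P0 y * q4 y + 2 * (P2 y * q2 y) + P4 y * q0 y)).
Proof.
move=> cA0 cA2 cP0 cP2 cP4 cq0 cq1 cq2 cq3 cq4 E2 E0.
have c1 := continuousMf cA2 cq1; have c2 := continuousMf cA0 cq3.
have c3 := continuousMf cP4 cq0; have c4 := continuousMf cP2 cq2.
have c5 := continuousMf cP0 cq4.
rewrite (segment_integralD _ _ (continuousDf c1 c2)
  (continuousZf (continuousDf c3 c4))).
rewrite (segment_integralD _ _ c1 c2) (segment_integralZ _ _ _ (continuousDf c3 c4)).
rewrite (segment_integralD _ _ c3 c4).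
rewrite (segment_integralD _ _ (continuousDf c5 (continuousZf c4)) c3).
rewrite (segment_integralD _ _ c5 (continuousZf c4)) (segment_integralZ _ _ _ c4).
rewrite E2 E0.
by move: (Rintegral _ _ _) (Rintegral _ _ _) (Rintegral _ _ _) => *; ring.
Qed.

(** In the curl equation the pairings of g are antiderivatives of pairings of
    f (stokes_pair_cross_component), and one integration by parts raises those
    of f to antiderivatives as well. *)
Lemma stokes_pair_biharmonic f g a b p q : stokes_pair f g -> a < b ->
  bump_on a b p -> bump_on (-1) 1 q ->
  \int[mu]_(y in `[-1, 1]) (primitive (xpairing f a b p) y * q^[4] y +
    2 * (primitive (xpairing f a b p^[2]) y * q^[2] y) +
    primitive (xpairing f a b p^[4]) y * q y) = 0.
Proof.
move=> fg ab bp bq.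
have cf := pair_continuous1 fg.
have cp n : continuous p^[n] := bump_on_continuous (bump_on_derive1n n bp).
have cq n : continuous q^[n] := bump_on_continuous (bump_on_derive1n n bq).
have cq0 : continuous q := cq 0%N.
have l n := left0_xpairing a b cf (cp n) (pair_noslip1 fg).
have := pair_curl fg ab bp bq.
have snd n y : -1 <= y <= 1 -> xpairing g a b p^[n] y =
    primitive (xpairing f a b p^[n.+1]) y.
  move=> y1; rewrite (stokes_pair_cross_component fg ab (bump_on_derive1n n bp) y1).
  by rewrite derive1n1 -derive1nS.
rewrite (@eq_segment_integral _ _ _ _ (fun y =>
    (xpairing f a b p^[2] y * q^[1] y + xpairing f a b p y * q^[3] y) +
    -1 * (primitive (xpairing f a b p^[4]) y * q y +
     primitive (xpairing f a b p^[2]) y * q^[2] y))); last first.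
  by move=> y y1; rewrite !snd// mulN1r.
have cV n : continuous (xpairing f a b p^[n]) by have [] := l n.
have cP n : continuous (primitive (xpairing f a b p^[n])).
  by have [] := left0_iter_primitive 1 (l n).
have dP n := fun x => is_derive_iter_primitive 0 x (l n).
have le11 := ltW ltN11.
have bp2 : \int[mu]_(y in `[-1, 1]) (primitive (xpairing f a b p^[2]) y * q^[2] y) =
    - \int[mu]_(y in `[-1, 1]) (xpairing f a b p^[2] y * q^[1] y) :=
  bump_by_parts le11 (dP 2%N) (cV 2%N) (bump_on_derive1n 1 bq).
have bp0 : \int[mu]_(y in `[-1, 1]) (primitive (xpairing f a b p) y * q^[4] y) =
    - \int[mu]_(y in `[-1, 1]) (xpairing f a b p y * q^[3] y) :=
  bump_by_parts le11 (dP 0%N) (cV 0%N) (bump_on_derive1n 3 bq).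
move=> C; apply/eqP; rewrite -oppr_eq0; apply/eqP; rewrite -C.
exact: esym (curl_to_biharmonic (cV 0%N) (cV 2%N) (cP 0%N) (cP 2%N) (cP 4%N)
  cq0 (cq 1%N) (cq 2%N) (cq 3%N) (cq 4%N) bp2 bp0).
Qed.

Lemma bump_on_bounded a b p : bump_on a b p -> exists M, forall x, `|p x| <= M.
Proof.
move=> bp.
have cF : continuous (fun z : R * R => p z.1).
  move=> z; apply: (@continuous_comp _ _ _ fst p); first exact: cvg_fst.
  exact: (bump_on_continuous bp).
have [M HM] := box_bounded a b 0 0 cF.
exists (Num.max M 0) => x; have [axb|axb] := boolP (a < x < b).
  rewrite le_max; apply/orP; left; apply: (HM (x, 0)); apply/boxP.
  by split; rewrite /= ?lexx//; case/andP: axb => ? ?; rewrite !ltW.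
by rewrite (bump_on_out bp)// normr0 le_max lexx orbT.
Qed.

Definition translate p t x := p (1 * x + t).

Lemma translate_derive1n p t n : smooth p -> (translate p t)^[n] = translate p^[n] t.
Proof.
move=> sp; rewrite /translate derive1nZ_affine//; apply/funext => x.
by rewrite expr1n mul1r.
Qed.

Lemma is_derive_translate p t x : smooth p ->
  is_derive t 1 (fun t => translate p t x) (translate p^D t x).
Proof.
move=> sp; rewrite /translate.
rewrite (_ : (fun t => p (1 * x + t)) = fun t => p (1 * t + x)); last first.
  by apply/funext => s; rewrite !mul1r addrC.
have -> : p^D (1 * x + t) = 1 * p^D (1 * t + x) by rewrite !mul1r addrC.
by apply: is_derive1_affine; exact: smooth_is_derive.
Qed.

Lemma segment_integral_bound h a b M : a <= b -> continuous h ->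
  (forall x, a <= x <= b -> `|h x| <= M) ->
  `|\int[mu]_(x in `[a, b]) h x| <= (b - a) * M.
Proof.
move=> ab ch hM; apply: le_trans (le_normr_Rintegral _ _) _ => //.
  exact: continuous_integrable.
apply: le_trans (segment_integral_le (g := fun _ => M) _ _ hM) _.
- by move=> x; apply: cvg_norm; exact: ch.
- by move=> x; exact: cvg_cst.
move: ab; rewrite le_eqVlt => /predU1P[->|ab].
  by rewrite set_itv1 Rintegral_set1 subrr mul0r.
by rewrite Rintegral_cst//= lebesgue_measure_itv/= lte_fin ab -EFinD/= mulrC.
Qed.

(** For t near t0 the translated bumps have their supports in one fixed
    interval, which justifies differentiation under the integral. The bound
    uniform in t is the Cauchy-Schwarz inequality on an interval of length
    one, as in the supremum over a in pair_bounded. *)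
Lemma stokes_family f g a p : stokes_pair f g -> bump_on a (a + 1) p ->
  clamped_family
    (fun k t => xpairing f (a - t) (a + 1 - t) (translate p^[k] t)).
Proof.
move=> fg bp.
have cf := pair_continuous1 fg.
have aa t : a - t < a + 1 - t by lra.
have bs k t : bump_on (a - t) (a + 1 - t) (translate p^[k] t).
  by apply: bump_on_shift; exact: bump_on_derive1n.
have cs k t := bump_on_continuous (bs k t).
have ss k : smooth p^[k] by apply: smooth_derive1n; case: bp.
have extend k t t0 y : `|t - t0| < 1 ->
    xpairing f (a - t) (a + 1 - t) (translate p^[k] t) y =
    xpairing f (a - t0 - 1) (a - t0 + 2) (translate p^[k] t) y.
  rewrite ltr_distl => /andP[t1 t2].
  by apply: xpairing_extend (bs k t); lra.
have cK k t y : continuous (fun x => f (x, y) * translate p^[k] t x).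
  by apply: continuousMf => //; exact: continuous_pairR.
split.
- by move=> k t; apply: left0_xpairing => //; exact: pair_noslip1 fg.
- move=> k t; apply: xpairing_out => x; apply: (pair_noslip1 fg).
  exact: notin_oo1.
- by move=> k t; exact: stokes_pair_flux fg (aa t) (bs k t).
- move=> k t y.
  have [M1 HM1] := box_bounded (a - t - 1) (a - t + 2) y y cf.
  have [M2 HM2] := bump_on_bounded (bump_on_derive1n k.+1 bp).
  have D : is_derive t 1
      (fun s => xpairing f (a - t - 1) (a - t + 2) (translate p^[k] s) y)
      (xpairing f (a - t - 1) (a - t + 2) (translate p^[k.+1] t) y).
    apply: (@derive_segment_integral _ (fun s x => f (x, y) * translate p^[k] s x)
      (fun s x => f (x, y) * translate p^[k.+1] s x) _ _ t (M1 * M2)).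
    + by move=> s; exact: cK.
    + move=> s x _; have ? := is_derive_translate s x (ss k).
      by rewrite derive1nS; apply: is_deriveZ.
    + move=> s x _ x1; rewrite normrM ler_pM//; last exact: HM2.
      by apply: HM1; apply/boxP; rewrite /= x1 lexx.
  rewrite (extend k.+1 t t) ?subrr ?normr0//.
  apply: (@near_eq_is_derive R R R
    (fun s => xpairing f (a - t - 1) (a - t + 2) (translate p^[k] s) y)).
  near=> s; apply/esym/extend; rewrite distrC.
  by near: s; exact: (nbhsx_ballx t 1 ltr01).
- move=> k t0.
  have [M1 HM1] := box_bounded (a - t0 - 1) (a - t0 + 2) (-1) 1 cf.
  have [M2 HM2] := bump_on_bounded (bump_on_derive1n k bp).
  exists ((a - t0 + 2 - (a - t0 - 1)) * (M1 * M2)) => t y tt y1.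
  rewrite (extend k t t0)//; apply: segment_integral_bound => //; first lra.
  move=> x x1; rewrite normrM ler_pM//; last exact: HM2.
  by apply: HM1; apply/boxP.
- move=> k; have [C HC] := pair_bounded fg.
  have [m Hm] := bump_on_bounded (bump_on_derive1n k bp).
  exists (m ^+ 2 * C) => t.
  have cf2 : continuous (fun z => f z ^+ 2).
    by under eq_fun do rewrite expr2; move=> z; apply: continuousM; exact: cf.
  have E : a + 1 - t = a - t + 1 by ring.
  apply: (@le_trans _ _ (\int[mu]_(y in `[-1, 1])
    (m ^+ 2 * \int[mu]_(x in `[a - t, a + 1 - t]) (f (x, y) ^+ 2)))); last first.
    rewrite segment_integralZ; last first.
      move=> y; apply: (@continuous_integral_section _ (fun z => f (z.2, z.1) ^+ 2)).
      move=> z; apply: (@continuous_comp _ _ _ (fun z : R * R => (z.2, z.1))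
        (fun z => f z ^+ 2)); last exact: cf2.
      by apply: continuous_pairing => u; [exact: cvg_snd|exact: cvg_fst].
    rewrite ler_wpM2l ?sqr_ge0//.
    by rewrite -(box_fubini_sym (a - t) (a + 1 - t) (-1) 1 cf2) E.
  have cX : continuous (fun y => \int[mu]_(x in `[a - t, a + 1 - t]) (f (x, y) ^+ 2)).
    move=> y; apply: (@continuous_integral_section _ (fun z => f (z.2, z.1) ^+ 2)).
    move=> z; apply: (@continuous_comp _ _ _ (fun z : R * R => (z.2, z.1))
      (fun z => f z ^+ 2)); last exact: cf2.
    by apply: continuous_pairing => u; [exact: cvg_snd|exact: cvg_fst].
  apply: segment_integral_le => [||y y1].
  + by apply: continuousXf2; exact: continuous_xpairing.
  + exact: continuousZf.
  + have cfy : continuous (fun x => f (x, y) ^+ 2).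
      by apply: continuousXf2; exact: continuous_pairR.
    rewrite -(segment_integralZ _ _ _ cfy).
    apply: le_trans (segment_sqr_integral_le (ltW (aa t)) (cK k t y)) _.
    rewrite {1}E addrAC subrr add0r mul1r.
    apply: segment_integral_le.
    * exact: continuousXf2.
    * exact: continuousZf.
    * move=> x _; rewrite exprMn mulrC ler_wpM2r ?sqr_ge0//.
      by rewrite -(real_normK (num_real (translate _ _ _))) lerXn2r ?nnegrE// ?Hm//;
        apply: le_trans (Hm 0); rewrite normr_ge0.
- move=> k t q bq; have := stokes_pair_biharmonic fg (aa t) (bs k t) bq.
  by rewrite !translate_derive1n// -!derive1nD2 !(derive1nD2 _ k.+2).
Unshelve. all: by end_near. Qed.

Theorem stokes_pair_zero f g : stokes_pair f g ->
  (forall z, f z = 0) /\ (forall z, g z = 0).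
Proof.
move=> fg; have cf := pair_continuous1 fg; have cg := pair_continuous2 fg.
have fz a p y : bump_on a (a + 1) p -> -1 <= y <= 1 ->
    xpairing f a (a + 1) p y = 0.
  move=> bp y1.
  have := clamped_family_zero (stokes_family fg bp) 0 y1.
  rewrite /= !subr0 => <-; congr (xpairing _ _ _ _ _).
  by apply/funext => x; rewrite /translate mul1r addr0.
have vanish (h : R * R -> R) : continuous h ->
    (forall a p y, bump_on a (a + 1) p -> -1 <= y <= 1 ->
      xpairing h a (a + 1) p y = 0) ->
    (forall x y, ~~ (-1 < y < 1) -> h (x, y) = 0) -> forall z, h z = 0.
  move=> ch hz h0 [x y]; have [y1|] := boolP (-1 < y < 1); last exact: h0.
  apply: (@bump_orthogonal_eq0 _ (fun x => h (x, y)) (x - 1 / 2) (x - 1 / 2 + 1)).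
  - exact: continuous_pairR.
  - move=> p bp; apply: hz => //.
    by case/andP: y1 => ? ?; rewrite !ltW.
  - by apply/andP; split; lra.
split; apply: vanish => //; [exact: pair_noslip1 fg| |exact: pair_noslip2 fg].
move=> a p y bp y1.
rewrite (stokes_pair_cross_component fg _ bp y1); last by rewrite ltrDl.
have Z x : -1 <= x <= 1 -> xpairing f a (a + 1) p^[1] x = 0.
  by apply: fz; exact: bump_on_derive1n.
rewrite /primitive (@eq_segment_integral _ _ _ _ (cst 0)); last first.
  by move=> x /andP[x1 xy]; apply: Z; rewrite x1 (le_trans xy)//; case/andP: y1.
by rewrite Rintegral_cst//= mul0r.
Qed.

End stokes_uniqueness.

(** * Approximation of rectangles by product bumps *)

Section box_approximation.
Context {R : realType}.
Notation mu := (@lebesgue_measure R).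
Notation plane := (measurableTypeR R * measurableTypeR R)%type.
Implicit Types (f g : R * R -> R) (p q : R -> R) (a b c d x y : R).
Implicit Types Om : set (R * R).

Definition tensor p q (z : R * R) : R := p z.1 * q z.2.

Lemma continuous_tensor p q : continuous p -> continuous q ->
  continuous (tensor p q).
Proof.
move=> cp cq z; apply: continuousM.
  by apply: (@continuous_comp _ _ _ fst p); [exact: cvg_fst|exact: cp].
by apply: (@continuous_comp _ _ _ snd q); [exact: cvg_snd|exact: cq].
Qed.

Definition open_box a b c d : set (R * R) := `]a, b[ `*` `]c, d[.

Lemma open_boxP a b c d z :
  open_box a b c d z <-> a < z.1 < b /\ c < z.2 < d.
Proof. by rewrite /open_box /setX/= !in_itv/=. Qed.

Lemma open_box_measurable a b c d : measurable (open_box a b c d : set plane).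
Proof. by apply: measurableX; exact: measurable_itv. Qed.

Lemma open_box_setI a b c d a' b' c' d' :
  open_box a b c d `&` open_box a' b' c' d' =
  open_box (Num.max a a') (Num.min b b') (Num.max c c') (Num.min d d').
Proof.
apply/seteqP; split=> z.
  move=> [/open_boxP[/andP[? ?] /andP[? ?]] /open_boxP[/andP[? ?] /andP[? ?]]].
  by apply/open_boxP; rewrite !gt_max !lt_min; split; do !(apply/andP; split).
move/open_boxP; rewrite !gt_max !lt_min => -[/andP[/andP[? ?] /andP[? ?]]
  /andP[/andP[? ?] /andP[? ?]]].
by split; apply/open_boxP; split; apply/andP; split.
Qed.

(** The open rectangles form a pi-system; this is the form of the product
    sigma-algebra to which Dynkin's theorem applies. *)
Lemma plane_generated_by_boxes :
  @measurable _ plane =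
  <<s [set Q : set plane | exists a b c d, Q = open_box a b c d] >>.
Proof.
rewrite measurable_prod_measurableType; set G := (X in _ = <<s X >>).
apply/seteqP; split; apply: smallest_sub; try exact: smallest_sigma_algebra.
  pose T := g_sigma_algebraType G.
  have strip1 (x y : R) : measurable ((`]x, y[%classic `*` setT) : set T).
    rewrite (_ : _ `*` _ = \bigcup_n (open_box x y (- n%:R) n%:R)).
      apply: bigcupT_measurable => n; apply: sub_sigma_algebra.
      by exists x, y, (- n%:R), n%:R.
    apply/seteqP; split=> z.
      move=> [/=]; rewrite in_itv/= => xy _.
      exists (Num.trunc `|z.2|).+1 => //; apply/open_boxP; split => //.
      by rewrite -ltr_norml; exact: truncnS_gt.
    by move=> [n _ /open_boxP[h _]]; split=> //=; rewrite in_itv.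
  have strip2 (x y : R) : measurable ((setT `*` `]x, y[%classic) : set T).
    rewrite (_ : _ `*` _ = \bigcup_n (open_box (- n%:R) n%:R x y)).
      apply: bigcupT_measurable => n; apply: sub_sigma_algebra.
      by exists (- n%:R), n%:R, x, y.
    apply/seteqP; split=> z.
      move=> [_ /=]; rewrite in_itv/= => xy.
      exists (Num.trunc `|z.1|).+1 => //; apply/open_boxP; split => //.
      by rewrite -ltr_norml; exact: truncnS_gt.
    by move=> [n _ /open_boxP[_ h]]; split=> //=; rewrite in_itv.
  have m1 : measurable_fun [set: T] (fst : T -> measurableTypeR R).
    apply: (measurability _ (measurable_realfun.RGenOpens.measurableE R)).
    by move=> _ [_ [x [y ->]] <-]; rewrite setTI -setXT; exact: strip1.
  have m2 : measurable_fun [set: T] (snd : T -> measurableTypeR R).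
    apply: (measurability _ (measurable_realfun.RGenOpens.measurableE R)).
    by move=> _ [_ [x [y ->]] <-]; rewrite setTI -setTX; exact: strip2.
  move=> _ [A mA [B mB <-]].
  have -> : A `*` B = (fst @^-1` A `&` snd @^-1` B) :> set T by [].
  apply: (@measurableI _ T).
    by rewrite -[X in measurable X]setTI; exact: m1.
  by rewrite -[X in measurable X]setTI; exact: m2.
move=> _ [a [b [c [d ->]]]]; apply: sub_sigma_algebra.
by exists `]a, b[%classic; [exact: measurable_itv|exists `]c, d[%classic;
  [exact: measurable_itv|]].
Qed.

(** The argument equals (n+1) s - 1, which tends to +oo when s > 0. The offset
    1/(n+1) keeps the supports of the bumps built from it inside the open
    interval. *)
Lemma flat_cvg_indicator (s : R) :
  flat 1 (n.+1%:R * (s - n.+1%:R^-1)) @[n --> \oo] --> ((0 < s)%R%:R : R).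
Proof.
have E n : n.+1%:R * (s - n.+1%:R^-1) = n.+1%:R * s - 1 :> R.
  by rewrite mulrBr divff.
under eq_fun do rewrite E.
have [s0|s0] := ltP 0 s; last first.
  rewrite (_ : (fun n => _) = cst 0); first exact: cvg_cst.
  apply/funext => n; rewrite /flat ifF//; apply/negbTE; rewrite -leNgt subr_le0.
  by apply: le_trans ler01; rewrite mulr_ge0_le0.
apply/cvgrPdist_le => e e0; near=> n.
have big : e^-1 + 1 <= n.+1%:R * s.
  rewrite -ler_pdivrMr// (@le_trans _ _ n%:R)//.
    by near: n; exact: nbhs_infty_ger.
  by rewrite ler_nat.
set t := n.+1%:R * s - 1; have te : e^-1 <= t by rewrite /t; lra.
have t0 : 0 < t by apply: lt_le_trans te; rewrite invr_gt0.
rewrite /flat t0 hornerC mul1r ger0_norm; last first.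
  by rewrite subr_ge0 expR_le1 oppr_le0 invr_ge0 ltW.
have := expR_ge1Dx (- t^-1).
have : t^-1 <= e by rewrite -[e]invrK lef_pV2// posrE ?invr_gt0.
have -> : true%:R = 1 :> R by [].
lra.
Unshelve. all: by end_near. Qed.

Lemma bump_cvg_indicator a b x :
  bump n.+1%:R (a + n.+1%:R^-1) (b - n.+1%:R^-1) x @[n --> \oo]
    --> ((a < x < b)%R%:R : R).
Proof.
have E n : bump n.+1%:R (a + n.+1%:R^-1) (b - n.+1%:R^-1) x =
    flat 1 (n.+1%:R * (x - a - n.+1%:R^-1)) *
    flat 1 (n.+1%:R * (b - x - n.+1%:R^-1)).
  by rewrite /bump; congr (flat _ _ * flat _ _); ring.
under eq_fun do rewrite E.
have := cvgM (@flat_cvg_indicator (x - a)) (@flat_cvg_indicator (b - x)).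
by rewrite !subr_gt0 -natrM mulnb => H; exact: H.
Qed.

Lemma tensor_bump_cvg a b c d z :
  tensor (bump n.+1%:R (a + n.+1%:R^-1) (b - n.+1%:R^-1))
    (bump n.+1%:R (c + n.+1%:R^-1) (d - n.+1%:R^-1)) z @[n --> \oo]
    --> (\1_(open_box a b c d) z : R).
Proof.
have := cvgM (@bump_cvg_indicator a b z.1) (@bump_cvg_indicator c d z.2).
rewrite -natrM mulnb /tensor indicE.
suff -> : (z \in open_box a b c d) = (a < z.1 < b) && (c < z.2 < d).
  by move=> H; exact: H.
by apply/idP/andP => [/set_mem/open_boxP//|h]; apply/mem_set/open_boxP.
Qed.

(** Dominated convergence along bumps that tend to the indicator function of
    the smaller rectangle. *)
Lemma open_box_integral0 g a b c d a' b' c' d' :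
  (mu2 R).-integrable (box a b c d) (EFin \o g) ->
  (forall p q, bump_on a b p -> bump_on c d q ->
    \int[mu2 R]_(z in box a b c d) (g z * tensor p q z) = 0) ->
  a <= a' -> b' <= b -> c <= c' -> d' <= d ->
  (\int[mu2 R]_(z in box a b c d) (g z * \1_(open_box a' b' c' d') z)%:E = 0)%E.
Proof.
move=> ig orth aa bb cc dd.
have mB := @box_measurable R a b c d.
have mg : measurable_fun (box a b c d : set plane) g.
  by apply/measurable_EFinP; exact: measurable_int ig.
pose t n := tensor (bump n.+1%:R (a' + n.+1%:R^-1) (b' - n.+1%:R^-1))
    (bump n.+1%:R (c' + n.+1%:R^-1) (d' - n.+1%:R^-1)).
have k0 n : 0 < n.+1%:R :> R by [].
have kV n : 0 < n.+1%:R^-1 :> R by rewrite invr_gt0.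
have bp n : bump_on a b (bump n.+1%:R (a' + n.+1%:R^-1) (b' - n.+1%:R^-1)).
  by apply: bump_on_bump => //; move: (kV n); move: (_^-1) => v v0; lra.
have bq n : bump_on c d (bump n.+1%:R (c' + n.+1%:R^-1) (d' - n.+1%:R^-1)).
  by apply: bump_on_bump => //; move: (kV n); move: (_^-1) => v v0; lra.
have ct n : continuous (t n).
  by apply: continuous_tensor; [exact: bump_on_continuous (bp n)|
    exact: bump_on_continuous (bq n)].
have t01 n z : 0 <= t n z <= 1.
  by rewrite /t /tensor mulr_ge0 ?bump_ge0//= mulr_ile1 ?bump_ge0 ?bump_le1.
have mt n : measurable_fun (box a b c d : set plane) (t n).
  exact: measurable_funS (continuous_plane_measurable (ct n)).
have bnd n z : (`|(g z * t n z)%:E| <= `|(g z)%:E|)%E.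
  have /andP[t0 t1] := t01 n z.
  by rewrite lee_fin normrM (ger0_norm t0) ler_piMr.
have it n : (mu2 R).-integrable (box a b c d) (fun z => (g z * t n z)%:E).
  apply: (le_integrable mB _ _ ig); last by move=> z _; exact: bnd.
  by apply/measurable_EFinP/measurable_funM.
have cvg := @dominated_cvg _ _ _ (mu2 R) _ mB (fun n z => (g z * t n z)%:E)
  (fun z => (g z * \1_(open_box a' b' c' d') z)%:E) (fun z => `|(g z)%:E|)%E.
have : (\int[mu2 R]_(z in box a b c d) (g z * t n z)%:E)%E @[n --> \oo] -->
    (\int[mu2 R]_(z in box a b c d) (g z * \1_(open_box a' b' c' d') z)%:E)%E.
  apply: cvg => //.
  - by move=> n; apply/measurable_EFinP/measurable_funM.
  - move=> z _; apply: cvg_EFin; first exact: nearW.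
    by apply: cvgM; [exact: cvg_cst|exact: tensor_bump_cvg].
  - exact: integrable_abse.
rewrite (_ : (fun n => _) = cst 0%E); last first.
  apply/funext => n /=; rewrite -[LHS]fineK; last exact: integrable_fin_num (it n).
  by congr EFin; exact: (orth _ _ (bp n) (bq n)).
by move=> /cvg_lim <- //; rewrite lim_cst.
Qed.

(** The sets on which h has integral 0 form a Dynkin system. *)
Lemma integral0_generated (h : plane -> \bar R) :
  (mu2 R).-integrable setT h ->
  (\int[mu2 R]_(z in setT) h z = 0)%E ->
  (forall a b c d, \int[mu2 R]_(z in open_box a b c d) h z = 0)%E ->
  h = cst 0%E %[ae mu2 R].
Proof.
move=> ih hT hQ.
have mh := measurable_int _ ih.
have all0 S : measurable S -> (\int[mu2 R]_(z in S) h z = 0)%E.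
  rewrite plane_generated_by_boxes; move: S; apply: (@dynkin_induction _ plane _
    (fun S => (\int[mu2 R]_(z in S) h z = 0)%E)).
  - exact: plane_generated_by_boxes.
  - move=> _ _ [a [b [c [d ->]]]] [a' [b' [c' [d' ->]]]].
    by rewrite open_box_setI; do 4 eexists.
  - exact: hT.
  - by move=> _ [a [b [c [d ->]]]]; exact: hQ.
  - move=> S mS S0.
    have := @integral_setU _ _ _ (mu2 R) S (~` S) h mS (measurableC mS).
    rewrite setUv hT S0 add0e => <-//.
    by apply/disj_setPCl.
  - move=> F mF tF F0; rewrite integral_bigcup//; last first.
      by apply: integrableS ih => //; exact: bigcupT_measurable.
    by apply: eseries0 => n _ _.
apply: (@integral_ae_eq _ _ _ (mu2 R) setT) => // E _ mE.
by rewrite all0// integral0.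
Qed.

End box_approximation.

(** * The fundamental lemma with product test functions *)

Section fundamental_lemma.
Context {R : realType}.
Notation mu := (@lebesgue_measure R).
Notation plane := (measurableTypeR R * measurableTypeR R)%type.
Implicit Types (f g h F : R * R -> R) (p q : R -> R) (a b c d x y : R).
Implicit Types Om : set (R * R).

Lemma ae_zero_on_box g a b c d :
  (mu2 R).-integrable (box a b c d) (EFin \o g) ->
  (forall p q, bump_on a b p -> bump_on c d q ->
    \int[mu2 R]_(z in box a b c d) (g z * tensor p q z) = 0) ->
  g = (fun _ => 0) %[ae mu2 R in open_box a b c d].
Proof.
move=> ig orth; have mB := @box_measurable R a b c d.
pose h := (fun z => (g z * \1_(open_box a b c d) z)%:E) \_ (box a b c d).
have mg : measurable_fun (box a b c d : set plane) g.
  by apply/measurable_EFinP; exact: measurable_int ig.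
have ih : (mu2 R).-integrable setT h.
  apply/integrable_restrict => //; rewrite setTI.
  apply: (le_integrable mB _ _ ig).
    apply/measurable_EFinP/measurable_funM => //.
    by apply: measurable_indic; exact: open_box_measurable.
  move=> z _; rewrite lee_fin normrM ler_piMr// indicE.
  by case: (_ \in _); rewrite ?normr1 ?normr0.
have hQ a' b' c' d' : (\int[mu2 R]_(z in open_box a' b' c' d') h z = 0)%E.
  rewrite integral_mkcond /h -patch_setI setIC patch_setI -integral_mkcond.
  rewrite -[RHS](@open_box_integral0 _ g a b c d (Num.max a' a) (Num.min b' b)
    (Num.max c' c) (Num.min d' d) ig orth) ?le_max ?ge_min ?lexx ?orbT//.
  apply: eq_integral => z _; rewrite -open_box_setI patchE !indicE in_setI.
  by case: ifPn => //= _; rewrite mulr0.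
have hT : (\int[mu2 R]_(z in setT) h z = 0)%E.
  rewrite -(hQ a b c d) [RHS]integral_mkcond; apply: eq_integral => z _.
  rewrite [RHS]patchE; case: ifPn => // zQ; rewrite /h patchE.
  by case: ifP => // _; rewrite indicE (negbTE zQ) mulr0.
have := integral0_generated ih hT hQ.
apply: filterS => z /(_ I) + /[dup] /mem_set zQ /open_boxP[/andP[? ?] /andP[? ?]].
rewrite /h patchE mem_set; last by apply/boxP; rewrite !ltW.
by rewrite indicE zQ mulr1 => -[].
Qed.

Lemma open_measurable_fun_sub Om a b c d f : box a b c d `<=` Om -> open Om ->
  measurable_fun (Om : set plane) f ->
  measurable_fun (box a b c d : set plane) f.
Proof.
by move=> BO oO mf; apply: measurable_funS mf => //; exact: open_plane_measurable.
Qed.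

Lemma Lploc1_integrable Om g a b c d : open Om -> Lploc 1 Om g ->
  box a b c d `<=` Om -> (mu2 R).-integrable (box a b c d) (EFin \o g).
Proof.
move=> oO [mg ig] BO; apply/integrableP; split.
  by apply/measurable_EFinP; exact: open_measurable_fun_sub mg.
have := ig _ (@box_compact R a b c d) BO; apply: le_lt_trans.
by rewrite le_eqVlt; apply/orP; left; apply/eqP; apply: eq_integral => z _;
  rewrite expr1.
Qed.

Lemma integrable_mul_continuous g F a b c d : continuous F ->
  (mu2 R).-integrable (box a b c d) (EFin \o g) ->
  (mu2 R).-integrable (box a b c d) (EFin \o (fun z => g z * F z)).
Proof.
move=> cF ig; have [M HM] := box_bounded a b c d cF.
rewrite (_ : EFin \o _ = fun z => (EFin \o g) z * (EFin \o F) z)%E; last first.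
  by apply/funext => z /=; rewrite EFinM.
apply: integrableMl => //.
- exact: box_measurable.
- exact: measurable_funS (continuous_plane_measurable cF).
- exists M; split; first exact: num_real.
  by move=> N MN z /HM /le_trans; apply; exact: ltW.
Qed.

Lemma tensor_out a b c d p q z : bump_on a b p -> bump_on c d q ->
  ~ box a b c d z -> tensor p q z = 0.
Proof.
move=> bp bq nB; rewrite /tensor.
have [h1|h1] := boolP (a < z.1 < b); last by rewrite (bump_on_out bp h1) mul0r.
have [h2|h2] := boolP (c < z.2 < d); last by rewrite (bump_on_out bq h2) mulr0.
exfalso; apply: nB; apply/boxP.
by case/andP: h1 => ? ?; case/andP: h2 => ? ?; rewrite !ltW.
Qed.

Lemma integral_box_support Om g F a b c d : box a b c d `<=` Om ->
  (forall z, ~ box a b c d z -> F z = 0) ->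
  \int[mu2 R]_(z in Om) (g z * F z) = \int[mu2 R]_(z in box a b c d) (g z * F z).
Proof.
move=> BO F0; apply: Rintegral_support => z; first by move=> _ /F0 ->; rewrite mulr0.
by move=> /BO Oz /(_ Oz).
Qed.

(** Rational corners give countably many rectangles; indices that do not code
    a good one are sent to an empty rectangle. *)
Lemma open_inner_boxes Om : open Om -> exists a b c d : nat -> R,
  (forall n, box (a n) (b n) (c n) (d n) `<=` Om) /\
  (forall z, Om z -> exists n, open_box (a n) (b n) (c n) (d n) z).
Proof.
move=> oO.
pose good (q : rat * rat * rat * rat) :=
  `[< box (ratr q.1.1.1) (ratr q.1.1.2) (ratr q.1.2) (ratr q.2) `<=` Om >].
pose Q n := if unpickle n is Some q then if good q then q else (1, 0, 1, 0)
  else (1, 0, 1, 0) : rat * rat * rat * rat.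
exists (fun n => ratr (Q n).1.1.1), (fun n => ratr (Q n).1.1.2),
  (fun n => ratr (Q n).1.2), (fun n => ratr (Q n).2); split.
  have em : box (ratr 1) (ratr 0) (ratr 1) (ratr 0) `<=` Om.
    move=> z /boxP[/andP[h1 h2] _]; have := le_trans h1 h2.
    by rewrite rmorph1 rmorph0 ler10.
  move=> n; rewrite /Q; case: unpickle => [q|//].
  by case: ifP => // /asboolP.
move=> z Oz.
have [e /= e0 He] : nbhs_ball z Om by apply/nbhs_ballP; exact: open_nbhs_nbhs.
have [q1 q1z] : exists q : rat, ratr q \in `](z.1 - e), z.1[.
  by apply: rat_in_itvoo; rewrite ltrBlDr ltrDl.
have [q2 q2z] : exists q : rat, ratr q \in `]z.1, (z.1 + e)[.
  by apply: rat_in_itvoo; rewrite ltrDl.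
have [q3 q3z] : exists q : rat, ratr q \in `](z.2 - e), z.2[.
  by apply: rat_in_itvoo; rewrite ltrBlDr ltrDl.
have [q4 q4z] : exists q : rat, ratr q \in `]z.2, (z.2 + e)[.
  by apply: rat_in_itvoo; rewrite ltrDl.
move: q1z q2z q3z q4z; rewrite !in_itv/= => /andP[a1 b1] /andP[a2 b2]
  /andP[a3 b3] /andP[a4 b4].
exists (pickle (q1, q2, q3, q4)).
rewrite /Q pickleK ifT.
  by apply/open_boxP; rewrite /= b1 a2 b3 a4.
apply/asboolP => -[x y] /boxP[/= /andP[x1 x2] /andP[y1 y2]].
by apply: He; split; rewrite /ball/= ltr_distl; apply/andP; split; lra.
Qed.

(** An open set is a countable union of open rectangles whose closures it
    contains, and a countable union of null sets is null. *)
Lemma fundamental_lemma Om g : open Om -> Lploc 1 Om g ->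
  (forall a b c d p q, box a b c d `<=` Om -> bump_on a b p -> bump_on c d q ->
    \int[mu2 R]_(z in Om) (g z * tensor p q z) = 0) ->
  g = (fun _ => 0) %[ae mu2 R in Om].
Proof.
move=> oO Lg orth.
have [a [b [c [d [BO cov]]]]] := open_inner_boxes oO.
have H n : g = (fun _ => 0) %[ae mu2 R in open_box (a n) (b n) (c n) (d n)].
  apply: ae_zero_on_box; first exact: Lploc1_integrable (BO n).
  move=> p q bp bq; rewrite -(orth _ _ _ _ p q (BO n) bp bq).
  apply/esym/integral_box_support => //.
  by move=> z; exact: tensor_out.
apply: filterS (ae_foralln H) => z Hz Oz.
by have [n zn] := cov z Oz; exact: (Hz n).
Qed.

End fundamental_lemma.

(** * Weak derivatives tested against products *)

Section tensor_test_functions.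
Context {R : realType}.
Notation mu := (@lebesgue_measure R).
Notation plane := (measurableTypeR R * measurableTypeR R)%type.
Implicit Types (f g h F : R * R -> R) (p q : R -> R) (a b c d x y : R).
Implicit Types Om : set (R * R).

Lemma ae_imp (P Q : R * R -> Prop) : (forall z, P z -> Q z) ->
  (\forall z \ae mu2 R, P z) -> \forall z \ae mu2 R, Q z.
Proof.
move=> PQ; apply: filterS => //; exact: (ae_filter_ringOfSetsType (mu2 R)).
Qed.

Lemma ae_imp2 (P1 P2 Q : R * R -> Prop) : (forall z, P1 z -> P2 z -> Q z) ->
  (\forall z \ae mu2 R, P1 z) -> (\forall z \ae mu2 R, P2 z) ->
  \forall z \ae mu2 R, Q z.
Proof.
move=> PQ; apply: filterS2 => //; exact: (ae_filter_ringOfSetsType (mu2 R)).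
Qed.

Lemma quotient_e1 f z :
  (fun k : R => k^-1 *: ((f \o shift z) (k *: e1 R) - f z)) =
  (fun k => k^-1 *: (((fun x => f (x, z.2)) \o shift z.1) (k *: 1) -
    (fun x => f (x, z.2)) z.1)).
Proof.
apply/funext => k; rewrite /shift/= /e1.
have -> : k *: ((1, 0) : R * R) + z = (k *: 1 + z.1, z.2).
  by rewrite [RHS]surjective_pairing/=; congr (_, _); rewrite /= scaler0 add0r.
by rewrite -surjective_pairing.
Qed.

Lemma quotient_e2 f z :
  (fun k : R => k^-1 *: ((f \o shift z) (k *: e2 R) - f z)) =
  (fun k => k^-1 *: (((fun y => f (z.1, y)) \o shift z.2) (k *: 1) -
    (fun y => f (z.1, y)) z.2)).
Proof.
apply/funext => k; rewrite /shift/= /e2.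
have -> : k *: ((0, 1) : R * R) + z = (z.1, k *: 1 + z.2).
  by rewrite [RHS]surjective_pairing/=; congr (_, _); rewrite /= scaler0 add0r.
by rewrite -surjective_pairing.
Qed.

Lemma derivable_e1 f z :
  derivable f z (e1 R) <-> derivable (fun x => f (x, z.2)) z.1 1.
Proof. by rewrite /derivable quotient_e1. Qed.

Lemma derivable_e2 f z :
  derivable f z (e2 R) <-> derivable (fun y => f (z.1, y)) z.2 1.
Proof. by rewrite /derivable quotient_e2. Qed.

Lemma derive_e1 f z : 'D_(e1 R) f z = (fun x => f (x, z.2))^D z.1.
Proof. by rewrite derive1E /derive quotient_e1. Qed.

Lemma derive_e2 f z : 'D_(e2 R) f z = (fun y => f (z.1, y))^D z.2.
Proof. by rewrite derive1E /derive quotient_e2. Qed.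

Lemma derive1Zl p (k : R) x : (forall x, derivable p x 1) ->
  (fun x => k * p x)^D x = k * p^D x.
Proof. by move=> dp; rewrite !derive1E; exact: deriveZ. Qed.

Lemma derive_e1_tensor p q : smooth p ->
  (fun z => 'D_(e1 R) (tensor p q) z) = tensor p^D q.
Proof.
move=> sp; apply/funext => z; rewrite derive_e1 /tensor/=.
under eq_fun do rewrite mulrC.
by rewrite derive1Zl 1?mulrC// => x; exact: smooth_derivable.
Qed.

Lemma derive_e2_tensor p q : smooth q ->
  (fun z => 'D_(e2 R) (tensor p q) z) = tensor p q^D.
Proof.
move=> sq; apply/funext => z; rewrite derive_e2 /tensor/=.
by rewrite derive1Zl// => x; exact: smooth_derivable.
Qed.

Lemma Ck_tensor k p q : smooth p -> smooth q -> Ck k (tensor p q).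
Proof.
elim: k p q => [|k IH] p q sp sq /=.
  by apply: continuous_tensor; exact: smooth_continuous.
split.
- move=> z; apply/derivable_e1; rewrite /tensor/=.
  under eq_fun do rewrite mulrC.
  by apply: derivableZ; exact: smooth_derivable.
- move=> z; apply/derivable_e2; rewrite /tensor/=.
  by apply: derivableZ; exact: smooth_derivable.
- by apply: continuous_tensor; exact: smooth_continuous.
- by rewrite derive_e1_tensor//; apply: IH => //; exact: smooth_derive1.
- by rewrite derive_e2_tensor//; apply: IH => //; exact: smooth_derive1.
Qed.

Lemma pderive_tensor al p q : smooth p -> smooth q ->
  pderive al (tensor p q) = tensor p^[al.1] q^[al.2].
Proof.
move=> sp sq; rewrite /pderive.
have -> : iter al.2 (fun g z => 'D_(e2 R) g z) (tensor p q) = tensor p q^[al.2].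
  elim: al.2 => [//|n IH]; rewrite iterS IH derive1nS derive_e2_tensor//.
  exact: smooth_derive1n.
elim: al.1 => [//|n IH]; rewrite iterS IH derive1nS derive_e1_tensor//.
exact: smooth_derive1n.
Qed.

Lemma closed_box a b c d : closed (box a b c d).
Proof.
apply: compact_closed; last exact: box_compact.
exact: norm_hausdorff.
Qed.

Lemma test_function_tensor Om a b c d p q : box a b c d `<=` Om ->
  bump_on a b p -> bump_on c d q -> test_function Om (tensor p q).
Proof.
move=> BO bp bq.
have sub : closure [set z | tensor p q z != 0] `<=` box a b c d.
  rewrite closureE; apply: smallest_sub; first exact: closed_box.
  move=> z /= z0; apply: contrapT => nB.
  by move: z0; rewrite (tensor_out bp bq nB) eqxx.
split.
- by move=> k; apply: Ck_tensor; [case: bp|case: bq].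
- by apply: subclosed_compact sub; [exact: closed_closure|exact: box_compact].
- exact: subset_trans BO.
Qed.

(** A product of bumps is an admissible test function whose partial
    derivatives are again products. *)
Lemma weak_derivative_tensor Om al f g a b c d p q :
  weak_derivative Om al f g -> box a b c d `<=` Om ->
  bump_on a b p -> bump_on c d q ->
  \int[mu2 R]_(z in Om) (f z * tensor p^[al.1] q^[al.2] z) =
  (-1) ^+ (al.1 + al.2) * \int[mu2 R]_(z in Om) (g z * tensor p q z).
Proof.
move=> [_ _ H] BO bp bq.
by rewrite -(H _ (test_function_tensor BO bp bq)) pderive_tensor//;
  [case: bp|case: bq].
Qed.

Lemma LplocB Om f g : open Om -> Lploc 1 Om f -> Lploc 1 Om g ->
  Lploc 1 Om (fun z => f z - g z).
Proof.
move=> oO [mf If] [mg Ig]; have mO := open_plane_measurable oO.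
split; first exact: measurable_funB.
move=> K cK KO.
have mK : measurable (K : set plane).
  rewrite -[K]setCK; apply: measurableC; apply: open_plane_measurable.
  by apply: closed_openC; apply: compact_closed cK; exact: norm_hausdorff.
have ab h : Lploc 1 Om h -> (mu2 R).-integrable K (EFin \o h).
  move=> [mh Ih]; apply/integrableP; split.
    by apply/measurable_EFinP; exact: measurable_funS mh.
  apply: le_lt_trans (Ih _ cK KO).
  by rewrite le_eqVlt; apply/orP; left; apply/eqP; apply: eq_integral => z _;
    rewrite expr1.
have : (mu2 R).-integrable K (EFin \o (fun z => f z - g z)).
  rewrite (_ : _ \o _ = (EFin \o f) \- (EFin \o g))%E; last first.
    by apply/funext.
  by apply: integrableB => //; exact: ab.
move=> /integrableP[_]; apply: le_lt_trans.
by rewrite le_eqVlt; apply/orP; left; apply/eqP; apply: eq_integral => z _;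
  rewrite expr1.
Qed.

Lemma ae_eq_Rintegral_mul (D : set (R * R)) f g h :
  measurable (D : set plane) ->
  measurable_fun (D : set plane) f -> measurable_fun (D : set plane) g ->
  measurable_fun (D : set plane) h ->
  f = g %[ae mu2 R in D] ->
  \int[mu2 R]_(z in D) (f z * h z) = \int[mu2 R]_(z in D) (g z * h z).
Proof.
move=> mD mf mg mh fg; congr fine; apply: ae_eq_integral => //.
- by apply/measurable_EFinP/measurable_funM.
- by apply/measurable_EFinP/measurable_funM.
- by apply: ae_imp fg => z fg Dz; rewrite fg.
Qed.

Lemma ae_eq_from_tensors Om g1 g2 : open Om -> Lploc 1 Om g1 -> Lploc 1 Om g2 ->
  (forall a b c d p q, box a b c d `<=` Om -> bump_on a b p -> bump_on c d q ->
    \int[mu2 R]_(z in Om) (g1 z * tensor p q z) =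
    \int[mu2 R]_(z in Om) (g2 z * tensor p q z)) ->
  g1 = g2 %[ae mu2 R in Om].
Proof.
move=> oO L1 L2 H.
suff : (fun z => g1 z - g2 z) = (fun _ => 0) %[ae mu2 R in Om].
  by apply: ae_imp => z Hz /Hz /eqP; rewrite subr_eq0 => /eqP.
apply: fundamental_lemma => //; first exact: LplocB.
move=> a b c d p q BO bp bq.
have out z : ~ box a b c d z -> tensor p q z = 0 by exact: tensor_out.
rewrite (integral_box_support _ BO out).
have ct : continuous (tensor p q).
  by apply: continuous_tensor; [exact: bump_on_continuous bp|
    exact: bump_on_continuous bq].
under eq_Rintegral do rewrite mulrBl.
rewrite RintegralB; [|exact: box_measurable|
  exact: integrable_mul_continuous (Lploc1_integrable oO L1 BO)|
  exact: integrable_mul_continuous (Lploc1_integrable oO L2 BO)].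
rewrite -!(integral_box_support _ BO out).
by rewrite (H _ _ _ _ _ _ BO bp bq) subrr.
Qed.

Lemma weak_derivative_unique Om al f1 f2 g1 g2 : open Om ->
  weak_derivative Om al f1 g1 -> weak_derivative Om al f2 g2 ->
  f1 = f2 %[ae mu2 R in Om] -> g1 = g2 %[ae mu2 R in Om].
Proof.
move=> oO w1 w2 f12.
have [L1 M1 _] := w1; have [L2 M2 _] := w2.
apply: ae_eq_from_tensors => // a b c d p q BO bp bq.
have := weak_derivative_tensor w1 BO bp bq.
have E : \int[mu2 R]_(z in Om) (f1 z * tensor p^[al.1] q^[al.2] z) =
    \int[mu2 R]_(z in Om) (f2 z * tensor p^[al.1] q^[al.2] z).
  apply: ae_eq_Rintegral_mul f12.
  - exact: open_plane_measurable.
  - exact: L1.1.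
  - exact: L2.1.
  - apply: measurable_funS (continuous_plane_measurable _) => //.
    apply: continuous_tensor.
      exact: bump_on_continuous (bump_on_derive1n _ bp).
    exact: bump_on_continuous (bump_on_derive1n _ bq).
rewrite E (weak_derivative_tensor w2 BO bp bq) => /eqP.
by rewrite (inj_eq (mulfI _)) ?signr_eq0// => /eqP.
Qed.

Lemma wD_weak_derivative Om al f g : weak_derivative Om al f g ->
  weak_derivative Om al f (wD Om al f).
Proof. by move=> wg; apply: (@xgetPex _ _ [set g | weak_derivative Om al f g]); exists g. Qed.

End tensor_test_functions.

(** * Classical derivatives of products are weak derivatives *)

Section classical_weak_derivatives.
Context {R : realType}.
Notation mu := (@lebesgue_measure R).
Notation plane := (measurableTypeR R * measurableTypeR R)%type.
Implicit Types (f g h F phi : R * R -> R) (p q : R -> R) (a b c d x y : R).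
Implicit Types Om : set (R * R).

Lemma near_pairR z (P : R * R -> Prop) : (\forall w \near z, P w) ->
  \forall x \near (z.1 : R), P (x, z.2).
Proof.
move=> /nbhs_ballP[e /= e0 He]; apply/nbhs_ballP; exists e => //= x xz.
by apply: He; split=> //=; exact: ballxx.
Qed.

Lemma near_pairL z (P : R * R -> Prop) : (\forall w \near z, P w) ->
  \forall y \near (z.2 : R), P (z.1, y).
Proof.
move=> /nbhs_ballP[e /= e0 He]; apply/nbhs_ballP; exists e => //= y yz.
by apply: He; split=> //=; exact: ballxx.
Qed.

Lemma derive1_near0 p x : (\forall y \near x, p y = 0) -> p^D x = 0.
Proof.
move=> px; rewrite derive1E; have d0 : is_derive x 1 p 0.
  by apply: (@near_eq_is_derive R R R (cst 0)); apply: filterS px => y ->.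
exact: derive_val.
Qed.

Lemma notin_support_near0 phi z : ~ closure [set z | phi z != 0] z ->
  \forall w \near z, phi w = 0.
Proof.
move=> nz; have := open_nbhs_nbhs (conj (closed_openC (@closed_closure _
  [set z | phi z != 0])) nz).
apply: filterS => w nw; apply: contrapT => w0; apply: nw.
by apply: subset_closure; exact/eqP.
Qed.

Lemma support_derive_e1 phi :
  closure [set z | 'D_(e1 R) phi z != 0] `<=` closure [set z | phi z != 0].
Proof.
rewrite [X in X `<=` _]closureE; apply: smallest_sub; first exact: closed_closure.
move=> z /= dz; apply: contrapT => /notin_support_near0 H; move/eqP: dz; apply.
rewrite derive_e1; apply: derive1_near0.
exact: (near_pairR (P := fun w => phi w = 0) H).
Qed.

Lemma support_derive_e2 phi :
  closure [set z | 'D_(e2 R) phi z != 0] `<=` closure [set z | phi z != 0].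
Proof.
rewrite [X in X `<=` _]closureE; apply: smallest_sub; first exact: closed_closure.
move=> z /= dz; apply: contrapT => /notin_support_near0 H; move/eqP: dz; apply.
rewrite derive_e2; apply: derive1_near0.
exact: (near_pairL (P := fun w => phi w = 0) H).
Qed.

Lemma test_function_e1 Om phi : test_function Om phi ->
  test_function Om (fun z => 'D_(e1 R) phi z).
Proof.
move=> [ck cK KO]; split.
- by move=> k; have [] := ck k.+1.
- by apply: subclosed_compact (@support_derive_e1 phi); [exact: closed_closure|].
- exact: subset_trans (@support_derive_e1 phi) KO.
Qed.

Lemma test_function_e2 Om phi : test_function Om phi ->
  test_function Om (fun z => 'D_(e2 R) phi z).
Proof.
move=> [ck cK KO]; split.
- by move=> k; have [] := ck k.+1.
- by apply: subclosed_compact (@support_derive_e2 phi); [exact: closed_closure|].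
- exact: subset_trans (@support_derive_e2 phi) KO.
Qed.

Lemma compact_in_box (K : set (R * R)) : compact K ->
  exists2 N : R, 0 < N & K `<=` open_box (- N) N (- N) N.
Proof.
move=> cK; have [M [_ HM]] := compact_bounded cK.
exists (`|M| + 2); first by rewrite ltr_wpDl.
move=> z Kz; have := HM (`|M| + 1) _ z Kz.
have h : M < `|M| + 1 by rewrite (le_lt_trans (ler_norm M))// ltrDl.
move=> /(_ h) zM; apply/open_boxP; rewrite -!ltr_norml.
have [z1 z2] : `|z.1| <= `|z| /\ `|z.2| <= `|z|.
  by rewrite {2 4}/Num.norm/= !le_max !lexx orbT.
have M12 : `|M| + 1 < `|M| + 2 by rewrite ltrD2l ltr1n.
by split; [exact: le_lt_trans (le_trans z1 zM) M12|
  exact: le_lt_trans (le_trans z2 zM) M12].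
Qed.

Lemma test_integral_box Om phi F N : test_function Om phi ->
  closure [set z | phi z != 0] `<=` open_box (- N) N (- N) N ->
  \int[mu2 R]_(z in Om) (F z * phi z) =
  \int[mu2 R]_(z in box (- N) N (- N) N) (F z * phi z).
Proof.
move=> [_ _ KO] KN.
have out z : ~ closure [set z | phi z != 0] z -> phi z = 0.
  by move=> nz; apply: contrapT => z0; apply/nz/subset_closure/eqP.
apply: Rintegral_support => z.
  move=> _ nB; rewrite out ?mulr0// => /KN /open_boxP[/andP[? ?] /andP[? ?]].
  by apply: nB; apply/boxP; rewrite !ltW.
by move=> _ nO; rewrite out ?mulr0// => /KO.
Qed.

(** Fubini on a square that contains the support, and integration by parts on
    each horizontal segment, where the boundary values of phi vanish. *)
Lemma test_by_parts_e1 Om phi p q : smooth p -> smooth q -> test_function Om phi ->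
  \int[mu2 R]_(z in Om) (tensor p q z * 'D_(e1 R) phi z) =
  - \int[mu2 R]_(z in Om) (tensor p^D q z * phi z).
Proof.
move=> sp sq tphi; have tD := test_function_e1 tphi.
have [ck cK _] := tphi; have [N N0 KN] := compact_in_box cK.
have KN' := subset_trans (@support_derive_e1 phi) KN.
rewrite (test_integral_box _ tD KN') (test_integral_box _ tphi KN).
have [d1 _ cphi cd1 _] := ck 1%N.
have cp := smooth_continuous sp; have cq := smooth_continuous sq.
have cp' := smooth_continuous (smooth_derive1 sp).
have out z : ~ open_box (- N) N (- N) N z -> phi z = 0.
  by move=> nz; apply: contrapT => z0; apply/nz/KN/subset_closure/eqP.
rewrite box_fubini_sym; last first.
  by move=> z; apply: continuousM; [exact: continuous_tensor|exact: cd1].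
rewrite [in RHS]box_fubini_sym; last first.
  by move=> z; apply: continuousM; [exact: continuous_tensor|exact: cphi].
have ctb : continuous (fun y => \int[mu]_(x in `[(- N), N])
    (tensor p^D q (x, y) * phi (x, y))).
  have cF : continuous (fun z : R * R =>
      tensor p^D q (z.2, z.1) * phi (z.2, z.1)).
    move=> z; have cs : continuous (fun z : R * R => (z.2, z.1)).
      by apply: continuous_pairing => u; [exact: cvg_snd|exact: cvg_fst].
    apply: (@continuous_comp _ _ _ (fun z : R * R => (z.2, z.1))
      (fun z => tensor p^D q z * phi z)); first exact: cs.
    by apply: continuousM; [exact: continuous_tensor|exact: cphi].
  by move=> y; exact: (@continuous_integral_section _ _ (- N) N cF y).
rewrite -[RHS]mulN1r -(segment_integralZ _ _ _ ctb).
apply: eq_segment_integral => y _; rewrite mulN1r.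
have dphi x : is_derive x 1 (fun x => phi (x, y)) ('D_(e1 R) phi (x, y)).
  apply: DeriveDef; first exact: ((derivable_e1 phi (x, y)).1 (d1 _)).
  by rewrite -derive1E derive_e1.
have dF x : is_derive x 1 (fun x => tensor p q (x, y)) (tensor p^D q (x, y)).
  rewrite /tensor/=; have ? := smooth_is_derive x sp.
  rewrite mulrC (_ : (fun x => p x * q y) = (fun x => q y * p x)).
    exact: is_deriveZ.
  by apply/funext => z; rewrite mulrC.
rewrite (segment_by_parts _ dF _ dphi).
- rewrite !out ?mulr0 ?subrr ?sub0r// => /open_boxP[/=].
    by rewrite ltxx ?andbF.
  by rewrite ltxx ?andbF.
- lra.
- by apply: continuous_pairR; exact: continuous_tensor.
- exact: (@continuous_pairR _ (fun z => 'D_(e1 R) phi z) y cd1).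
Qed.

Lemma test_by_parts_e2 Om phi p q : smooth p -> smooth q -> test_function Om phi ->
  \int[mu2 R]_(z in Om) (tensor p q z * 'D_(e2 R) phi z) =
  - \int[mu2 R]_(z in Om) (tensor p q^D z * phi z).
Proof.
move=> sp sq tphi; have tD := test_function_e2 tphi.
have [ck cK _] := tphi; have [N N0 KN] := compact_in_box cK.
have KN' := subset_trans (@support_derive_e2 phi) KN.
rewrite (test_integral_box _ tD KN') (test_integral_box _ tphi KN).
have [_ d2 cphi _ cd2] := ck 1%N.
have cp := smooth_continuous sp; have cq := smooth_continuous sq.
have cq' := smooth_continuous (smooth_derive1 sq).
have out z : ~ open_box (- N) N (- N) N z -> phi z = 0.
  by move=> nz; apply: contrapT => z0; apply/nz/KN/subset_closure/eqP.
have cF : continuous (fun z : R * R => tensor p q^D z * phi z).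
  by move=> z; apply: continuousM; [exact: continuous_tensor|exact: cphi].
rewrite box_fubini; last first.
  by move=> z; apply: continuousM; [exact: continuous_tensor|exact: cd2].
rewrite [in RHS]box_fubini//.
rewrite -[RHS]mulN1r -(segment_integralZ _ _ _ (@continuous_integral_section _ _ (- N) N cF)).
apply: eq_segment_integral => x _; rewrite mulN1r.
have dphi y : is_derive y 1 (fun y => phi (x, y)) ('D_(e2 R) phi (x, y)).
  apply: DeriveDef; first exact: ((derivable_e2 phi (x, y)).1 (d2 _)).
  by rewrite -derive1E derive_e2.
have dF y : is_derive y 1 (fun y => tensor p q (x, y)) (tensor p q^D (x, y)).
  by rewrite /tensor/=; have ? := smooth_is_derive y sq; exact: is_deriveZ.
rewrite (segment_by_parts _ dF _ dphi).
- rewrite !out ?mulr0 ?subrr ?sub0r// => /open_boxP[/= _].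
    by rewrite ltxx ?andbF.
  by rewrite ltxx ?andbF.
- lra.
- by apply: continuous_pairL; exact: continuous_tensor.
- exact: (@continuous_pairL _ (fun z => 'D_(e2 R) phi z) x cd2).
Qed.

Lemma test_by_parts Om phi al p q : smooth p -> smooth q ->
  test_function Om phi ->
  \int[mu2 R]_(z in Om) (tensor p q z * pderive al phi z) =
  (-1) ^+ (al.1 + al.2) *
    \int[mu2 R]_(z in Om) (tensor p^[al.1] q^[al.2] z * phi z).
Proof.
move=> sp sq; rewrite /pderive; move: al.1 al.2 => i j {al} tphi.
have tj n : test_function Om (iter n (fun g z => 'D_(e2 R) g z) phi).
  by elim: n => [//|n IH]; exact: test_function_e2.
have -> : \int[mu2 R]_(z in Om) (tensor p q z *
    iter i (fun g z => 'D_(e1 R) g z) (iter j (fun g z => 'D_(e2 R) g z) phi) z) =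
    (-1) ^+ i * \int[mu2 R]_(z in Om) (tensor p^[i] q z *
      iter j (fun g z => 'D_(e2 R) g z) phi z).
  have ti n : test_function Om (iter n (fun g z => 'D_(e1 R) g z)
      (iter j (fun g z => 'D_(e2 R) g z) phi)).
    by elim: n => [|n IH]; [exact: tj|exact: test_function_e1].
  elim: i p sp => [|i IH] p sp; first by rewrite mul1r.
  rewrite iterS (test_by_parts_e1 sp sq (ti i)) IH; last exact: smooth_derive1.
  by rewrite exprS mulN1r mulNr -derive1Sn.
rewrite exprD -mulrA; congr (_ * _).
have {}sp : smooth p^[i] by exact: smooth_derive1n.
elim: j q sq tj => [|j IH] q sq tj; first by rewrite mul1r.
rewrite iterS (test_by_parts_e2 sp sq (tj j)) IH//; last exact: smooth_derive1.
by rewrite exprS mulN1r mulNr -derive1Sn.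
Qed.

End classical_weak_derivatives.

(** * Function spaces on the strip *)

Section smooth_members.
Context {R : realType}.
Notation mu := (@lebesgue_measure R).
Notation plane := (measurableTypeR R * measurableTypeR R)%type.
Implicit Types (f g h F phi : R * R -> R) (p q : R -> R) (a b c d x y : R).
Implicit Types Om : set (R * R).

Lemma compact_plane_measurable (K : set (R * R)) : compact K ->
  measurable (K : set plane).
Proof.
move=> cK; rewrite -[K]setCK; apply: measurableC; apply: open_plane_measurable.
by apply: closed_openC; apply: compact_closed cK; exact: norm_hausdorff.
Qed.

Lemma continuous_Lploc n Om F : continuous F -> Lploc n Om F.
Proof.
move=> cF; split.
  exact: measurable_funS (continuous_plane_measurable cF).
move=> K cK _; have mK := compact_plane_measurable cK.
have [N N0 KN] := compact_in_box cK.
have cG : continuous (fun z => `|F z| ^+ n).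
  move=> z; apply: (@continuous_comp _ _ _ (fun z => `|F z|) (fun x => x ^+ n)).
    by apply: cvg_norm; exact: cF.
  exact: exprn_continuous.
have /integrableP[_] := box_integrable (- N) N (- N) N cG.
apply: le_lt_trans.
have -> : (\int[mu2 R]_(z in K) (`|F z| ^+ n)%:E =
    \int[mu2 R]_(z in K) `|((`|F z| ^+ n)%R)%:E|)%E.
  by apply: eq_integral => z _; rewrite gee0_abs// lee_fin exprn_ge0.
apply: ge0_subset_integral => //.
- exact: box_measurable.
- apply: measurableT_comp => //; apply/measurable_EFinP.
  exact: measurable_funS (continuous_plane_measurable cG).
- move=> z /KN /open_boxP[/andP[? ?] /andP[? ?]].
  by apply/boxP; rewrite !ltW.
Qed.

Lemma Lploc_ae n Om f g : open Om -> measurable_fun (Om : set plane) f ->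
  f = g %[ae mu2 R in Om] -> Lploc n Om g -> Lploc n Om f.
Proof.
move=> oO mf fg [mg ig]; split=> // K cK KO.
have mK := compact_plane_measurable cK.
rewrite (ae_eq_integral (fun z : plane => (`|g z| ^+ n)%:E))//; first exact: ig.
- apply/measurable_EFinP; apply: measurable_funX; apply: measurableT_comp => //.
  exact: measurable_funS (open_plane_measurable oO) KO mf.
- apply/measurable_EFinP; apply: measurable_funX; apply: measurableT_comp => //.
  exact: measurable_funS (open_plane_measurable oO) KO mg.
- by apply: ae_imp fg => z H /KO /H ->.
Qed.

Lemma Lploc_sub n Om Om' f : open Om -> Om' `<=` Om -> Lploc n Om f ->
  Lploc n Om' f.
Proof.
move=> oO OO [mf If]; split.
  exact: measurable_funS (open_plane_measurable oO) OO mf.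
by move=> K cK KO; apply: If => //; exact: subset_trans OO.
Qed.

Lemma test_function_continuous Om phi al : test_function Om phi ->
  continuous (pderive al phi).
Proof.
move=> tp; suff [] : test_function Om (pderive al phi) by move=> /(_ 0%N).
rewrite /pderive; elim: al.1 => [|i IH]; last exact: test_function_e1.
by elim: al.2 => [//|j IH]; exact: test_function_e2.
Qed.

Lemma weak_derivative_ae Om al f f' g : open Om ->
  measurable_fun (Om : set plane) f -> f = f' %[ae mu2 R in Om] ->
  weak_derivative Om al f' g -> weak_derivative Om al f g.
Proof.
move=> oO mf ff [Lf Lg H]; split=> //; first exact: Lploc_ae Lf.
move=> phi tp; rewrite -(H _ tp); apply: ae_eq_Rintegral_mul => //.
- exact: open_plane_measurable.
- exact: Lf.1.
- apply: measurable_funS (continuous_plane_measurable _) => //.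
  exact: test_function_continuous tp.
Qed.

Lemma tensor_weak_derivative Om al p q : smooth p -> smooth q ->
  weak_derivative Om al (tensor p q) (tensor p^[al.1] q^[al.2]).
Proof.
move=> sp sq; split.
- by apply: continuous_Lploc; apply: continuous_tensor; exact: smooth_continuous.
- apply: continuous_Lploc; apply: continuous_tensor;
    apply: smooth_continuous; exact: smooth_derive1n.
- by move=> phi tp; exact: test_by_parts tp.
Qed.

Lemma Hloc_ae_tensor m Om f p q : open Om -> measurable_fun (Om : set plane) f ->
  smooth p -> smooth q -> f = tensor p q %[ae mu2 R in Om] -> Hloc m Om f.
Proof.
move=> oO mf sp sq fpq.
have ct n k : continuous (tensor p^[n] q^[k]).
  by apply: continuous_tensor; apply: smooth_continuous; exact: smooth_derive1n.
split; first exact: Lploc_ae fpq (continuous_Lploc _ _ (ct 0%N 0%N)).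
move=> al _; exists (tensor p^[al.1] q^[al.2]); last exact: continuous_Lploc.
exact: weak_derivative_ae fpq (tensor_weak_derivative _ _ sp sq).
Qed.

Lemma open_strip : open (@strip R).
Proof.
rewrite (_ : @strip R = snd @^-1` `]-1, 1[); last first.
  by apply/seteqP; split=> z /=; rewrite in_itv.
by apply: open_comp; [move=> z _; exact: cvg_snd|exact: interval_open].
Qed.

Lemma strip_rectE a : strip_rect a = open_box a (a + 1) (-1) 1.
Proof.
by apply/seteqP; split=> z; [move=> h; apply/open_boxP|move/open_boxP].
Qed.

Lemma open_open_box a b c d : open (open_box a b c d).
Proof.
rewrite (_ : open_box a b c d = fst @^-1` `]a, b[ `&` snd @^-1` `]c, d[)//.
by apply: openI; apply: open_comp;
  [move=> z _; exact: cvg_fst|exact: interval_open|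
   move=> z _; exact: cvg_snd|exact: interval_open].
Qed.

Lemma open_strip_rect a : open (strip_rect a).
Proof. by rewrite strip_rectE; exact: open_open_box. Qed.

Lemma strip_rect_sub a : strip_rect a `<=` @strip R.
Proof. by move=> z []. Qed.

Lemma mu2_strip_rect a : mu2 R (strip_rect a) = 2%:E.
Proof.
rewrite strip_rectE /open_box product_measure1E;
  [|exact: measurable_itv|exact: measurable_itv].
have E1 : mu `]a, (a + 1)[%classic = 1%:E.
  by rewrite lebesgue_measure_itv/= lte_fin ltrDl ltr01 -EFinB addrAC subrr add0r.
have E2 : mu `]-1, 1[%classic = 2%:E.
  by rewrite lebesgue_measure_itv/= lte_fin ifT; [rewrite -EFinB opprK|lra].
by rewrite [X in (X * _)%E]E1 [X in (_ * X)%E]E2 mul1e.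
Qed.

(** The derivatives of p are bounded on the whole line, which makes the norm
    uniform in the position a of the rectangle; those of q are bounded on ]-1,
    1[ by continuity on the closed interval. *)
Lemma Xspace_ae_tensor m f p q :
  measurable_fun (@strip R : set plane) f -> smooth p -> smooth q ->
  (forall i, exists M, forall x, `|p^[i] x| <= M) ->
  f = tensor p q %[ae mu2 R in @strip R] -> Xspace m f.
Proof.
move=> mf sp sq bp fpq; split; first exact: Hloc_ae_tensor open_strip _ _ _ fpq.
have cq j : continuous q^[j] by apply/smooth_continuous/smooth_derive1n.
have [M HM] := choice bp.
have bq j : exists N, forall y, -1 < y < 1 -> `|q^[j] y| <= N.
  have cF : continuous (fun z : R * R => q^[j] z.1).
    move=> z; apply: (@continuous_comp _ _ _ fst q^[j]); first exact: cvg_fst.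
    exact: cq.
  have [N HN] := box_bounded (-1) 1 0 0 cF.
  exists N => y /andP[y1 y2]; apply: (HN (y, 0)); apply/boxP.
  by rewrite /= lexx !ltW.
have [N HN] := choice bq.
pose C : R := \sum_(i < m.+1) \sum_(j < m.+1 | (i + j <= m)%N)
  ((M i * N j) ^+ 2 * 2).
have term a (i j : nat) :
    (\int[mu2 R]_(z in strip_rect a) ((wD (strip_rect a) (i, j) f z) ^+ 2)%:E <=
     ((M i * N j) ^+ 2 * 2)%:E)%E.
  have oO := @open_strip_rect a; have mO := open_plane_measurable oO.
  have ct : continuous (tensor p^[i] q^[j]).
    by apply: continuous_tensor => //; apply/smooth_continuous/smooth_derive1n.
  have fpq' : f = tensor p q %[ae mu2 R in strip_rect a].
    by apply: ae_imp fpq => z H /strip_rect_sub /H.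
  have mf' : measurable_fun (strip_rect a : set plane) f.
    exact: measurable_funS (open_plane_measurable open_strip)
      (@strip_rect_sub a) mf.
  have wf := weak_derivative_ae oO mf' fpq'
    (tensor_weak_derivative (strip_rect a) (i, j) sp sq).
  have wE := weak_derivative_unique oO (wD_weak_derivative wf) wf (aeW _ (fun z _ => erefl)).
  have [_ [mw _] _] := wD_weak_derivative wf.
  have mt : measurable_fun (strip_rect a : set plane) (tensor p^[i] q^[j]).
    exact: measurable_funS (continuous_plane_measurable ct).
  rewrite (ae_eq_integral (fun z : plane => (tensor p^[i] q^[j] z ^+ 2)%:E))//; last first.
  - by apply: ae_imp wE => z H /H ->.
  - by apply/measurable_EFinP/measurable_funX.
  - by apply/measurable_EFinP/measurable_funX.
  rewrite EFinM -(mu2_strip_rect a) -integral_cst//.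
  apply: ge0_le_integral => //.
  - by move=> z _; rewrite lee_fin sqr_ge0.
  - by apply/measurable_EFinP/measurable_funX.
  - move=> z [_ z2]; rewrite lee_fin -[leLHS]real_normK ?num_real//.
    rewrite lerXn2r ?nnegrE//.
      by rewrite mulr_ge0//; [apply: le_trans (HM i 0)|apply: le_trans (HN j _ z2)].
    by rewrite /tensor normrM ler_pM// HN.
have bound a : (Hnorm m (strip_rect a) f <= C%:E `^ 2^-1)%E.
  rewrite /Hnorm; apply: gt0_ler_poweR.
  - by rewrite invr_ge0.
  - rewrite in_itv/= leey andbT; apply: sume_ge0 => i _; apply: sume_ge0 => j _.
    by apply: integral_ge0 => z _; rewrite lee_fin sqr_ge0.
  - rewrite in_itv/= leey andbT lee_fin; apply: sumr_ge0 => i _.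
    by apply: sumr_ge0 => j _; rewrite mulr_ge0// sqr_ge0.
  - rewrite /C -sumEFin; apply: lee_sum => i _; rewrite -sumEFin.
    by apply: lee_sum => j _; exact: term.
apply: (@le_lt_trans _ _ (C%:E `^ 2^-1)%E).
  by apply: ub_ereal_sup => _ [a _ <-]; exact: bound.
by rewrite poweR_EFin ltry.
Qed.

End smooth_members.

(** * The Poiseuille flow is a solution *)

Section poiseuille_existence.
Context {R : realType}.
Notation mu := (@lebesgue_measure R).
Notation plane := (measurableTypeR R * measurableTypeR R)%type.
Implicit Types (f g h F phi : R * R -> R) (p q : R -> R) (a b c d x y : R).
Implicit Types (Om : set (R * R)) (Phi : R) (u : R * R -> R * R).

Lemma wD_ae_tensor Om al f p q : open Om -> measurable_fun (Om : set plane) f ->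
  smooth p -> smooth q -> f = tensor p q %[ae mu2 R in Om] ->
  weak_derivative Om al f (wD Om al f) /\
  wD Om al f = tensor p^[al.1] q^[al.2] %[ae mu2 R in Om].
Proof.
move=> oO mf sp sq fpq.
have wf := weak_derivative_ae oO mf fpq (tensor_weak_derivative Om al sp sq).
split; first exact: wD_weak_derivative wf.
by apply: (weak_derivative_unique oO (wD_weak_derivative wf) wf (aeW _ _)).
Qed.

Definition parabola (c y : R) : R := c * (1 - y ^+ 2).

Lemma is_derive_parabola c y : is_derive y 1 (parabola c) (-2 * c * y).
Proof.
have -> : -2 * c * y = (c *: - (2 * y ^+ 1)) :> R.
  by rewrite /GRing.scale/= expr1; ring.
have dX : is_derive y 1 (fun y : R => y ^+ 2) (2 * y ^+ 1).
  by apply: DeriveDef; [exact: exprn_derivable|rewrite -derive1E exp_derive1].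
have d1 : is_derive y 1 (fun y : R => 1 - y ^+ 2) (- (2 * y ^+ 1)).
  by rewrite -[X in is_derive _ _ _ X]sub0r; apply: is_deriveB.
exact: is_deriveZ.
Qed.

Lemma is_derive_scale (c y : R) : is_derive y 1 (fun y => c * y) c.
Proof.
rewrite -[X in is_derive _ _ _ X]mulr1.
exact: (@is_deriveZ _ _ _ _ c _ _ _ (is_derive_id y 1)).
Qed.

Lemma derive1_parabola c : (parabola c)^D = fun y => -2 * c * y.
Proof. by apply: is_derive_derive1 => y; exact: is_derive_parabola. Qed.

Lemma derive1_scale c : (fun y : R => c * y)^D = cst c.
Proof. by apply: is_derive_derive1 => y; exact: is_derive_scale. Qed.

Lemma derive1n2_parabola c : (parabola c)^[2] = cst (-2 * c).
Proof. by rewrite derive1nS derive1n1 derive1_parabola derive1_scale. Qed.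

Lemma derive1_cst_fun (c : R) : (cst c : R -> R)^D = cst 0.
Proof. by apply: is_derive_derive1 => y; exact: is_derive_cst. Qed.

Lemma derive1n_cst (c : R) n : (cst c : R -> R)^[n] = cst (if n is 0%N then c else 0).
Proof.
elim: n => [//|n IH]; rewrite derive1nS IH derive1_cst_fun.
by case: n {IH}.
Qed.

Lemma smooth_scale_id (c : R) : smooth (fun y : R => c * y).
Proof.
apply: (@smooth_antiderivative _ _ (cst c)); last exact: smooth_cst.
by move=> y; exact: is_derive_scale.
Qed.

Lemma smooth_parabola c : smooth (parabola c).
Proof.
apply: (@smooth_antiderivative _ _ (fun y => -2 * c * y)).
  by move=> y; exact: is_derive_parabola.
exact: smooth_scale_id.
Qed.

Lemma bounded_derive1n_cst (c : R) : forall i, exists M, forall x,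
  `|(cst c : R -> R)^[i] x| <= M.
Proof.
by move=> i; exists `|if i is 0%N then c else 0| => x; rewrite derive1n_cst.
Qed.

Lemma integral_parabola c :
  \int[mu]_(y in `[-1, 1]) parabola c y = 4 / 3 * c.
Proof.
have le11 : -1 <= 1 :> R by lra.
have dF y : is_derive y 1 (fun y => c * y + - (c / 3) * y ^+ 3) (parabola c y).
  have -> : parabola c y = c + (- (c / 3)) *: (3 * y ^+ 2).
    by rewrite /parabola /GRing.scale/=; field.
  have dX : is_derive y 1 (fun y : R => y ^+ 3) (3 * y ^+ 2).
    by apply: DeriveDef; [exact: exprn_derivable|rewrite -derive1E exp_derive1].
  have d1 := is_derive_scale c y.
  by apply: is_deriveD; exact: is_deriveZ.
rewrite (FTC2 le11 dF); first by field.
exact: smooth_continuous (smooth_parabola c).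
Qed.

Lemma poiseuille_u1 Phi :
  fst \o poiseuille_u Phi = tensor (cst 1) (parabola (3 / 4 * Phi)).
Proof.
by apply/funext => z; rewrite /poiseuille_u /tensor /parabola/= /GRing.scale/= mul1r mulr1.
Qed.

Lemma poiseuille_u2 Phi : snd \o poiseuille_u Phi = tensor (cst 1) (cst 0).
Proof.
by apply/funext => z; rewrite /poiseuille_u /tensor/= /GRing.scale/= mul1r mulr0.
Qed.

Lemma poiseuille_pE Phi :
  poiseuille_p Phi = tensor (fun x => - (3 / 2 * Phi) * x) (cst 1).
Proof. by apply/funext => z; rewrite /tensor/= mulr1 mulNr. Qed.

Lemma tensor_measurable Om p q : smooth p -> smooth q ->
  measurable_fun (Om : set plane) (tensor p q).
Proof.
move=> sp sq; apply: measurable_funS (continuous_plane_measurable _) => //.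
by apply: continuous_tensor; exact: smooth_continuous.
Qed.

Lemma ae_in_and (D P1 P2 : R * R -> Prop) :
  (\forall z \ae mu2 R, D z -> P1 z) -> (\forall z \ae mu2 R, D z -> P2 z) ->
  \forall z \ae mu2 R, D z -> P1 z /\ P2 z.
Proof. by apply: ae_imp2 => z H1 H2 Dz; split; [exact: H1|exact: H2]. Qed.

Lemma ae_refl (D : set (R * R)) (T : Type) (f : R * R -> T) :
  f = f %[ae mu2 R in D].
Proof. exact: aeW. Qed.

Lemma poiseuille_wD Phi u al : 
  measurable_fun (@strip R : set plane) (fst \o u) ->
  measurable_fun (@strip R : set plane) (snd \o u) ->
  u = poiseuille_u Phi %[ae mu2 R in @strip R] ->
  wD (@strip R) al (fst \o u) =
    tensor (cst 1 : R -> R)^[al.1] (parabola (3 / 4 * Phi))^[al.2]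
    %[ae mu2 R in @strip R] /\
  wD (@strip R) al (snd \o u) = (fun _ => 0) %[ae mu2 R in @strip R].
Proof.
move=> m1 m2 uE; split.
  apply: (wD_ae_tensor al open_strip m1 _ _ _).2.
  - exact: smooth_cst.
  - exact: smooth_parabola.
  - by rewrite -(poiseuille_u1 Phi); apply: ae_imp uE => z /= H /H ->.
have : wD (@strip R) al (snd \o u) = tensor (cst 1 : R -> R)^[al.1] (cst 0 : R -> R)^[al.2]
    %[ae mu2 R in @strip R].
  apply: (wD_ae_tensor al open_strip m2 _ _ _).2.
  - exact: smooth_cst.
  - exact: smooth_cst.
  - by rewrite -(poiseuille_u2 Phi); apply: ae_imp uE => z /= H /H ->.
by apply: ae_imp => z H /H ->; rewrite /tensor [X in _ * X z.2]derive1n_cst;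
  case: al.2 => [|?]; rewrite /= mulr0.
Qed.

(** Stated for any u equal to the Poiseuille flow almost everywhere: it serves
    to verify the equation for the flow itself, and to read off the pressure
    gradient of an arbitrary solution once its velocity is known. *)
Lemma poiseuille_balance Phi u : 
  measurable_fun (@strip R : set plane) (fst \o u) ->
  measurable_fun (@strip R : set plane) (snd \o u) ->
  u = poiseuille_u Phi %[ae mu2 R in @strip R] ->
  (fun z => - vlaplacian u z + advection u z) = (fun _ => (3 / 2 * Phi, 0))
    %[ae mu2 R in @strip R] /\
  wdiv u = (fun _ => 0) %[ae mu2 R in @strip R].
Proof.
move=> m1 m2 uE.
have D al := (poiseuille_wD al m1 m2 uE).1.
have Z al := (poiseuille_wD al m1 m2 uE).2.
have Dx i j : wD (@strip R) (i.+1, j) (fst \o u) = (fun _ => 0)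
    %[ae mu2 R in @strip R].
  apply: ae_imp (D (i.+1, j)) => z H zS.
  by rewrite (H zS) /tensor derive1n_cst mul0r.
have Dyy : wD (@strip R) (0%N, 2%N) (fst \o u) = (fun _ => - (3 / 2 * Phi))
    %[ae mu2 R in @strip R].
  apply: ae_imp (D (0%N, 2%N)) => z H zS.
  by rewrite (H zS) /tensor derive1n_cst mul1r derive1n2_parabola /cst; field.
split; last first.
  apply: ae_imp2 (Dx 0%N 0%N) (Z (0%N, 1%N)) => z H1 H2 zS.
  by rewrite /wdiv /wdx /wdy (H1 zS) (H2 zS) addr0.
have H1 : wlaplacian (fst \o u) = (fun _ => - (3 / 2 * Phi))
    %[ae mu2 R in @strip R].
  apply: ae_imp2 (Dx 1%N 0%N) Dyy => z h1 h2 zS.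
  by rewrite /wlaplacian (h1 zS) (h2 zS) add0r.
have H2 : wlaplacian (snd \o u) = (fun _ => 0) %[ae mu2 R in @strip R].
  apply: ae_imp2 (Z (2%N, 0%N)) (Z (0%N, 2%N)) => z h1 h2 zS.
  by rewrite /wlaplacian (h1 zS) (h2 zS) addr0.
have H3 : advection u = (fun _ => (0, 0)) %[ae mu2 R in @strip R].
  have A : (fun z => (wdx (fst \o u) z, (u z).2)) = (fun _ => (0, 0))
      %[ae mu2 R in @strip R].
    apply: ae_imp2 (Dx 0%N 0%N) uE => z h1 h2 zS.
    by rewrite (h2 zS) /wdx (h1 zS) /poiseuille_u/= /GRing.scale/= mulr0.
  have B := ae_in_and (Z (1%N, 0%N)) (Z (0%N, 1%N)).
  apply: ae_imp2 A B => z A B zS; have [w1 v2] := A zS; have [w2 w3] := B zS.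
  by rewrite /advection /wdx /wdy /= in w1 v2 w2 w3 *; rewrite w1 v2 w2 w3 !mulr0 !mul0r addr0.
have H4 := ae_in_and H1 H2.
apply: ae_imp2 H3 H4 => z h3 h4 zS; have [h1 h2] := h4 zS.
rewrite (h3 zS) /vlaplacian h1 h2.
by apply: injective_projections; rewrite /= ?opprK ?oppr0 addr0.
Qed.

Theorem poiseuille_solution Phi :
  ns_solution Phi (poiseuille_u Phi) (poiseuille_p Phi).
Proof.
have c1 : smooth (cst 1 : R -> R) by exact: smooth_cst.
have c0 : smooth (cst 0 : R -> R) by exact: smooth_cst.
have sp := smooth_parabola (3 / 4 * Phi).
have sl := smooth_scale_id (- (3 / 2 * Phi)).
have m1 : measurable_fun (@strip R : set plane) (fst \o poiseuille_u Phi).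
  by rewrite poiseuille_u1; exact: tensor_measurable.
have m2 : measurable_fun (@strip R : set plane) (snd \o poiseuille_u Phi).
  by rewrite poiseuille_u2; exact: tensor_measurable.
have mp : measurable_fun (@strip R : set plane) (poiseuille_p Phi).
  by rewrite poiseuille_pE; exact: tensor_measurable.
have pE : poiseuille_p Phi = tensor (fun x => - (3 / 2 * Phi) * x) (cst 1)
    %[ae mu2 R in @strip R] by rewrite poiseuille_pE; exact: ae_refl.
have [wx wxE] := wD_ae_tensor (1%N, 0%N) open_strip mp sl c1 pE.
have [wy wyE] := wD_ae_tensor (0%N, 1%N) open_strip mp sl c1 pE.
have [[_ [mx _] _] [_ [my _] _]] := (wx, wy).
have px : wdx (poiseuille_p Phi) = tensor (cst (- (3 / 2 * Phi))) (cst 1)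
    %[ae mu2 R in @strip R].
  by apply: ae_imp wxE => z H /H; rewrite /wdx => ->; rewrite /= derive1_scale.
have py : wdy (poiseuille_p Phi) = tensor (cst 0) (cst 1) %[ae mu2 R in @strip R].
  apply: ae_imp wyE => z H /H; rewrite /wdy => ->.
  by rewrite /tensor/= derive1_cst_fun mulr0 mul0r.
split.
- split.
    apply: (Xspace_ae_tensor _ m1 c1 sp (bounded_derive1n_cst 1)).
    by rewrite poiseuille_u1; exact: ae_refl.
  apply: (Xspace_ae_tensor _ m2 c1 c0 (bounded_derive1n_cst 1)).
  by rewrite poiseuille_u2; exact: ae_refl.
- exact: (Hloc_ae_tensor 1 open_strip mp sl c1 pE).
- split.
    exact: (Xspace_ae_tensor _ mx (smooth_cst _) c1 (bounded_derive1n_cst _) px).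
  exact: (Xspace_ae_tensor _ my c0 c1 (bounded_derive1n_cst _) py).
- by split; apply: aeW => z _; rewrite /poiseuille_u//= /GRing.scale/= mulr0 oppr0.
- have [B D] := poiseuille_balance m1 m2 (ae_refl _ _).
  split => //.
    have P := ae_in_and px py.
    apply: ae_imp2 B P => z b hp zS; have [hx hy] := hp zS.
    rewrite (b zS) /wgrad hx hy /tensor/= mulr1 mul0r.
    by apply: injective_projections; rewrite /= ?subrr ?addr0.
  exists (poiseuille_u Phi); split.
  + split; last exact: ae_refl.
    apply: continuous_subspaceT => z.
    have -> : poiseuille_u Phi = (fun z => (tensor (cst 1)
        (parabola (3 / 4 * Phi)) z, tensor (cst 1) (cst 0) z)).
      rewrite -(poiseuille_u1 Phi) -(poiseuille_u2 Phi); apply/funext => w /=.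
      exact: surjective_pairing.
    by apply: continuous_pairing; apply: continuous_tensor;
      exact: smooth_continuous.
  + by move=> x; rewrite /poiseuille_u/= sqrrN !expr1n subrr mulr0 scale0r.
  + rewrite -[RHS](_ : 4 / 3 * (3 / 4 * Phi) = Phi); last by field.
    rewrite -integral_parabola; apply: eq_segment_integral => y _.
    by rewrite /poiseuille_u /parabola/= /GRing.scale/= mulr1.
Qed.

End poiseuille_existence.

(** * Reflection in the vertical axis *)

Definition reflect_x (R : realType) (z : measurableTypeR R * measurableTypeR R) :
  measurableTypeR R * measurableTypeR R := (- z.1, z.2).

Lemma measurable_reflect_x (R : realType) :
  measurable_fun [set: measurableTypeR R * measurableTypeR R] (@reflect_x R).
Proof.
apply: measurable_fun_pair; last exact: measurable_snd.
exact: (measurableT_comp (@oppr_measurable R setT) measurable_fst).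
Qed.

(* Makes the pushforward of mu2 R by reflect_x a measure. *)
HB.instance Definition _ (R : realType) := @isMeasurableFun.Build _ _ _ _
  (@reflect_x R) (@measurable_reflect_x R).

Section reflection.
Context {R : realType}.
Notation mu := (@lebesgue_measure R).
Notation plane := (measurableTypeR R * measurableTypeR R)%type.
Implicit Types (f g h F phi : R * R -> R) (p q : R -> R) (a b c d x y s : R).
Implicit Types (Om : set (R * R)) (u : R * R -> R * R).
Local Notation refl := (@reflect_x R).

Lemma reflect_xK : involutive refl.
Proof. by move=> z; rewrite /reflect_x/= opprK -surjective_pairing. Qed.

Lemma continuous_reflect_x : continuous (refl : R * R -> R * R).
Proof.
apply: continuous_pairing => z; last exact: cvg_snd.
by apply: cvgN; exact: cvg_fst.
Qed.

Lemma mu2_reflect_x (A : set plane) : measurable A ->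
  pushforward (mu2 R) refl A = mu2 R A.
Proof.
move=> mA; apply/esym/product_measure_unique => // B C mB mC.
have mNB : measurable (-%R @^-1` B : set (measurableTypeR R)).
  by rewrite -[X in measurable X]setTI; exact: oppr_measurable.
have H : mu2 R ((-%R @^-1` B) `*` C) = (mu (-%R @^-1` B) * mu C)%E.
  exact: product_measure1E.
by apply: etrans H _; congr (_ * _)%E; exact: lebesgue_measureN.
Qed.

Lemma reflect_x_strip : refl @^-1` (@strip R) = @strip R.
Proof. by apply/seteqP; split=> z. Qed.

Lemma ae_reflect_x (P : R * R -> Prop) : (\forall z \ae mu2 R, P z) ->
  \forall z \ae mu2 R, P (refl z).
Proof.
move=> [A [mA A0 PA]]; exists (refl @^-1` A); split.
- by rewrite -[X in measurable X]setTI; exact: measurable_reflect_x.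
- by rewrite -A0 -(mu2_reflect_x mA).
- by move=> z nP; exact: PA.
Qed.

Lemma integral_reflect_x F : measurable_fun (@strip R : set plane) F ->
  \int[mu2 R]_(z in @strip R) F (refl z) = \int[mu2 R]_(z in @strip R) F z.
Proof.
move=> mF; have mS := open_plane_measurable (@open_strip R).
have ge0 (G : plane -> \bar R) : measurable_fun (@strip R : set plane) G ->
    (forall z, 0 <= G z)%E ->
    (\int[mu2 R]_(z in @strip R) G (refl z) = \int[mu2 R]_(z in @strip R) G z)%E.
  move=> mG G0.
  have := @ge0_integral_pushforward _ _ _ _ _ _ (@measurable_reflect_x R) (mu2 R)
    (@strip R) G mS mG (fun z _ => G0 z).
  rewrite reflect_x_strip => <-; apply: eq_measure_integral => A mA _.
  exact: mu2_reflect_x.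
have mE : measurable_fun (@strip R : set plane) (EFin \o F) by exact/measurable_EFinP.
rewrite /Rintegral -[fun z : plane => (F (refl z))%:E]/((EFin \o F) \o refl).
congr fine; rewrite integralE [RHS]integralE; congr (_ - _)%E.
  apply: etrans (ge0 ((EFin \o F)^\+)%E (measurable_funepos mE) _).
    by apply: eq_integral => z _; rewrite funepos_comp.
  by move=> z; exact: funepos_ge0.
apply: etrans (ge0 ((EFin \o F)^\-)%E (measurable_funeneg mE) _).
  by apply: eq_integral => z _; rewrite funeneg_comp.
by move=> z; exact: funeneg_ge0.
Qed.

Lemma measurable_comp_reflect f : measurable_fun (@strip R : set plane) f ->
  measurable_fun (@strip R : set plane) (f \o refl).
Proof.
move=> mf; apply: (measurable_comp _ _ mf).
- exact: open_plane_measurable (@open_strip R).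
- by move=> _ [z zS <-].
- exact: measurable_funS (@measurable_reflect_x R).
Qed.

Lemma Lploc_reflect n f : Lploc n (@strip R) f -> Lploc n (@strip R) (f \o refl).
Proof.
move=> [mf If]; split; first exact: measurable_comp_reflect.
move=> K cK KO.
have cK' : compact (refl @` K : set (R * R)).
  by apply: continuous_compact cK; apply: continuous_subspaceT;
    exact: continuous_reflect_x.
have KO' : refl @` K `<=` @strip R by move=> _ [z /KO zK <-].
have mK' := compact_plane_measurable cK'.
have EK : refl @^-1` (refl @` K) = K.
  apply/seteqP; split=> z; last by exists z.
  by move=> [w Kw] /(can_inj reflect_xK) <-.
apply: le_lt_trans (If _ cK' KO').
have mG : measurable_fun (refl @` K : set plane) (fun z => (`|f z| ^+ n)%:E).
  apply/measurable_EFinP; apply: measurable_funX; apply: measurableT_comp => //.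
  exact: measurable_funS (open_plane_measurable (@open_strip R)) KO' mf.
have := @ge0_integral_pushforward _ _ _ _ _ _ (@measurable_reflect_x R) (mu2 R)
    (refl @` K) (fun z => (`|f z| ^+ n)%:E) mK' mG.
rewrite EK => <-; last by move=> z _; rewrite lee_fin exprn_ge0.
rewrite le_eqVlt; apply/orP; left; apply/eqP.
by apply: eq_measure_integral => A mA _; exact: mu2_reflect_x.
Qed.

Definition flip p x := p (-1 * x + 0).

Lemma flip_derive1n p n : smooth p -> (flip p)^[n] = fun x => (-1) ^+ n * flip p^[n] x.
Proof. by move=> sp; rewrite /flip derive1nZ_affine. Qed.

Lemma tensor_flip p q z : tensor (flip p) q z = tensor p q (refl z).
Proof. by rewrite /tensor /flip/= mulN1r addr0. Qed.

Lemma bump_on_flipped a b p : bump_on a b p -> bump_on (- b) (- a) (flip p).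
Proof. exact: bump_on_flip. Qed.

Lemma box_strip_flip a b c d : box a b c d `<=` @strip R ->
  box (- b) (- a) c d `<=` @strip R.
Proof.
move=> BS z /boxP[/andP[z1 z2] zcd].
have : @strip R (refl z) by apply: BS; apply/boxP; rewrite /= lerNr lerNl z1 z2.
by [].
Qed.

Lemma integral_tensor_flip f p q : measurable_fun (@strip R : set plane) f ->
  smooth p -> smooth q ->
  \int[mu2 R]_(z in @strip R) (f z * tensor (flip p) q z) =
  \int[mu2 R]_(z in @strip R) (f (refl z) * tensor p q z).
Proof.
move=> mf sp sq.
rewrite -(@integral_reflect_x (fun z => f z * tensor (flip p) q z)).
  by apply: eq_Rintegral => z _; rewrite tensor_flip reflect_xK.
apply: measurable_funM => //; apply: tensor_measurable => //.
exact: smooth_affine.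
Qed.

(** Test with p(-x) q(y): its derivative of order i in x carries the sign
    (-1)^i, so each derivative in x reverses the parity. *)
Lemma weak_derivative_parity al s f g : weak_derivative (@strip R) al f g ->
  f \o refl = (fun z => s * f z) %[ae mu2 R in @strip R] ->
  g \o refl = (fun z => s * (-1) ^+ al.1 * g z) %[ae mu2 R in @strip R].
Proof.
move=> wg fs; have [Lf Lg _] := wg; have oS := @open_strip R.
have mS := open_plane_measurable oS.
have LZ (k : R) : Lploc 1 (@strip R) (fun z => k * g z).
  have [mg Ig] := Lg; split; first exact: measurable_funM.
  move=> K cK KO.
  have mK := compact_plane_measurable cK.
  rewrite (_ : (fun z => _) = (fun z => `|k|%:E * (`|g z| ^+ 1)%:E)%E); last first.
    by apply/funext => z; rewrite -EFinM !expr1 normrM.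
  rewrite ge0_integralZl//; first by rewrite lte_mul_pinfty// Ig.
  apply/measurable_EFinP; apply: measurable_funX; apply: measurableT_comp => //.
  exact: measurable_funS mS KO mg.
have LR : Lploc 1 (@strip R) (g \o refl) by exact: Lploc_reflect.
apply: (ae_eq_from_tensors oS LR (LZ (s * (-1) ^+ al.1))).
move=> a b c d p q BS bp bq.
have [sp _] := bp; have [sq _] := bq.
have mt p' q' : smooth p' -> smooth q' ->
    measurable_fun (@strip R : set plane) (tensor p' q').
  by move=> *; exact: tensor_measurable.
rewrite -(integral_tensor_flip Lg.1 sp sq).
have := weak_derivative_tensor wg (box_strip_flip BS) (bump_on_flipped bp) bq.
have W' := weak_derivative_tensor wg BS bp bq.
set e := (-1) ^+ (al.1 + al.2) in W' *.
have spi : smooth p^[al.1] by exact: smooth_derive1n.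
have sqj : smooth q^[al.2] by exact: smooth_derive1n.
have iB h p' q' : Lploc 1 (@strip R) h -> bump_on a b p' -> bump_on c d q' ->
    (mu2 R).-integrable (box a b c d) (EFin \o (fun z => h z * tensor p' q' z)).
  move=> Lh bp' bq'; apply: integrable_mul_continuous.
    by apply: continuous_tensor; [exact: bump_on_continuous bp'|
      exact: bump_on_continuous bq'].
  exact: Lploc1_integrable oS Lh BS.
have scal h p' q' k : Lploc 1 (@strip R) h -> bump_on a b p' -> bump_on c d q' ->
    \int[mu2 R]_(z in @strip R) (k * h z * tensor p' q' z) =
    k * \int[mu2 R]_(z in @strip R) (h z * tensor p' q' z).
  move=> Lh bp' bq'.
  have out z : ~ box a b c d z -> tensor p' q' z = 0 by exact: tensor_out.
  rewrite !(integral_box_support _ BS out).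
  under eq_Rintegral do rewrite -mulrA.
  by rewrite RintegralZl//; [exact: box_measurable|exact: iB].
have -> : \int[mu2 R]_(z in @strip R) (f z * tensor (flip p)^[al.1] q^[al.2] z) =
    (-1) ^+ al.1 * (s * \int[mu2 R]_(z in @strip R) (f z * tensor p^[al.1] q^[al.2] z)).
  have bpi := bump_on_derive1n al.1 bp; have bqj := bump_on_derive1n al.2 bq.
  rewrite -(scal f _ _ s Lf bpi bqj).
  rewrite -(@ae_eq_Rintegral_mul _ (@strip R) (f \o refl) (fun z => s * f z)
    (tensor p^[al.1] q^[al.2]) mS (measurable_comp_reflect Lf.1) _ _ fs); last 2 first.
  - by apply: measurable_funM => //; exact: Lf.1.
  - exact: mt.
  rewrite -(integral_tensor_flip Lf.1 spi sqj).
  have bfi := bump_on_flipped bpi.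
  have BSf := box_strip_flip BS.
  have outf z : ~ box (- b) (- a) c d z -> tensor (flip p^[al.1]) q^[al.2] z = 0.
    exact: tensor_out.
  have ifl : (mu2 R).-integrable (box (- b) (- a) c d)
      (EFin \o (fun z => f z * tensor (flip p^[al.1]) q^[al.2] z)).
    apply: integrable_mul_continuous.
      by apply: continuous_tensor; [exact: bump_on_continuous bfi|
        exact: bump_on_continuous bqj].
    exact: Lploc1_integrable oS Lf BSf.
  rewrite [in RHS](integral_box_support _ BSf outf).
  rewrite -[RHS]RintegralZl//; last exact: box_measurable.
  rewrite (integral_box_support _ BSf); last first.
    move=> z nz; rewrite flip_derive1n// /tensor.
    by rewrite -mulrA -/(tensor _ _ _) outf// mulr0.
  by apply: eq_Rintegral => z _; rewrite flip_derive1n// /tensor; ring.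
rewrite W' => E.
rewrite (scal g _ _ _ Lg bp bq).
have e0 : e != 0 by rewrite signr_eq0.
apply: (mulfI e0); rewrite -E.
by move: (Rintegral _ _ _) => I; ring.
Qed.

End reflection.

(** * Parity splits the equation into linear and quadratic parts *)

Section stokes_from_symmetry.
Context {R : realType}.
Notation mu := (@lebesgue_measure R).
Notation plane := (measurableTypeR R * measurableTypeR R)%type.
Implicit Types (f g h F phi : R * R -> R) (p q : R -> R) (a b c d x y s : R).
Implicit Types (Om : set (R * R)) (u : R * R -> R * R).

Lemma bump_on_shrink a b p : bump_on a b p ->
  exists c d, [/\ a < c, d < b & bump_on c d p].
Proof.
move=> [sp [c [d [ac db pc pd]]]].
exists ((a + c) / 2), ((d + b) / 2); split; try lra.
by split=> //; exists c, d; split=> //; lra.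
Qed.

Lemma box_in_strip a b c d : -1 < c -> d < 1 -> box a b c d `<=` @strip R.
Proof.
move=> c1 d1 z /boxP[_ /andP[zc zd]]; apply/andP; split.
  exact: lt_le_trans zc.
exact: le_lt_trans d1.
Qed.

Definition test_pairing h p q := \int[mu2 R]_(z in @strip R) (h z * tensor p q z).

Lemma test_pairing_integrable h a b c d p q : Lploc 1 (@strip R) h ->
  box a b c d `<=` @strip R -> continuous p -> continuous q ->
  (mu2 R).-integrable (box a b c d) (EFin \o (fun z => h z * tensor p q z)).
Proof.
move=> Lh BS cp cq; apply: integrable_mul_continuous; first exact: continuous_tensor.
exact: Lploc1_integrable open_strip Lh BS.
Qed.

Lemma test_pairing_lin h1 h2 k a b p q : Lploc 1 (@strip R) h1 ->
  Lploc 1 (@strip R) h2 -> bump_on a b p -> bump_on (-1) 1 q ->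
  test_pairing (fun z => h1 z + k * h2 z) p q =
  test_pairing h1 p q + k * test_pairing h2 p q.
Proof.
move=> L1 L2 bp bq; have [c [d [c1 d1 bq']]] := bump_on_shrink bq.
have BS := @box_in_strip a b c d c1 d1.
have out z : ~ box a b c d z -> tensor p q z = 0 by exact: tensor_out.
have cp := bump_on_continuous bp; have cq := bump_on_continuous bq.
rewrite /test_pairing !(integral_box_support _ BS out).
have i1 := test_pairing_integrable L1 BS cp cq.
have i2 := test_pairing_integrable L2 BS cp cq.
have mB := @box_measurable R a b c d.
rewrite -(RintegralZl k mB i2) -RintegralD//; last first.
  rewrite (_ : _ \o _ = fun z => (k%:E * ((h2 z * tensor p q z)%R)%:E)%E).
    exact: integrableZl.
  by apply/funext => z /=; rewrite EFinM.
by apply: eq_Rintegral => z _; ring.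
Qed.

Lemma test_pairing_scale h k a b p q : Lploc 1 (@strip R) h ->
  bump_on a b p -> bump_on (-1) 1 q ->
  test_pairing h (fun x => k * p x) q = k * test_pairing h p q.
Proof.
move=> Lh bp bq; have [c [d [c1 d1 bq']]] := bump_on_shrink bq.
have BS := @box_in_strip a b c d c1 d1.
have out z : ~ box a b c d z -> tensor p q z = 0 by exact: tensor_out.
have cp := bump_on_continuous bp; have cq := bump_on_continuous bq.
have i1 := test_pairing_integrable Lh BS cp cq.
have mB := @box_measurable R a b c d.
rewrite /test_pairing (integral_box_support _ BS out) -(RintegralZl k mB i1).
rewrite (integral_box_support _ BS); last first.
  by move=> z nz; rewrite /tensor -mulrA -/(tensor p q z) out// mulr0.
by apply: eq_Rintegral => z _; rewrite /tensor; ring.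
Qed.

Lemma test_pairing_ae h1 h2 p q : measurable_fun (@strip R : set plane) h1 ->
  measurable_fun (@strip R : set plane) h2 -> smooth p -> smooth q ->
  h1 = h2 %[ae mu2 R in @strip R] -> test_pairing h1 p q = test_pairing h2 p q.
Proof.
move=> m1 m2 sp sq E; apply: ae_eq_Rintegral_mul => //.
  exact: open_plane_measurable open_strip.
exact: tensor_measurable.
Qed.

Lemma test_pairing_weak_derivative al h g a b p q :
  weak_derivative (@strip R) al h g -> bump_on a b p -> bump_on (-1) 1 q ->
  test_pairing g p q =
  (-1) ^+ (al.1 + al.2) * test_pairing h p^[al.1] q^[al.2].
Proof.
move=> wg bp bq; have [c [d [c1 d1 bq']]] := bump_on_shrink bq.
have BS := @box_in_strip a b c d c1 d1.
rewrite /test_pairing (weak_derivative_tensor wg BS bp bq').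
by rewrite mulrA -expr2 sqrr_sign mul1r.
Qed.

(** By the change of variables x -> -x the flipped bump moves the reflection
    onto h. *)
Lemma test_pairing_parity h s a b p q : Lploc 1 (@strip R) h ->
  bump_on a b p -> bump_on (-1) 1 q ->
  h \o @reflect_x R = (fun z => s * h z) %[ae mu2 R in @strip R] ->
  test_pairing h (flip p) q = s * test_pairing h p q.
Proof.
move=> Lh bp bq hs; have [sp _] := bp; have [sq _] := bq.
rewrite /test_pairing (integral_tensor_flip Lh.1 sp sq).
have E := @test_pairing_ae (h \o @reflect_x R) (fun z => s * h z) p q
  (measurable_comp_reflect Lh.1) _ sp sq hs.
apply: etrans (E _) _.
  by apply: measurable_funM => //; exact: Lh.1.
have := test_pairing_lin (s - 1) Lh Lh bp bq.
rewrite -/(test_pairing _ _ _).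
rewrite (_ : (fun z => h z + (s - 1) * h z) = (fun z => s * h z)); last first.
  by apply/funext => z; ring.
by move=> ->; ring.
Qed.

(** A1 and A2 are the two components of the advection term, as given by the
    momentum equation. The curl of that equation does not contain the pressure
    P, so curl lap = curl A when tested against p(x) q(y). Testing also
    against p(-x) q(y), the parities turn this into curl lap = - curl A, so
    both curls vanish. *)
Lemma curl_cancel_nonlinear (lap1 lap2 A1 A2 p1 p2 P : R * R -> R) :
  Lploc 1 (@strip R) lap1 -> Lploc 1 (@strip R) lap2 ->
  weak_derivative (@strip R) (1%N, 0%N) P p1 ->
  weak_derivative (@strip R) (0%N, 1%N) P p2 ->
  A1 = (fun z => lap1 z + -1 * p1 z) -> A2 = (fun z => lap2 z + -1 * p2 z) ->
  lap1 \o @reflect_x R = (fun z => 1 * lap1 z) %[ae mu2 R in @strip R] ->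
  lap2 \o @reflect_x R = (fun z => -1 * lap2 z) %[ae mu2 R in @strip R] ->
  A1 \o @reflect_x R = (fun z => -1 * A1 z) %[ae mu2 R in @strip R] ->
  A2 \o @reflect_x R = (fun z => 1 * A2 z) %[ae mu2 R in @strip R] ->
  forall a b p q, bump_on a b p -> bump_on (-1) 1 q ->
  test_pairing lap1 p q^[1] = test_pairing lap2 p^[1] q.
Proof.
move=> L1 L2 w1 w2 A1E A2E e1 e2 e3 e4 a b p q bp bq.
have [_ Lp1 _] := w1; have [_ Lp2 _] := w2.
have oS := @open_strip R.
have LA1 : Lploc 1 (@strip R) A1.
  rewrite A1E (_ : (fun z => _) = (fun z => lap1 z - p1 z)); first exact: LplocB.
  by apply/funext => z; rewrite mulN1r.
have LA2 : Lploc 1 (@strip R) A2.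
  rewrite A2E (_ : (fun z => _) = (fun z => lap2 z - p2 z)); first exact: LplocB.
  by apply/funext => z; rewrite mulN1r.
have curl a' b' p' : bump_on a' b' p' ->
    test_pairing lap1 p' q^[1] - test_pairing A1 p' q^[1] =
    test_pairing lap2 p'^[1] q - test_pairing A2 p'^[1] q.
  move=> bp'.
  have bq1 := bump_on_derive1n 1 bq; have bp1 := bump_on_derive1n 1 bp'.
  rewrite A1E A2E (test_pairing_lin (-1) L1 Lp1 bp' bq1).
  rewrite (test_pairing_lin (-1) L2 Lp2 bp1 bq).
  rewrite (test_pairing_weak_derivative w1 bp' bq1).
  by rewrite (test_pairing_weak_derivative w2 bp1 bq) /= addn0 add0n; ring.
have bf := bump_on_flipped bp.
have bp1 := bump_on_derive1n 1 bp; have bq1 := bump_on_derive1n 1 bq.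
have := curl _ _ _ bf; have := curl _ _ _ bp.
have [sp _] := bp.
have fl h s : Lploc 1 (@strip R) h ->
    h \o @reflect_x R = (fun z => s * h z) %[ae mu2 R in @strip R] ->
    test_pairing h (flip p)^[1] q = - s * test_pairing h p^[1] q.
  move=> Lh hs; rewrite flip_derive1n// expr1.
  rewrite (test_pairing_scale _ Lh (bump_on_flipped bp1) bq).
  by rewrite (test_pairing_parity Lh bp1 bq hs); ring.
rewrite (test_pairing_parity L1 bp bq1 e1) (test_pairing_parity LA1 bp bq1 e3).
rewrite (fl _ _ L2 e2) (fl _ _ LA2 e4).
by move: (test_pairing lap1 _ _) (test_pairing lap2 _ _) (test_pairing A1 _ _)
  (test_pairing A2 _ _) => *; lra.
Qed.

End stokes_from_symmetry.

(** * Uniqueness of the velocity *)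

Section velocity_uniqueness.
Context {R : realType}.
Notation mu := (@lebesgue_measure R).
Notation plane := (measurableTypeR R * measurableTypeR R)%type.
Implicit Types (f g h F phi : R * R -> R) (p q : R -> R) (a b c d x y s : R).
Implicit Types (Om : set (R * R)) (u v : R * R -> R * R) (Phi : R).

(** Composing with clamp extends a function continuous on the closed strip to
    a continuous function on the plane; a field that vanishes on the walls is
    extended by 0. *)
Definition clamp y : R := Num.max (-1) (Num.min 1 y).

Lemma clampE y : -1 <= y <= 1 -> clamp y = y.
Proof.
by move=> /andP[y1 y2]; rewrite /clamp (min_idPr y2) (max_idPr y1).
Qed.

Lemma clamp_in y : -1 <= clamp y <= 1.
Proof.
have H : (-1 : R) <= 1 by lra.
by rewrite /clamp le_max lexx/= ge_max H ge_min lexx.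
Qed.

Lemma clamp_out y : ~~ (-1 < y < 1) -> clamp y = 1 \/ clamp y = -1.
Proof.
have H : (-1 : R) <= 1 by lra.
rewrite negb_and -!leNgt /clamp => /orP[|] y1.
  by right; rewrite (min_idPr (le_trans y1 H)) (max_idPl y1).
by left; rewrite (min_idPl y1) (max_idPr H).
Qed.

Lemma continuous_clamp : continuous clamp.
Proof.
move=> y.
have c1 : {for y, continuous (cst 1 : R -> R^o)} by exact: cvg_cst.
have c2 : {for y, continuous (cst (-1) : R -> R^o)} by exact: cvg_cst.
have ci : {for y, continuous (id : R -> R^o)} by exact: cvg_id.
exact: continuous_max c2 (continuous_min c1 ci).
Qed.

Definition clamped v (z : R * R) : R * R := v (z.1, clamp z.2).

(** Continuity within the closed strip suffices because the map (x, y) -> (x,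
    clamp y) takes its values there. *)
Lemma continuous_clamped v : {within @closed_strip R, continuous v} ->
  continuous (clamped v).
Proof.
move=> /subspace_continuousP cv z.
have cm : continuous (fun z : R * R => (z.1, clamp z.2)).
  apply: continuous_pairing => w; first exact: cvg_fst.
  exact: (cvg_comp _ _ (@cvg_snd _ _ (nbhs w.1) (nbhs w.2) _) (@continuous_clamp w.2)).
have inS w : @closed_strip R (w.1, clamp w.2) by exact: clamp_in.
have mw : (fun w : R * R => (w.1, clamp w.2)) w @[w --> z] -->
    within (@closed_strip R) (nbhs (z.1, clamp z.2)).
  move=> U HU.
  have H : \forall w \near z, @closed_strip R (w.1, clamp w.2) -> U (w.1, clamp w.2).
    exact: cm z _ HU.
  suff : \forall w \near z, U (w.1, clamp w.2) by [].
  by near=> w; apply: (near H w _ (inS w)).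
exact: cvg_comp mw (cv _ (inS z)).
Unshelve. all: by end_near. Qed.

Lemma test_pairing_continuous F a b p q : continuous F -> bump_on a b p ->
  bump_on (-1) 1 q ->
  test_pairing F p q = \int[mu]_(y in `[-1, 1]) (xpairing F a b p y * q y).
Proof.
move=> cF bp bq; have cp := bump_on_continuous bp; have cq := bump_on_continuous bq.
transitivity (\int[mu2 R]_(z in box a b (-1) 1) (F z * tensor p q z)).
  apply: Rintegral_support => z.
    by move=> _ nB; rewrite (tensor_out bp bq nB) mulr0.
  by move=> _ /negP nS; rewrite /tensor (bump_on_out bq nS) mulr0 mulr0.
rewrite box_fubini_sym; last first.
  by move=> z; apply: continuousM; [exact: cF|exact: continuous_tensor].
apply: eq_segment_integral => y _; rewrite mulrC /xpairing.
rewrite -segment_integralZ; last first.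
  by apply: continuousMf => //; exact: continuous_pairR.
by apply: eq_segment_integral => x _; rewrite /tensor/=; ring.
Qed.

Lemma Xspace_weak_derivative m f al : Xspace m f -> (al.1 + al.2 <= m)%N ->
  weak_derivative (@strip R) al f (wD (@strip R) al f).
Proof.
by move=> [[_ H] _] /H[g wg _]; exact: wD_weak_derivative wg.
Qed.

Lemma LplocD f g : Lploc 1 (@strip R) f -> Lploc 1 (@strip R) g ->
  Lploc 1 (@strip R) (fun z => f z + g z).
Proof.
move=> Lf Lg; have oS := @open_strip R.
have L0 : Lploc 1 (@strip R) (fun _ => 0).
  by apply: continuous_Lploc => z; exact: cvg_cst.
rewrite (_ : (fun z => _) = (fun z => f z - (0 - g z))).
  by apply: LplocB => //; exact: LplocB.
by apply/funext => z; rewrite sub0r opprK.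
Qed.

Lemma strip_reflect z : @strip R z -> @strip R (reflect_x z).
Proof. by []. Qed.

Lemma ae_reflect_strip (P : R * R -> Prop) :
  (\forall z \ae mu2 R, @strip R z -> P z) ->
  \forall z \ae mu2 R, @strip R z -> P (reflect_x z).
Proof.
by move=> H; apply: ae_imp (ae_reflect_x H) => z Hz zS; exact: (Hz (strip_reflect zS)).
Qed.

(** Under (X1) the two components of the Laplacian have parities 1 and -1 in
    x, and those of the advection term -1 and 1; curl_cancel_nonlinear then
    applies, and the Laplacian moves onto the test function. *)
Lemma ns_stokes Phi u P : ns_solution Phi u P ->
  forall a b p q, bump_on a b p -> bump_on (-1) 1 q ->
  test_pairing (fst \o u) p^[2] q^[1] + test_pairing (fst \o u) p q^[3] =
  test_pairing (snd \o u) p^[3] q + test_pairing (snd \o u) p^[1] q^[2].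
Proof.
move=> [[X1 X2] [_ HP] _ [S1 S2] [NS _ _]] a b p q bp bq.
set u1 := fst \o u in X1 *; set u2 := snd \o u in X2 *.
pose D f i j := wD (@strip R) (i, j) f.
have w1 i j : (i + j <= 2)%N -> weak_derivative (@strip R) (i, j) u1 (D u1 i j).
  by move=> ij; exact: (@Xspace_weak_derivative 2 u1 (i, j) X1 ij).
have w2 i j : (i + j <= 2)%N -> weak_derivative (@strip R) (i, j) u2 (D u2 i j).
  by move=> ij; exact: (@Xspace_weak_derivative 2 u2 (i, j) X2 ij).
have par1 i j : (i + j <= 2)%N -> D u1 i j \o @reflect_x R =
    (fun z => (-1) ^+ i * D u1 i j z) %[ae mu2 R in @strip R].
  move=> ij; have := @weak_derivative_parity _ (i, j) 1 _ _ (w1 i j ij).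
  rewrite mul1r; apply; apply: ae_imp S1 => z H /H; rewrite /= mul1r; exact.
have par2 i j : (i + j <= 2)%N -> D u2 i j \o @reflect_x R =
    (fun z => -1 * (-1) ^+ i * D u2 i j z) %[ae mu2 R in @strip R].
  move=> ij; apply: (@weak_derivative_parity _ (i, j) (-1) _ _ (w2 i j ij)).
  by apply: ae_imp S2 => z H /H; rewrite /= mulN1r; exact.
have [p1 wp1 _] := HP (1%N, 0%N) isT; have {wp1}wp1 := wD_weak_derivative wp1.
have [p2 wp2 _] := HP (0%N, 1%N) isT; have {wp2}wp2 := wD_weak_derivative wp2.
pose lap1 := wlaplacian u1; pose lap2 := wlaplacian u2.
have Ll1 : Lploc 1 (@strip R) lap1.
  have [_ La _] := w1 2%N 0%N isT; have [_ Lb _] := w1 0%N 2%N isT.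
  exact: (LplocD La Lb).
have Ll2 : Lploc 1 (@strip R) lap2.
  have [_ La _] := w2 2%N 0%N isT; have [_ Lb _] := w2 0%N 2%N isT.
  exact: (LplocD La Lb).
have e1 : lap1 \o @reflect_x R = (fun z => 1 * lap1 z) %[ae mu2 R in @strip R].
  apply: ae_imp2 (par1 2%N 0%N isT) (par1 0%N 2%N isT) => z h1 h2 zS.
  apply: etrans (congr2 +%R (h1 zS) (h2 zS)) _.
  rewrite /lap1 /wlaplacian -/(D u1 2%N 0%N) -/(D u1 0%N 2%N).
  by move: (D u1 2%N 0%N z) (D u1 0%N 2%N z) => s t /=; ring.
have e2 : lap2 \o @reflect_x R = (fun z => -1 * lap2 z) %[ae mu2 R in @strip R].
  apply: ae_imp2 (par2 2%N 0%N isT) (par2 0%N 2%N isT) => z h1 h2 zS.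
  apply: etrans (congr2 +%R (h1 zS) (h2 zS)) _.
  rewrite /lap2 /wlaplacian -/(D u2 2%N 0%N) -/(D u2 0%N 2%N).
  by move: (D u2 2%N 0%N z) (D u2 0%N 2%N z) => s t /=; ring.
pose A1 z := lap1 z + -1 * wdx P z; pose A2 z := lap2 z + -1 * wdy P z.
have AE : \forall z \ae mu2 R, @strip R z ->
    A1 z = (advection u z).1 /\ A2 z = (advection u z).2.
  apply: ae_imp NS => z H /H; rewrite /vlaplacian /wgrad => E.
  have /= E1 := congr1 fst E; have /= E2 := congr1 snd E.
  rewrite /A1 /A2 /lap1 /lap2.
  split; apply/eqP; rewrite -subr_eq0; apply/eqP.
    by rewrite -[RHS]oppr0 -[in RHS]E1 /advection/=; ring.
  by rewrite -[RHS]oppr0 -[in RHS]E2 /advection/=; ring.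
have advE z : advection u z =
    ((u z).1 * D u1 1%N 0%N z + (u z).2 * D u1 0%N 1%N z,
     (u z).1 * D u2 1%N 0%N z + (u z).2 * D u2 0%N 1%N z) by [].
have advpar : \forall z \ae mu2 R, @strip R z ->
    (advection u (reflect_x z)).1 = - (advection u z).1 /\
    (advection u (reflect_x z)).2 = (advection u z).2.
  have H1 := ae_in_and (par1 1%N 0%N isT) (par1 0%N 1%N isT).
  have H2 := ae_in_and (par2 1%N 0%N isT) (par2 0%N 1%N isT).
  have H3 := ae_in_and S1 S2.
  apply: ae_imp2 (ae_in_and H1 H2) H3 => z h h3 zS.
  have [[a1 a2] [a3 a4]] := h zS; have [a5 a6] := h3 zS.
  rewrite !advE; split.
    apply: etrans (congr2 +%R (congr2 *%R a5 a1) (congr2 *%R a6 a2)) _.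
    by move: (D u1 1%N 0%N z) (D u1 0%N 1%N z) (u z) => s t w /=; ring.
  apply: etrans (congr2 +%R (congr2 *%R a5 a3) (congr2 *%R a6 a4)) _.
  by move: (D u2 1%N 0%N z) (D u2 0%N 1%N z) (u z) => s t w /=; ring.
have Apar : \forall z \ae mu2 R, @strip R z ->
    A1 (reflect_x z) = -1 * A1 z /\ A2 (reflect_x z) = 1 * A2 z.
  apply: ae_imp2 (ae_in_and AE (ae_reflect_strip AE)) advpar => z h1 h2 zS.
  have [[b1 b2] [b3 b4]] := h1 zS; have [b5 b6] := h2 zS.
  rewrite mul1r mulN1r; split.
    exact: (etrans b3 (etrans b5 (congr1 -%R (esym b1)))).
  exact: (etrans b4 (etrans b6 (esym b2))).
have e3 : A1 \o @reflect_x R = (fun z => -1 * A1 z) %[ae mu2 R in @strip R].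
  by apply: ae_imp Apar => z H zS; have [h1 h2] := H zS; exact: h1.
have e4 : A2 \o @reflect_x R = (fun z => 1 * A2 z) %[ae mu2 R in @strip R].
  by apply: ae_imp Apar => z H zS; have [h1 h2] := H zS; exact: h2.
have := curl_cancel_nonlinear Ll1 Ll2 wp1 wp2 (erefl A1) (erefl A2) e1 e2 e3 e4 bp bq.
have lapE h p' q' a' b' : Xspace 2 h -> bump_on a' b' p' -> bump_on (-1) 1 q' ->
    test_pairing (wlaplacian h) p' q' =
    test_pairing h p'^[2] q' + test_pairing h p' q'^[2].
  move=> Xh bp' bq'.
  have wa := Xspace_weak_derivative (al := (2%N, 0%N)) Xh isT.
  have wb := Xspace_weak_derivative (al := (0%N, 2%N)) Xh isT.
  have [_ La _] := wa; have [_ Lb _] := wb.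
  rewrite (_ : wlaplacian h = (fun z => wD (@strip R) (2%N, 0%N) h z +
    1 * wD (@strip R) (0%N, 2%N) h z)); last first.
    by apply/funext => z; rewrite /wlaplacian mul1r.
  apply: etrans (test_pairing_lin 1 La Lb bp' bq') _.
  have Ea := test_pairing_weak_derivative wa bp' bq'.
  have Eb := test_pairing_weak_derivative wb bp' bq'.
  apply: etrans (congr2 (fun s t => s + 1 * t) Ea Eb) _.
  by rewrite /= addn0 add0n sqrrN expr1n !mul1r.
rewrite (lapE _ _ _ _ _ X1 bp (bump_on_derive1n 1 bq)).
rewrite (lapE _ _ _ _ _ X2 (bump_on_derive1n 1 bp) bq).
by rewrite -!derive1nD2.
Qed.

Lemma ns_div Phi u P : ns_solution Phi u P ->
  forall a b p q, bump_on a b p -> bump_on (-1) 1 q ->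
  test_pairing (fst \o u) p^[1] q + test_pairing (snd \o u) p q^[1] = 0.
Proof.
move=> [[X1 X2] _ _ _ [_ DV _]] a b p q bp bq.
have wa := Xspace_weak_derivative (al := (1%N, 0%N)) X1 isT.
have wb := Xspace_weak_derivative (al := (0%N, 1%N)) X2 isT.
have [_ La _] := wa; have [_ Lb _] := wb.
have sp : smooth p by case: bp.
have sq : smooth q by case: bq.
pose D1 := wD (@strip R) (1%N, 0%N) (fst \o u).
pose D2 := wD (@strip R) (0%N, 1%N) (snd \o u).
have L1 : Lploc 1 (@strip R) D1 by exact: La.
have L2 : Lploc 1 (@strip R) D2 by exact: Lb.
have mD : measurable_fun (@strip R : set plane) (fun z => D1 z + 1 * D2 z).
  apply: measurable_funD; first exact: L1.1.
  by apply: measurable_funM; [exact: measurable_cst|exact: L2.1].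
have E0 : (fun z => D1 z + 1 * D2 z) = (fun _ => 0) %[ae mu2 R in @strip R].
  apply: ae_imp DV => z H zS; apply: etrans (H zS).
  by rewrite mul1r; reflexivity.
have Z : test_pairing (fun _ => 0) p q = 0.
  rewrite /test_pairing; under eq_Rintegral do rewrite mul0r.
  by rewrite Rintegral_cst ?mul0r//; exact: open_plane_measurable open_strip.
have E1 := test_pairing_lin 1 L1 L2 bp bq.
have m0 : measurable_fun (@strip R : set plane) (fun _ : plane => 0 : R).
  exact: measurable_cst.
have E2 := test_pairing_ae mD m0 sp sq E0.
have Ea := test_pairing_weak_derivative wa bp bq.
have Eb := test_pairing_weak_derivative wb bp bq.
have := etrans (esym (congr2 (fun s t => s + 1 * t) Ea Eb)) (etrans (esym E1) (etrans E2 Z)).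
rewrite /= addn0 add0n expr1 => E; apply/eqP; rewrite -oppr_eq0; apply/eqP.
by rewrite -[RHS]E; ring.
Qed.

(** The L2 norm is the term of order (0, 0) in the sum that defines the norm.
    *)
Lemma Hnorm_ge_L2 m Om f : (\int[mu2 R]_(z in Om) (wD Om (0%N, 0%N) f z ^+ 2)%:E <=
  Hnorm m Om f `^ 2)%E.
Proof.
rewrite /Hnorm -poweRrM mulVf ?pnatr_eq0// poweRe1; last first.
  apply: sume_ge0 => i _; apply: sume_ge0 => j _; apply: integral_ge0 => z _.
  by rewrite lee_fin sqr_ge0.
rewrite big_ord_recl big_mkcond/= big_ord_recl/= -addeA leeDl//.
apply: adde_ge0; last apply: sume_ge0 => i _.
  apply: sume_ge0 => j _; case: ifP => // _; apply: integral_ge0 => z _.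
  by rewrite lee_fin sqr_ge0.
apply: sume_ge0 => j _; apply: integral_ge0 => z _.
by rewrite lee_fin sqr_ge0.
Qed.

Lemma weak_derivative_self Om f : Lploc 1 Om f -> weak_derivative Om (0%N, 0%N) f f.
Proof. by move=> Lf; split=> // phi _; rewrite expr0 mul1r. Qed.

Lemma mu2_box a : mu2 R (box a (a + 1) (-1) 1) = 2%:E.
Proof.
rewrite /box product_measure1E; [|exact: measurable_itv|exact: measurable_itv].
have E1 : mu `[a, (a + 1)]%classic = 1%:E.
  by rewrite lebesgue_measure_itv/= lte_fin ltrDl ltr01 -EFinB addrAC subrr add0r.
have E2 : mu `[-1, 1]%classic = 2%:E.
  by rewrite lebesgue_measure_itv/= lte_fin ifT; [rewrite -EFinB opprK|lra].
by rewrite [X in (X * _)%E]E1 [X in (_ * X)%E]E2 mul1e.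
Qed.

Lemma box_strip_rect_negligible a :
  mu2 R (box a (a + 1) (-1) 1 `\` strip_rect a) = 0%E.
Proof.
have mB := @box_measurable R a (a + 1) (-1) 1.
have mS := open_plane_measurable (@open_strip_rect R a).
have SB : strip_rect a `<=` box a (a + 1) (-1) 1.
  by move=> z [/andP[z1 z2] /andP[z3 z4]]; apply/boxP; rewrite !ltW.
apply: etrans (measureD mB mS (@box_mu2_fin R _ _ _ _)) _.
rewrite (setIidr SB) [X in (_ - X)%E]mu2_strip_rect.
by rewrite [X in (X - _)%E]mu2_box subee.
Qed.

Lemma integral_box_strip_rect F a : continuous F -> (forall z, 0 <= F z) ->
  (\int[mu2 R]_(z in box a (a + 1) (-1) 1) (F z)%:E =
   \int[mu2 R]_(z in strip_rect a) (F z)%:E)%E.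
Proof.
move=> cF F0; have mF := continuous_plane_measurable cF.
have mB := @box_measurable R a (a + 1) (-1) 1.
have mS := open_plane_measurable (@open_strip_rect R a).
have H := @ge0_negligible_integral _ _ _ (mu2 R) (box a (a + 1) (-1) 1)
  (box a (a + 1) (-1) 1 `\` strip_rect a) (EFin \o F).
apply: etrans (H _ _ _ _ _) _.
- exact: measurableD.
- exact: mB.
- by apply/measurable_EFinP; exact: measurable_funS mF.
- by move=> z _; rewrite lee_fin.
- exact: box_strip_rect_negligible.
- congr (integral _ _ _); apply/seteqP; split=> z.
    by move=> [Bz nz]; apply: contrapT => Sz; exact: nz.
  move=> Sz; split; last by move=> [].
  by case: Sz => /andP[z1 z2] /andP[z3 z4]; apply/boxP; rewrite !ltW.
Qed.

(** The norm in X^m is expressed with the chosen weak derivatives on open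
    rectangles. The one of order (0, 0) agrees with f almost everywhere, and
    passing to the closed rectangle adds a null set. *)
Lemma Xspace_L2_bound m f F : Xspace m f -> continuous F ->
  F = f %[ae mu2 R in @strip R] -> exists C, forall a,
    \int[mu2 R]_(z in box a (a + 1) (-1) 1) (F z ^+ 2) <= C.
Proof.
move=> [[_ Hf] Xfin] cF Ff.
have [_ [Lf _ _] _] := Hf (0%N, 0%N) isT.
have X0 a : (Hnorm m (strip_rect a) f <= Xnorm m f)%E.
  by apply: ereal_sup_ubound; exists a.
have Xge0 : (0 <= Xnorm m f)%E by apply: le_trans (X0 0); exact: poweR_ge0.
have fin : (Xnorm m f `^ 2 < +oo)%E.
  by move: Xfin Xge0; case: (Xnorm m f) => //= r _ _; rewrite ltry.
exists (fine (Xnorm m f `^ 2)%E) => a.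
have oS := @open_strip_rect R a.
have mS := open_plane_measurable oS.
have Lfa : Lploc 1 (strip_rect a) f := Lploc_sub open_strip (@strip_rect_sub R a) Lf.
have w := weak_derivative_self Lfa.
have w0 := wD_weak_derivative w.
have E : wD (strip_rect a) (0%N, 0%N) f = f %[ae mu2 R in strip_rect a].
  exact: weak_derivative_unique oS w0 w (ae_refl _ _).
have c2 : continuous (fun z => F z ^+ 2) by move=> z; apply: (@continuous_comp _ _ _ F (fun t => t ^+ 2)); [exact: cF|exact: exprn_continuous].
have F2 z : 0 <= F z ^+ 2 by exact: sqr_ge0.
have I : (\int[mu2 R]_(z in box a (a + 1) (-1) 1) (F z ^+ 2)%:E =
    \int[mu2 R]_(z in strip_rect a) (wD (strip_rect a) (0%N, 0%N) f z ^+ 2)%:E)%E.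
  rewrite (integral_box_strip_rect a c2 F2); apply: ae_eq_integral => //.
  - by apply/measurable_EFinP; exact: measurable_funS (continuous_plane_measurable c2).
  - by apply/measurable_EFinP; apply: measurable_funX; have [_ [? _] _] := w0.
  - apply: ae_imp2 E Ff => z h1 h2 zS.
    by rewrite (h1 zS) (h2 (strip_rect_sub zS)).
rewrite /Rintegral I; apply: fine_le.
- rewrite -I; apply: integrable_fin_num; first exact: box_measurable.
  exact: box_integrable.
- by rewrite ge0_fin_numE// poweR_ge0.
- apply: le_trans (Hnorm_ge_L2 m _ _) _.
  by apply: gt0_ler_poweR => //; rewrite ?in_itv/= ?leey ?andbT ?poweR_ge0.
Qed.

Lemma parabola_pm1 c : parabola c 1 = 0 /\ parabola c (-1) = 0.
Proof. by rewrite /parabola sqrrN expr1n subrr mulr0. Qed.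

Lemma parabola_bounded c y : -1 <= y <= 1 -> parabola c y ^+ 2 <= c ^+ 2.
Proof.
move=> /andP[y1 y2]; rewrite /parabola exprMn ler_piMr ?sqr_ge0//.
rewrite -[leRHS](expr1n _ 2) ler_sqr ?nnegrE ?ler01//; nra.
Qed.

(** The Poiseuille profile solves the homogeneous equations: it does not
    depend on x and its third derivative in y is zero. *)
Lemma test_pairing_parabola c a b p q i j : bump_on a b p -> bump_on (-1) 1 q ->
  (0 < i)%N || (2 < j)%N ->
  test_pairing (tensor (cst 1) (parabola c)) p^[i] q^[j] = 0.
Proof.
move=> bp bq ij.
have s1 : smooth (cst 1 : R -> R) by exact: smooth_cst.
have w := tensor_weak_derivative (@strip R) (i, j) s1 (smooth_parabola c).
have E := test_pairing_weak_derivative w bp bq.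
have Z : tensor (cst 1 : R -> R)^[i] (parabola c)^[j] = fun _ => 0.
  apply/funext => z; rewrite /tensor; case: i j ij {w E} => [|i] [|[|[|j]]]// _;
    rewrite ?derive1n_cst ?mul0r//.
  suff -> : (parabola c)^[j.+3] = cst 0 by rewrite mulr0.
  elim: j => [|j IH]; first by rewrite derive1nS derive1n2_parabola derive1_cst_fun.
  by rewrite derive1nS IH derive1_cst_fun.
have Z0 : test_pairing (fun _ => 0) p q = 0.
  rewrite /test_pairing; under eq_Rintegral do rewrite mul0r.
  by rewrite Rintegral_cst ?mul0r//; exact: open_plane_measurable open_strip.
move: E; rewrite /= Z Z0 => /esym/eqP; rewrite mulf_eq0 => /orP[|/eqP//].
by rewrite signr_eq0.
Qed.

Definition perturbation1 v c (z : R * R) : R := (clamped v z).1 - parabola c (clamp z.2).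
Definition perturbation2 v (z : R * R) : R := (clamped v z).2.

Lemma clamped_strip v z : @strip R z -> clamped v z = v z.
Proof.
move=> /andP[z1 z2]; rewrite /clamped clampE ?ltW//.
by rewrite -surjective_pairing.
Qed.

Lemma continuous_clamped1 v : {within @closed_strip R, continuous v} ->
  continuous (fst \o clamped v).
Proof.
by move=> /continuous_clamped cc z; exact: (cvg_comp _ _ (cc z) cvg_fst).
Qed.

Lemma continuous_perturbation1 v c : {within @closed_strip R, continuous v} ->
  continuous (perturbation1 v c).
Proof.
move=> cv z; apply: cvgB; first exact: continuous_clamped1.
have cp : {for clamp z.2, continuous (parabola c)}.
  by apply: smooth_continuous; exact: smooth_parabola.
have cs : {for z, continuous (fun w : R * R => clamp w.2)}.
  exact: (cvg_comp _ _ (@cvg_snd _ _ (nbhs z.1) (nbhs z.2) _) (@continuous_clamp z.2)).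
exact: (@continuous_comp _ _ _ (fun w : R * R => clamp w.2) (parabola c) z cs cp).
Qed.

Lemma continuous_perturbation2 v : {within @closed_strip R, continuous v} ->
  continuous (perturbation2 v).
Proof.
by move=> /continuous_clamped cc z; exact: (cvg_comp _ _ (cc z) cvg_snd).
Qed.

Lemma perturbation1_weak v u c a b p q i j :
  {within @closed_strip R, continuous v} -> v = u %[ae mu2 R in @strip R] ->
  Lploc 1 (@strip R) (fst \o u) ->
  bump_on a b p -> bump_on (-1) 1 q -> (0 < i)%N || (2 < j)%N ->
  test_pairing (perturbation1 v c) p^[i] q^[j] = test_pairing (fst \o u) p^[i] q^[j].
Proof.
move=> cv vu L1 bp bq ij.
have cK : continuous (tensor (cst 1) (parabola c)).
  apply: continuous_tensor; apply: smooth_continuous; first exact: smooth_cst.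
  exact: smooth_parabola.
have LK := continuous_Lploc 1 (@strip R) cK.
have bp' := bump_on_derive1n i bp; have bq' := bump_on_derive1n j bq.
have E := test_pairing_lin (-1) L1 LK bp' bq'.
rewrite (test_pairing_parabola c bp bq ij) mulr0 addr0 in E.
rewrite -[RHS]E; have [sp _] := bp'; have [sq _] := bq'.
apply: test_pairing_ae => //.
- apply: measurable_funS (continuous_plane_measurable _) => //.
  exact: continuous_perturbation1.
- apply: measurable_funD; first exact: L1.1.
  by apply: measurable_funM => //; exact: LK.1.
- apply: ae_imp vu => z H zS; rewrite /perturbation1 (clamped_strip _ zS) (H zS).
  have /andP[z1 z2] := zS.
  by rewrite clampE ?ltW// /tensor/= mul1r mulN1r.
Qed.

Lemma perturbation2_weak v u p q :
  {within @closed_strip R, continuous v} -> v = u %[ae mu2 R in @strip R] ->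
  Lploc 1 (@strip R) (snd \o u) -> smooth p -> smooth q ->
  test_pairing (perturbation2 v) p q = test_pairing (snd \o u) p q.
Proof.
move=> cv vu L1 sp sq; apply: test_pairing_ae => //.
- apply: measurable_funS (continuous_plane_measurable _) => //.
  exact: continuous_perturbation2.
- exact: L1.1.
- apply: ae_imp vu => z H zS; rewrite /perturbation2 (clamped_strip _ zS).
  by rewrite (H zS).
Qed.

Lemma perturbation1_bounded v u c m :
  {within @closed_strip R, continuous v} -> v = u %[ae mu2 R in @strip R] ->
  Xspace m (fst \o u) -> exists C, forall a,
    \int[mu2 R]_(z in box a (a + 1) (-1) 1) (perturbation1 v c z ^+ 2) <= C.
Proof.
move=> cv vu X.
have vu1 : fst \o clamped v = fst \o u %[ae mu2 R in @strip R].
  by apply: ae_imp vu => z H zS; rewrite /= (clamped_strip _ zS) (H zS).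
have c1 := continuous_clamped1 cv.
have [C HC] := Xspace_L2_bound X c1 vu1.
have sqrc F : continuous F -> continuous (fun z => F z ^+ 2).
  move=> cF z; apply: (@continuous_comp _ _ _ F (fun t => t ^+ 2)); first exact: cF.
  exact: exprn_continuous.
exists (2 * C + 2 * c ^+ 2 * 2) => a.
set B := box a (a + 1) (-1) 1.
have mB : measurable (B : set plane) := @box_measurable R a (a + 1) (-1) 1.
have i1 := box_integrable a (a + 1) (-1) 1 (sqrc _ (continuous_perturbation1 (c := c) cv)).
have i2 := box_integrable a (a + 1) (-1) 1 (sqrc _ c1).
have i3 : (mu2 R).-integrable B (EFin \o (fun z : plane => 2 * (clamped v z).1 ^+ 2)).
  apply: box_integrable => z; apply: cvgM; [exact: cvg_cst|exact: (sqrc _ c1)].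
have i4 : (mu2 R).-integrable B (EFin \o (fun z : plane => 2 * c ^+ 2)).
  by apply: box_integrable => z; exact: cvg_cst.
have i5 : (mu2 R).-integrable B
    (EFin \o (fun z : plane => 2 * (clamped v z).1 ^+ 2 + 2 * c ^+ 2)).
  apply: box_integrable => z; apply: cvgD; last exact: cvg_cst.
  apply: cvgM; [exact: cvg_cst|exact: (sqrc _ c1)].
have H1 : \int[mu2 R]_(z in B) (perturbation1 v c z ^+ 2) <=
    \int[mu2 R]_(z in B) (2 * (clamped v z).1 ^+ 2 + 2 * c ^+ 2).
  apply: le_Rintegral => // z _; rewrite /perturbation1.
  have := parabola_bounded c (clamp_in z.2).
  move: (clamped v z).1 (parabola _ _) => s t; have := sqr_ge0 (s + t); nra.
apply: le_trans H1 _; rewrite (RintegralD mB i3 i4) (RintegralZl 2 mB i2).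
rewrite (Rintegral_cst _ mB) [X in fine X]mu2_box.
by have := HC a; move: (\int[_]_(z in _) _) => *; lra.
Qed.

Lemma segment_integral_diff0 a b (p q : R -> R) : continuous p -> continuous q ->
  \int[mu]_(x in `[a, b]) p x = \int[mu]_(x in `[a, b]) q x ->
  \int[mu]_(x in `[a, b]) (p x - q x) = 0.
Proof.
move=> cp cq E.
have cN : continuous (fun x => -1 * q x).
  by apply: (continuousMf _ cq) => x; exact: cvg_cst.
apply: etrans (eq_segment_integral (g := fun x => p x + -1 * q x) _) _.
  by move=> x _; rewrite mulN1r.
rewrite (segment_integralD _ _ cp cN) (segment_integralZ _ _ (-1) cq).
by rewrite E mulN1r subrr.
Qed.

(** The Poiseuille profile with the same flux drops out of the divergence and
    curl equations, so the perturbation inherits them from u; its flux is Phi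
    - 4/3 * (3/4 Phi) = 0. *)
Lemma ns_stokes_pair Phi u P v : ns_solution Phi u P ->
  continuous_representative u v ->
  (forall x, v (x, 1) = 0 /\ v (x, -1) = 0) ->
  \int[mu]_(y in `[-1, 1]) (v (0, y)).1 = Phi ->
  stokes_pair (perturbation1 v (3 / 4 * Phi)) (perturbation2 v).
Proof.
move=> S [cv vu] v0 flux; have [[X1 X2] _ _ _ _] := S.
set c := 3 / 4 * Phi.
have cf : continuous (perturbation1 v c) := continuous_perturbation1 cv.
have cg : continuous (perturbation2 v) := continuous_perturbation2 cv.
have [[_ H1] _] := X1; have [_ [L1 _ _] _] := H1 (0%N, 0%N) isT.
have [[_ H2] _] := X2; have [_ [L2 _ _] _] := H2 (0%N, 0%N) isT.
have out x y : ~~ (-1 < y < 1) -> clamped v (x, y) = 0.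
  by move=> /clamp_out; rewrite /clamped /= => -[->|->]; have [] := v0 x.
have parout y : ~~ (-1 < y < 1) -> parabola c (clamp y) = 0.
  by move=> /clamp_out; have [p1 p2] := parabola_pm1 c => -[->|->].
have cw F a b p i q j : continuous F -> bump_on a b p -> bump_on (-1) 1 q ->
    continuous (fun y => xpairing F a b p^[i] y * q^[j] y).
  move=> cF bp bq; apply: continuousMf.
    by apply: continuous_xpairing => //; exact: bump_on_continuous (bump_on_derive1n i bp).
  exact: bump_on_continuous (bump_on_derive1n j bq).
have tp F a b p i q j : continuous F -> bump_on a b p -> bump_on (-1) 1 q ->
    \int[mu]_(y in `[-1, 1]) (xpairing F a b p^[i] y * q^[j] y) =
    test_pairing F p^[i] q^[j].
  move=> cF bp bq; apply/esym; apply: test_pairing_continuous => //.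
    exact: bump_on_derive1n.
  exact: bump_on_derive1n.
split=> //.
- by move=> x y h; rewrite /perturbation1 out// parout// subr0.
- by move=> x y h; rewrite /perturbation2 out.
- have E : \int[mu]_(y in `[-1, 1]) perturbation1 v c (0, y) =
      \int[mu]_(y in `[-1, 1]) ((clamped v (0, y)).1 + parabola (- c) y).
    apply: eq_segment_integral => y h.
    by rewrite /perturbation1 /= clampE// /parabola; ring.
  rewrite E segment_integralD; last 2 first.
  + exact: (continuous_pairL (continuous_clamped1 cv)).
  + exact: smooth_continuous (smooth_parabola _).
  rewrite integral_parabola.
  have -> : \int[mu]_(y in `[-1, 1]) (clamped v (0, y)).1 = Phi.
    rewrite -flux; apply: eq_segment_integral => y h.
    by rewrite /clamped /= clampE.
  by rewrite /c; field.
- move=> a b p q _ bp bq; rewrite segment_integralD; last 2 first.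
  + exact: (cw _ _ _ _ 1%N _ 0%N cf bp bq).
  + exact: (cw _ _ _ _ 0%N _ 1%N cg bp bq).
  have T1 := tp _ _ _ _ 1%N _ 0%N cf bp bq.
  have T2 := tp _ _ _ _ 0%N _ 1%N cg bp bq.
  apply: etrans (congr2 +%R T1 T2) _.
  have [sp _] := bp; have [sq _] := bq.
  have P1 := @perturbation1_weak _ _ c _ _ _ _ 1%N 0%N cv vu L1 bp bq isT.
  have P2 := perturbation2_weak cv vu L2 sp (smooth_derive1n 1 sq).
  by apply: etrans (congr2 +%R P1 P2) _; exact: (ns_div S bp bq).
- move=> a b p q _ bp bq.
  have [sp _] := bp; have [sq _] := bq.
  have P1 := @perturbation1_weak _ _ c _ _ _ _ 2%N 1%N cv vu L1 bp bq isT.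
  have P2 := @perturbation1_weak _ _ c _ _ _ _ 0%N 3%N cv vu L1 bp bq isT.
  have P3 := perturbation2_weak cv vu L2 (smooth_derive1n 3 sp) sq.
  have P4 := perturbation2_weak cv vu L2 (smooth_derive1n 1 sp) (smooth_derive1n 2 sq).
  have T1 := tp _ _ _ _ 2%N _ 1%N cf bp bq.
  have T2 := tp _ _ _ _ 0%N _ 3%N cf bp bq.
  have T3 := tp _ _ _ _ 3%N _ 0%N cg bp bq.
  have T4 := tp _ _ _ _ 1%N _ 2%N cg bp bq.
  have c1 := cw _ _ _ _ 2%N _ 1%N cf bp bq.
  have c2 := cw _ _ _ _ 0%N _ 3%N cf bp bq.
  have c3 := cw _ _ _ _ 3%N _ 0%N cg bp bq.
  have c4 := cw _ _ _ _ 1%N _ 2%N cg bp bq.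
  pose G1 y := xpairing (perturbation1 v c) a b p^[2] y * q^[1] y +
    xpairing (perturbation1 v c) a b p y * q^[3] y.
  pose G2 y := xpairing (perturbation2 v) a b p^[3] y * q y +
    xpairing (perturbation2 v) a b p^[1] y * q^[2] y.
  have cG1 : continuous G1 by exact: (continuousDf c1 c2).
  have cG2 : continuous G2 by exact: (continuousDf c3 c4).
  have I1 := etrans (segment_integralD (-1) 1 c1 c2)
    (congr2 +%R (etrans T1 P1) (etrans T2 P2)).
  have I2 := etrans (segment_integralD (-1) 1 c3 c4)
    (congr2 +%R (etrans T3 P3) (etrans T4 P4)).
  have I3 := ns_stokes S bp bq.
  have I : \int[mu]_(y in `[-1, 1]) G1 y = \int[mu]_(y in `[-1, 1]) G2 y.
    exact: (etrans I1 (etrans I3 (esym I2))).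
  rewrite -[LHS]/(\int[mu]_(y in `[-1, 1]) (G1 y - G2 y)).
  clearbody G1 G2; exact: segment_integral_diff0.
- exact: (perturbation1_bounded c cv vu X1).
Qed.

Theorem velocity_unique Phi u P : ns_solution Phi u P ->
  u = poiseuille_u Phi %[ae mu2 R in @strip R].
Proof.
move=> S; have [_ _ _ _ [_ _ [v [rv v0 flux]]]] := S.
have [f0 g0] := stokes_pair_zero (ns_stokes_pair S rv v0 flux).
have [_ vu] := rv; apply: ae_imp vu => z H zS; rewrite -(H zS).
have /andP[z1 z2] := zS.
have /eqP := f0 z; have := g0 z.
rewrite /perturbation1 /perturbation2 (clamped_strip _ zS) subr_eq0 => E2 /eqP E1.
apply: injective_projections; rewrite /= /GRing.scale/=.
  by rewrite E1 clampE ?ltW// /parabola mulr1.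
by rewrite E2 mulr0.
Qed.

End velocity_uniqueness.

(** * Uniqueness of the pressure *)

Section pressure.
Context {R : realType}.
Notation mu := (@lebesgue_measure R).
Notation plane := (measurableTypeR R * measurableTypeR R)%type.
Implicit Types (f g h F phi : R * R -> R) (p q : R -> R) (a b c d x y s : R).
Implicit Types (Om : set (R * R)) (u v : R * R -> R * R) (Phi : R).

Lemma test_pairing_linL h k a b p p' q : Lploc 1 (@strip R) h ->
  bump_on a b p -> bump_on a b p' -> bump_on (-1) 1 q ->
  test_pairing h (fun x => p x + k * p' x) q =
  test_pairing h p q + k * test_pairing h p' q.
Proof.
move=> Lh bp bp' bq; have [c [d [c1 d1 bq']]] := bump_on_shrink bq.
have BS := @box_in_strip R a b c d c1 d1.
have cp := bump_on_continuous bp; have cp' := bump_on_continuous bp'.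
have cq := bump_on_continuous bq.
have out z : ~ box a b c d z -> tensor p q z = 0 by exact: tensor_out.
have out' z : ~ box a b c d z -> tensor p' q z = 0 by exact: tensor_out.
have out2 z : ~ box a b c d z -> tensor (fun x => p x + k * p' x) q z = 0.
  by apply: tensor_out bq'; exact: bump_on_lin.
rewrite /test_pairing !(integral_box_support _ BS) //.
have i1 := test_pairing_integrable Lh BS cp cq.
have i2 := test_pairing_integrable Lh BS cp' cq.
have mB := @box_measurable R a b c d.
rewrite -(RintegralZl k mB i2) -RintegralD//; last first.
  rewrite (_ : _ \o _ = fun z => (k%:E * ((h z * tensor p' q z)%R)%:E)%E).
    exact: integrableZl.
  by apply/funext => z /=; rewrite EFinM.
by apply: eq_Rintegral => z _; rewrite /tensor; ring.
Qed.

Lemma test_pairing_linR h k a b p q q' : Lploc 1 (@strip R) h ->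
  bump_on a b p -> bump_on (-1) 1 q -> bump_on (-1) 1 q' ->
  test_pairing h p (fun y => q y + k * q' y) =
  test_pairing h p q + k * test_pairing h p q'.
Proof.
move=> Lh bp bq bq'; have bl := bump_on_lin k bq bq'.
have [c [d [c1 d1 b1]]] := bump_on_shrink bq.
have [c' [d' [c1' d1' b1']]] := bump_on_shrink bq'.
pose C := Num.min c c'; pose D := Num.max d d'.
have BS : box a b C D `<=` @strip R.
  by apply: box_in_strip; rewrite ?lt_min ?gt_max ?c1 ?d1.
have b2 : bump_on C D q by apply: bump_on_sub b1; rewrite ?ge_min ?le_max lexx.
have b2' : bump_on C D q' by apply: bump_on_sub b1'; rewrite ?ge_min ?le_max lexx orbT.
have cp := bump_on_continuous bp.
have cq := bump_on_continuous bq; have cq' := bump_on_continuous bq'.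
have out z : ~ box a b C D z -> tensor p q z = 0 by exact: tensor_out.
have out' z : ~ box a b C D z -> tensor p q' z = 0 by exact: tensor_out.
have out2 z : ~ box a b C D z -> tensor p (fun y => q y + k * q' y) z = 0.
  by apply: tensor_out bp _; exact: bump_on_lin.
rewrite /test_pairing !(integral_box_support _ BS) //.
have i1 := test_pairing_integrable Lh BS cp cq.
have i2 := test_pairing_integrable Lh BS cp cq'.
have mB := @box_measurable R a b C D.
rewrite -(RintegralZl k mB i2) -RintegralD//; last first.
  rewrite (_ : _ \o _ = fun z => (k%:E * ((h z * tensor p q' z)%R)%:E)%E).
    exact: integrableZl.
  by apply/funext => z /=; rewrite EFinM.
by apply: eq_Rintegral => z _; rewrite /tensor; ring.
Qed.

Lemma test_pairing_cst c a b p q : bump_on a b p -> bump_on (-1) 1 q ->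
  test_pairing (fun _ => c) p q =
  c * \int[mu]_(x in `[a, b]) p x * \int[mu]_(y in `[-1, 1]) q y.
Proof.
move=> bp bq; rewrite (test_pairing_continuous _ bp bq); last first.
  by move=> z; exact: cvg_cst.
have E y : xpairing (fun _ => c) a b p y = c * \int[mu]_(x in `[a, b]) p x.
  by rewrite /xpairing segment_integralZ//; exact: bump_on_continuous bp.
apply: etrans (eq_segment_integral
  (g := fun y => (c * \int[mu]_(x in `[a, b]) p x) * q y) _) _.
  by move=> y _; rewrite E.
by rewrite segment_integralZ//; exact: bump_on_continuous bq.
Qed.

Lemma bump_on_integral a b a' b' p : a' <= a -> b <= b' -> bump_on a b p ->
  \int[mu]_(x in `[a, b]) p x = \int[mu]_(x in `[a', b']) p x.
Proof.
move=> aa bb bp; apply: Rintegral_support => x /=; rewrite !in_itv/=.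
  move=> /andP[ax xb] /negP; rewrite (le_trans aa ax) (le_trans xb bb).
  by [].
move=> _ /negP h; apply: (bump_on_out bp).
by apply: contraNN h => /andP[h1 h2]; rewrite !ltW.
Qed.

(** Subtracting from p the multiple of r with the same integral leaves a bump
    of integral 0, whose antiderivative is again a bump. *)
Lemma bump_decomposition a b p r : bump_on a b p -> bump_on a b r ->
  \int[mu]_(x in `[a, b]) r x = 1 ->
  exists2 g, bump_on a b g & p = fun x => g^[1] x + (\int[mu]_(x in `[a, b]) p x) * r x.
Proof.
move=> bp br r1; set I := \int[mu]_(x in `[a, b]) p x.
have cp := bump_on_continuous bp; have cr := bump_on_continuous br.
have [|g bg gE] := bump_on_antiderivative (bump_on_lin (- I) bp br).
  apply: etrans (segment_integralD _ _ cp _) _; first exact: continuousZf.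
  by rewrite segment_integralZ// r1 mulr1 subrr.
exists g => //; apply/funext => x; rewrite derive1n1 gE; ring.
Qed.

(** Derivatives of bumps pair to zero with h in each variable, so by
    bump_decomposition the pairing of h with p(x) q(y) depends only on the
    integrals of p and q, as it does for a constant. The constant is the
    pairing with unit bumps. *)
Lemma weak_gradient0_cst h : Lploc 1 (@strip R) h ->
  (forall a b p q, bump_on a b p -> bump_on (-1) 1 q ->
    test_pairing h p^[1] q = 0) ->
  (forall a b p q, bump_on a b p -> bump_on (-1) 1 q ->
    test_pairing h p q^[1] = 0) ->
  exists c, h = (fun _ => c) %[ae mu2 R in @strip R].
Proof.
move=> Lh Hx Hy.
have [p0 bp0 ip0] := @unit_bump R 0 1 ltr01.
have [q0 bq0 iq0] : exists2 f, bump_on (-1) 1 f & \int[mu]_(x in `[-1, 1]) f x = 1.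
  by apply: unit_bump; lra.
exists (test_pairing h p0 q0).
have Lc : Lploc 1 (@strip R) (fun _ => test_pairing h p0 q0).
  by apply: continuous_Lploc => z; exact: cvg_cst.
apply: (ae_eq_from_tensors open_strip Lh Lc) => a b c d p q BS bp bq.
have [[z Bz]|/set0P/negP] := pselect (box a b c d !=set0); last first.
  rewrite negbK => /eqP B0; have T0 z : tensor p q z = 0.
    by apply: (tensor_out bp bq); rewrite B0.
  by apply: eq_Rintegral => z _; rewrite T0 !mulr0.
have /boxP[/andP[az zb] /andP[cz zd]] := Bz.
have bq1 : bump_on (-1) 1 q.
  apply: bump_on_sub bq.
    have /BS/andP[] : box a b c d (z.1, c); last by move=> /ltW.
    by apply/boxP; rewrite /= az zb lexx (le_trans cz zd).
  have /BS/andP[] : box a b c d (z.1, d); last by move=> _ /ltW.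
  by apply/boxP; rewrite /= az zb lexx (le_trans cz zd).
pose a' := Num.min a 0; pose b' := Num.max b 1.
have bp' : bump_on a' b' p by apply: bump_on_sub bp; rewrite ?ge_min ?le_max lexx.
have bp0' : bump_on a' b' p0.
  by apply: bump_on_sub bp0; rewrite ?ge_min ?le_max lexx orbT.
have ip0' : \int[mu]_(x in `[a', b']) p0 x = 1.
  by rewrite -ip0; apply/esym; apply: bump_on_integral bp0;
    rewrite ?ge_min ?le_max lexx orbT.
have [g bg pE] := bump_decomposition bp' bp0' ip0'.
have [k bk qE] := bump_decomposition bq1 bq0 iq0.
rewrite -[LHS]/(test_pairing h p q) -[RHS]/(test_pairing (fun _ => _) p q).
rewrite (test_pairing_cst _ bp' bq1).
set I := \int[mu]_(x in `[a', b']) p x in pE *.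
set J := \int[mu]_(x in `[-1, 1]) q x in qE *.
have E1 := test_pairing_linL I Lh (bump_on_derive1n 1 bg) bp0' bq1.
have E2 := test_pairing_linR J Lh bp0' (bump_on_derive1n 1 bk) bq0.
rewrite -pE (Hx _ _ _ _ bg bq1) add0r in E1.
rewrite -qE (Hy _ _ _ _ bp0' bk) add0r in E2.
by rewrite E1 E2; ring.
Qed.

Lemma test_pairing_same_derivative al h1 h2 g1 g2 a b p q :
  weak_derivative (@strip R) al h1 g1 -> weak_derivative (@strip R) al h2 g2 ->
  g1 = g2 %[ae mu2 R in @strip R] -> bump_on a b p -> bump_on (-1) 1 q ->
  test_pairing (fun z => h1 z + -1 * h2 z) p^[al.1] q^[al.2] = 0.
Proof.
move=> w1 w2 gE bp bq; have [L1 M1 _] := w1; have [L2 M2 _] := w2.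
have bp' := bump_on_derive1n al.1 bp; have bq' := bump_on_derive1n al.2 bq.
have [sp _] := bp; have [sq _] := bq.
apply: etrans (test_pairing_lin (-1) L1 L2 bp' bq') _.
have T1 := test_pairing_weak_derivative w1 bp bq.
have T2 := test_pairing_weak_derivative w2 bp bq.
have := etrans (esym T1) (etrans (test_pairing_ae M1.1 M2.1 sp sq gE) T2).
by move=> E; rewrite (mulfI _ E) ?signr_eq0// mulN1r subrr.
Qed.

Lemma pressure_unique Phi u P : ns_solution Phi u P ->
  exists c, P = (fun z => poiseuille_p Phi z + c) %[ae mu2 R in @strip R].
Proof.
move=> S; have uE := velocity_unique S.
have [[X1 X2] [_ HP] _ _ [NS _ _]] := S.
have [[[[m1 _] _] _] [[[m2 _] _] _]] := (X1, X2).
have [B _] := poiseuille_balance m1 m2 uE.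
have [px wpx _] := HP (1%N, 0%N) isT; have {wpx}wpx := wD_weak_derivative wpx.
have [py wpy _] := HP (0%N, 1%N) isT; have {wpy}wpy := wD_weak_derivative wpy.
have [LP _ _] := wpx.
have sl := smooth_scale_id (- (3 / 2 * Phi)).
have s1 : smooth (cst 1 : R -> R) by exact: smooth_cst.
have c0 : continuous (poiseuille_p Phi).
  by rewrite poiseuille_pE; apply: continuous_tensor; exact: smooth_continuous.
have L0 := continuous_Lploc 1 (@strip R) c0.
have wx : weak_derivative (@strip R) (1%N, 0%N) (poiseuille_p Phi)
    (fun _ => - (3 / 2 * Phi)).
  have := tensor_weak_derivative (@strip R) (1%N, 0%N) sl s1.
  rewrite -poiseuille_pE; congr weak_derivative.
  by apply/funext => z; rewrite /tensor /= derive1_scale mulr1.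
have wy : weak_derivative (@strip R) (0%N, 1%N) (poiseuille_p Phi) (fun _ => 0).
  have := tensor_weak_derivative (@strip R) (0%N, 1%N) sl s1.
  rewrite -poiseuille_pE; congr weak_derivative.
  by apply/funext => z; rewrite /tensor /= derive1_cst_fun mulr0.
have grad : \forall z \ae mu2 R, @strip R z ->
    wdx P z = - (3 / 2 * Phi) /\ wdy P z = 0.
  apply: ae_imp2 NS B => z h1 h2 zS; have := h1 zS; rewrite (h2 zS) /wgrad => E.
  have /= E1 := congr1 fst E; have /= E2 := congr1 snd E.
  move: E1 E2; move: (wdx P z) (wdy P z) => s t E1 E2.
  by split; [lra|rewrite add0r in E2].
have L : Lploc 1 (@strip R) (fun z => P z + -1 * poiseuille_p Phi z).
  rewrite (_ : (fun z => _) = (fun z => P z - poiseuille_p Phi z)).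
    exact: (LplocB open_strip LP L0).
  by apply/funext => z; rewrite mulN1r.
have [||c hc] := weak_gradient0_cst L.
- move=> a b p q bp bq.
  apply: (test_pairing_same_derivative wpx wx _ bp bq).
  by apply: ae_imp grad => z H zS; have [h1 _] := H zS; exact: h1.
- move=> a b p q bp bq.
  apply: (test_pairing_same_derivative wpy wy _ bp bq).
  by apply: ae_imp grad => z H zS; have [_ h2] := H zS; exact: h2.
exists c; apply: ae_imp hc => z H zS; have := H zS; rewrite mulN1r => <-.
by rewrite addrC subrK.
Qed.

End pressure.

Theorem corollary3 (R : realType) (Phi : R) (Phi_gt0 : 0 < Phi) :
  ns_solution Phi (poiseuille_u Phi) (poiseuille_p Phi) /\
  forall (u : R * R -> R * R) (p : R * R -> R), ns_solution Phi u p ->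
    u = poiseuille_u Phi %[ae mu2 R in @strip R] /\
    exists c : R,
      p = (fun z => poiseuille_p Phi z + c) %[ae mu2 R in @strip R].
Proof.
split; first exact: poiseuille_solution.
by move=> u p S; split; [exact: velocity_unique S|exact: pressure_unique S].
Qed.
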